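(* Let $\sigma:\mathbb{N}\to\mathbb{R}$ be a nonnegative, nondecreasing and unbounded function, and let $\epsilon$ be a real number with $0<\epsilon<1/4$. Then there exist a stationary ergodic probability measure $P$ on $\{0,1\}^\infty$, computable relative to $\sigma$, whose entropy $H$ satisfies $0<H\le\epsilon$, and an infinite binary sequence $\alpha$ such that $$d_P(\alpha^n)\le\sigma(n)\quad\text{for all sufficiently large } n,$$ and moreover $$\limsup_{n\to\infty}\frac{K(\alpha^n)}{n}\ge\frac14,\qquad \liminf_{n\to\infty}\frac{K(\alpha^n)}{n}\le\epsilon .$$
   Context: For an infinite binary sequence $\omega$, $\omega^n=\omega_1\dots\omega_n$ is its initial fragment of length $n$; $l(x)$ is the length of a word $x$; logarithms are base 2. $K(x)$ is the (plain, prefix-free not required) Kolmogorov complexity of a binary word $x$: the length of a shortest binary program $p$ with $\psi(p)=x$ for a fixed optimal (universal) partial computable decoding function $\psi$. $Km(x)$ is the monotone complexity: fix an optimal monotone decoding function $\psi$ given by an enumerable set $\hat\psi$ of pairs of words such that comparable first components have comparable second components, with $\psi(p)=\sup\{x:(p,x)\in\hat\psi\}$; then $Km(x)=\min\{l(p): x\subseteq\psi(p)\}$ ($x\subseteq y$ means $x$ is a prefix of $y$). For a probability measure $P$ on $\{0,1\}^\infty$, writing $P(x)$ for the measure of the set of sequences beginning with $x$, the randomness deficiency is $d_P(x)=-\log P(x)-Km(x)$. A measure is stationary if it is invariant under the left shift, and ergodic if every shift-invariant set has measure $0$ or $1$; $H$ is its (Shannon) entropy rate. ''Computable relative to $\sigma$''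 means there is an algorithm with oracle access to $\sigma$ that, given a word $x$ and rational $\delta>0$, outputs a rational $\delta$-approximation of $P(x)$. *)

(* Defs.v *)
From HB Require Import structures.
From mathcomp Require Import all_boot all_order all_algebra.
From mathcomp Require Import all_classical all_reals all_analysis.
Set Implicit Arguments. Unset Strict Implicit. Unset Printing Implicit Defensive.
Import Order.TTheory GRing.Theory Num.Theory.
Import numFieldNormedType.Exports.
Local Open Scope classical_set_scope.
Local Open Scope ring_scope.

(* bijective pairing nat * nat <-> nat : <a,b> = 2^a (2b+1) - 1 *)
Definition npair (a b : nat) : nat := (2 ^ a * b.*2.+1).-1.
Definition nfst (n : nat) : nat := logn 2 n.+1.
Definition nsnd (n : nat) : nat := ((n.+1 %/ 2 ^ nfst n).-1)./2.

Inductive code : Type :=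
| Czero | Csucc | Cfst | Csnd | Corc
| Ccomp (f h : code)
| Cpair (f h : code)
| Crec  (f h : code)
| Cmu   (f : code).

Inductive evalp (g : nat -> nat) : code -> nat -> nat -> Prop :=
| ev_zero x : evalp g Czero x 0
| ev_succ x : evalp g Csucc x x.+1
| ev_fst x : evalp g Cfst x (nfst x)
| ev_snd x : evalp g Csnd x (nsnd x)
| ev_orc x : evalp g Corc x (g x)
| ev_comp f h x y z : evalp g h x y -> evalp g f y z -> evalp g (Ccomp f h) x z
| ev_pair f h x a b : evalp g f x a -> evalp g h x b ->
    evalp g (Cpair f h) x (npair a b)
| ev_rec0 f h x y : evalp g f x y -> evalp g (Crec f h) (npair 0 x) y
| ev_recS f h n x r y : evalp g (Crec f h) (npair n x) r ->
    evalp g h (npair n (npair r x)) y -> evalp g (Crec f h) (npair n.+1 x) y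
| ev_mu f x n : evalp g f (npair n x) 0 ->
    (forall m, (m < n)%N -> exists2 v, v <> 0%N & evalp g f (npair m x) v) ->
    evalp g (Cmu f) x n.

Definition no_oracle : nat -> nat := fun _ => 0%N.

(* bijection {0,1}^* -> nat : empty |-> 0, w b |-> 2 enc(w) + 1 + b *)
Definition enc_word (w : seq bool) : nat :=
  foldl (fun n (b : bool) => (n.*2 + 1 + b)%N) 0%N w.

Definition enc_int (z : int) : nat :=
  match z with Posz n => n.*2 | Negz n => n.*2.+1 end.
Definition dec_int (n : nat) : int :=
  if odd n then Negz n./2 else Posz n./2.

Definition enc_rat (q : rat) : nat := npair (enc_int (numq q)) `|denq q|%N.
Definition dec_rat (n : nat) : rat := (dec_int (nfst n))%:~R / (nsnd n)%:R.

Definition word := seq bool.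

Definition pre (omega : nat -> bool) (n : nat) : word := mkseq omega n.

Definition pcomputable (phi : word -> option word) : Prop :=
  exists c : code, forall w v : word,
    phi w = Some v <-> evalp no_oracle c (enc_word w) (enc_word v).

(* complexity of x with respect to a decoding function (+oo if none) *)
Definition Kdec {R : realType} (phi : word -> option word) (x : word) : \bar R :=
  ereal_inf [set ((size p)%:R)%:E | p in [set p : word | phi p = Some x]].

Definition optimal_decoder {R : realType} (psi : word -> option word) : Prop :=
  pcomputable psi /\
  forall phi, pcomputable phi ->
    exists c : nat, forall x, (Kdec (R:=R) psi x <= Kdec (R:=R) phi x + (c%:R)%:E)%E.

Definition enumerable (S : set (word * word)) : Prop :=
  exists c : code, forall p x : word,
    S (p, x) <-> exists y, evalp no_oracle c (npair (enc_word p) (enc_word x)) y.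

Definition comparable (x y : word) : bool := prefix x y || prefix y x.

Definition monotone_graph (S : set (word * word)) : Prop :=
  forall p x p' x', S (p, x) -> S (p', x') -> comparable p p' -> comparable x x'.

(* x is a prefix of psi(p) = sup{y : (p,y) in S} (the y's form a chain) *)
Definition prefix_of_output (S : set (word * word)) (p x : word) : Prop :=
  x = [::] \/ exists y, S (p, y) /\ prefix x y.

Definition Kmon {R : realType} (S : set (word * word)) (x : word) : \bar R :=
  ereal_inf [set ((size p)%:R)%:E | p in [set p : word | prefix_of_output S p x]].

Definition optimal_monotone {R : realType} (S : set (word * word)) : Prop :=
  enumerable S /\ monotone_graph S /\
  forall S', enumerable S' -> monotone_graph S' ->
    exists c : nat, forall x, (Kmon (R:=R) S x <= Kmon (R:=R) S' x + (c%:R)%:E)%E.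

Definition cyl (x : word) : set (nat -> bool) :=
  [set omega | pre omega (size x) = x].

Definition cantor := g_sigma_algebraType (range cyl).

Definition shift (omega : cantor) : cantor := fun n => omega n.+1.

Definition log2 {R : realType} (x : R) : R := ln x / ln 2.

Section measures.
Context {R : realType}.
Variable P : probability cantor R.

Definition Pw (x : word) : R := fine (P (cyl x)).

Definition stationary : Prop :=
  forall A : set cantor, measurable A -> P (shift @^-1` A) = P A.

Definition ergodic : Prop :=
  forall A : set cantor, measurable A -> shift @^-1` A = A ->
    P A = 0%E \/ P A = 1%E.

Definition negplogp (p : R) : R := if p == 0 then 0 else - (p * log2 p).

Definition block_entropy_rate (n : nat) : R :=
  (\sum_(x : n.-tuple bool) negplogp (Pw x)) / n%:R.

Definition entropy_is (H : R) : Prop := block_entropy_rate @ \oo --> H.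

Definition deficiency (S : set (word * word)) (x : word) : \bar R :=
  ((if Pw x == 0%R then +oo else (- log2 (Pw x))%:E) - Kmon S x)%E.

Definition is_name (s : nat -> R) (g : nat -> nat) : Prop :=
  forall (n : nat) (d : rat), 0 < d ->
    `|ratr (dec_rat (g (npair n (enc_rat d)))) - s n| <= ratr d.

Definition computable_rel (s : nat -> R) : Prop :=
  exists c : code, forall g, is_name s g ->
    forall (x : word) (d : rat), 0 < d ->
      exists2 m, evalp g c (npair (enc_word x) (enc_rat d)) m &
        `|ratr (dec_rat m) - Pw x| <= ratr d.
End measures.

(* Main.v *)
(* Put independent coins on the positions of a sequence: a fair bit, and for each
   level j a mark of probability q_j. A level-j mark covers a block to its left,
   made of u_j fair bits followed by r u_j zeros, where u_j = 4 (r + 3)^j; a position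
   belongs to the highest level covering it, and uncovered positions are 0. The law P
   of the output is a factor of a Bernoulli shift, hence stationary and ergodic. Its
   entropy is small because ones are rare, and positive because both continuations
   are equally likely at a position carrying a fair bit.

   The rates satisfy q_j u_j = c (T_j - T_(j+1)) with T_j = 1 / (1 + sigma(u_j)). The
   probability that exactly one level of a group [J, J') puts a block near the origin,
   and the others none, is then of order T_J as soon as T_J' <= T_J / 2, so this event
   costs about log (1 + sigma(u_J)) bits. For groups sparse enough, conditioning on one
   block in each of the groups seen so far multiplies the probability of a word of
   length n by at most 2^sigma(n) / 4, and by the Kraft inequality some output of the
   conditioned process has deficiency at most sigma. Counting programs, that output can
   be chosen so that the fair part of every such block is incompressible; it starts at
   most 2 u_j after the origin, which gives the limsup, and the r u_j zeros after it
   give the liminf. All requirements concern finite prefixes, so Koenig's lemma produces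
   alpha. *)

Require Import Defs.
From HB Require Import structures.
From mathcomp Require Import all_boot all_order all_algebra.
From mathcomp Require Import all_classical all_reals all_analysis.
From mathcomp Require Import zify ring lra.
Set Implicit Arguments. Unset Strict Implicit. Unset Printing Implicit Defensive.
Import Order.TTheory GRing.Theory Num.Theory.
Import numFieldNormedType.Exports.
Local Open Scope classical_set_scope.
Local Open Scope ring_scope.

(** * Functionals recursive in an oracle *)

(** A slowly growing [sigma] may be constant over many scales, and the rates of those levels then
    vanish; only over a group of levels do the differences of the tails telescope to something of
    known size. Groups are affordable because [1 / (1 + sigma)] exceeds any constant multiple of
    [2^-sigma] once [sigma] is large: however small the probability of the stages already imposed,
    the next group can start so late that the allowance covers all of them. Words too short to see a
    group do not pay for it. Marks and fair bits are independent coordinates, so conditioning on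
    blocks leaves the coins fair and the count of programs applies unchanged. The fair part of a
    block ends before [3 u_j], and programs shorter than [3 u_j / 4] are excluded; this is the
    origin of [1/4]. The zeros have to outweigh that whole prefix and not only the fair part, so [r]
    is a multiple of 3. A constant [D] in the denominator of the rates makes ones rare, with
    probability at most [2 / D], and alone controls the upper bound on the entropy. *)

Lemma logn_double a b : (a + logn 2 b.*2.+1)%N = a.
Proof. by rewrite logn_coprime ?addn0 // coprime2n /= odd_double. Qed.

Lemma npair_inj a b a' b' : npair a b = npair a' b' -> a = a' /\ b = b'.
Proof.
rewrite /npair => /(congr1 S); rewrite !prednK ?muln_gt0 ?expn_gt0 // => h.
have ha : a = a'.
  have /(congr1 (logn 2)) := h.
  by rewrite !lognM ?expn_gt0 // !pfactorK // !logn_double.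
split=> //; move: h; rewrite ha => /eqP; rewrite eqn_pmul2l ?expn_gt0 //.
by rewrite eqSS => /eqP /double_inj.
Qed.

Lemma npairS a b : npair a.+1 b = (npair a b).*2.+1.
Proof.
rewrite /npair expnS -mulnA mul2n.
have : (0 < 2 ^ a * b.*2.+1)%N by rewrite muln_gt0 expn_gt0.
by case: (2 ^ a * _)%N => // k _ /=; rewrite doubleS.
Qed.

Lemma npair_surj n : exists a b, n = npair a b.
Proof.
have [m] := ubnP n; elim: m n => // m IH n.
rewrite ltnS => hn; case hodd: (odd n).
  have hnn : n = n./2.*2.+1 by rewrite -[LHS]odd_double_half hodd.
  have [|a [b hab]] := IH n./2.
    by apply: leq_trans hn; rewrite {2}hnn ltnS -addnn leq_addr.
  by exists a.+1, b; rewrite npairS -hab -hnn.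
exists 0%N, n./2; rewrite /npair expn0 mul1n /=.
by rewrite -[LHS]odd_double_half hodd.
Qed.

Lemma nfst_npair a b : nfst (npair a b) = a.
Proof.
rewrite /nfst /npair prednK ?muln_gt0 ?expn_gt0 //.
by rewrite lognM ?expn_gt0 // pfactorK // logn_double.
Qed.

Lemma nsnd_npair a b : nsnd (npair a b) = b.
Proof.
rewrite /nsnd nfst_npair /npair prednK ?muln_gt0 ?expn_gt0 //.
by rewrite mulKn ?expn_gt0 //= doubleK.
Qed.

Lemma npair_eta n : npair (nfst n) (nsnd n) = n.
Proof.
by have [a [b ->]] := npair_surj n; rewrite nfst_npair nsnd_npair.
Qed.

Lemma evalp_rec_inv g f h n x y : evalp g (Crec f h) (npair n x) y ->
  if n is n'.+1 then
    exists2 r, evalp g (Crec f h) (npair n' x) r & evalp g h (npair n' (npair r x)) y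
  else evalp g f x y.
Proof.
move=> e; inversion e; subst; match goal with E : npair _ _ = npair _ _ |- _ =>
  have [? ?] := npair_inj E end; subst=> //.
by eexists; eassumption.
Qed.

Lemma evalp_det g c x y y' : evalp g c x y -> evalp g c x y' -> y = y'.
Proof.
elim: c x y y' => [| | | | |f IHf h IHh|f IHf h IHh|f IHf h IHh|f IHf] x y y'.
- by move=> e e'; inversion e; inversion e'.
- by move=> e e'; inversion e; inversion e'.
- by move=> e e'; inversion e; inversion e'.
- by move=> e e'; inversion e; inversion e'.
- by move=> e e'; inversion e; inversion e'.
- move=> e e'; inversion e as [| | | | |? ? ? w ? hw hy| | | |].
  inversion e' as [| | | | |? ? ? w' ? hw' hy'| | | |]; subst.
  by rewrite -(IHh _ _ _ hw hw') in hy'; exact: IHf hy hy'.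
- move=> e e'; inversion e as [| | | | | |? ? ? a b ha hb| | |].
  inversion e' as [| | | | | |? ? ? a' b' ha' hb'| | |]; subst.
  by rewrite (IHf _ _ _ ha ha') (IHh _ _ _ hb hb').
- rewrite -(npair_eta x); move: (nfst x) (nsnd x) => n {}x.
  elim: n y y' => [|n IH] y y'.
    by move=> /evalp_rec_inv + /evalp_rec_inv; exact: IHf.
  move=> /evalp_rec_inv[r hr hy] /evalp_rec_inv[r' hr' hy'].
  by rewrite -(IH _ _ hr hr') in hy'; exact: IHh hy hy'.
- move=> e e'; inversion e as [| | | | | | | | |? ? ? h0 hpos].
  inversion e' as [| | | | | | | | |? ? ? h0' hpos']; subst.
  have [lt|gt|//] := ltngtP y y'.
    by have [v hv hev] := hpos' _ lt; case: hv; exact: IHf hev h0.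
  by have [v hv hev] := hpos _ gt; case: hv; exact: IHf hev h0'.
Qed.

(* [g] is the oracle; the functionals are total, hence primitive recursive in it *)
Definition crec (F : (nat -> nat) -> nat -> nat) : Prop :=
  exists c, forall g x, evalp g c x (F g x).

Lemma crec_ext F G : (forall g x, F g x = G g x) -> crec F -> crec G.
Proof. by move=> h [c hc]; exists c => g x; rewrite -h. Qed.

Lemma crec_comp F G : crec F -> crec G -> crec (fun g x => F g (G g x)).
Proof.
by move=> [c hc] [d hd]; exists (Ccomp c d) => g x; apply: ev_comp (hd _ _) (hc _ _).
Qed.

Lemma crec_pair F G :
  crec F -> crec G -> crec (fun g x => npair (F g x) (G g x)).
Proof. by move=> [c hc] [d hd]; exists (Cpair c d) => g x; apply: ev_pair. Qed.

Lemma crec_id : crec (fun _ x => x).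
Proof.
exists (Cpair Cfst Csnd) => g x; rewrite -{2}(npair_eta x).
by apply: ev_pair; constructor.
Qed.

Lemma crec_fst F : crec F -> crec (fun g x => nfst (F g x)).
Proof. by apply: (crec_comp (F := fun _ => nfst)); exists Cfst; constructor. Qed.

Lemma crec_snd F : crec F -> crec (fun g x => nsnd (F g x)).
Proof. by apply: (crec_comp (F := fun _ => nsnd)); exists Csnd; constructor. Qed.

Lemma crec_succ F : crec F -> crec (fun g x => (F g x).+1).
Proof. by apply: (crec_comp (F := fun _ => S)); exists Csucc; constructor. Qed.

Lemma crec_orc F : crec F -> crec (fun g x => g (F g x)).
Proof. by apply: (crec_comp (F := id)); exists Corc; constructor. Qed.

Lemma crec_const n : crec (fun _ _ => n).
Proof.
by elim: n => [|n IH]; [exists Czero; constructor | apply: crec_succ IH].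
Qed.

(** [Crec] recurses on the first component of a pair and keeps the second as a parameter. The whole
    input [x] is carried there, so that [F], [H] and [N] may all read it. *)
Lemma crec_rec (F : (nat -> nat) -> nat -> nat)
    (H : (nat -> nat) -> nat -> nat -> nat -> nat) (N : (nat -> nat) -> nat -> nat) :
  crec F -> crec (fun g y => H g (nfst y) (nfst (nsnd y)) (nsnd (nsnd y))) ->
  crec N ->
  crec (fun g x => nat_rect (fun _ => nat) (F g x) (fun n r => H g n r x) (N g x)).
Proof.
move=> [c hc] [d hd] hN.
have hR : crec (fun g y => nat_rect (fun _ => nat) (F g (nsnd y))
    (fun n r => H g n r (nsnd y)) (nfst y)).
  exists (Crec c d) => g y; rewrite -{1}(npair_eta y).
  elim: (nfst y) => [|n IH]; first exact: ev_rec0.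
  apply: (ev_recS IH).
  rewrite /=; set r := nat_rect _ _ _ n.
  by have := hd g (npair n (npair r (nsnd y))); rewrite !(nfst_npair, nsnd_npair).
apply: crec_ext (crec_comp hR (crec_pair hN crec_id)) => g x.
by rewrite nfst_npair nsnd_npair.
Qed.

Lemma crec_add F G : crec F -> crec G -> crec (fun g x => (F g x + G g x)%N).
Proof.
move=> hF hG.
apply: crec_ext (crec_rec hF (H := fun _ _ r _ => r.+1) _ hG).
  by move=> g x; elim: (G g x) => [|n /= ->]; rewrite ?addn0 ?addnS.
by apply/crec_succ/crec_fst/crec_snd/crec_id.
Qed.

Lemma crec_mul F G : crec F -> crec G -> crec (fun g x => (F g x * G g x)%N).
Proof.
move=> hF hG.
apply: crec_ext (crec_rec (crec_const 0) (H := fun g _ r x => (r + F g x)%N) _ hG).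
  by move=> g x; elim: (G g x) => [|n /= ->]; rewrite ?muln0 ?mulnS 1?addnC.
apply: crec_add; first by apply/crec_fst/crec_snd/crec_id.
by apply: crec_comp hF _; apply/crec_snd/crec_snd/crec_id.
Qed.

Lemma crec_exp F G : crec F -> crec G -> crec (fun g x => (F g x ^ G g x)%N).
Proof.
move=> hF hG.
apply: crec_ext (crec_rec (crec_const 1) (H := fun g _ r x => (r * F g x)%N) _ hG).
  by move=> g x; elim: (G g x) => [|n /= ->]; rewrite ?expn0 ?expnS 1?mulnC.
apply: crec_mul; first by apply/crec_fst/crec_snd/crec_id.
by apply: crec_comp hF _; apply/crec_snd/crec_snd/crec_id.
Qed.

Lemma crec_pred F : crec F -> crec (fun g x => (F g x).-1).
Proof.
move=> hF; apply: crec_ext (crec_rec (crec_const 0) (H := fun _ n _ _ => n) _ hF).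
  by move=> g x; case: (F g x).
exact/crec_fst/crec_id.
Qed.

Lemma crec_sub F G : crec F -> crec G -> crec (fun g x => (F g x - G g x)%N).
Proof.
move=> hF hG; apply: crec_ext (crec_rec hF (H := fun _ _ r _ => r.-1) _ hG).
  by move=> g x; elim: (G g x) => [|n /= ->]; rewrite ?subn0 ?subnS.
by apply/crec_pred/crec_fst/crec_snd/crec_id.
Qed.

Lemma crec_sum (F : (nat -> nat) -> nat -> nat -> nat) N :
  crec (fun g y => F g (nfst y) (nsnd y)) -> crec N ->
  crec (fun g x => \sum_(k < N g x) F g k x)%N.
Proof.
move=> hF hN.
apply: crec_ext (crec_rec (crec_const 0) (H := fun g n r x => (r + F g n x)%N) _ hN).
  by move=> g x; elim: (N g x) => [|n /= ->]; rewrite ?big_ord0 ?big_ord_recr.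
apply: crec_add; first by apply/crec_fst/crec_snd/crec_id.
apply: crec_ext (crec_comp hF (crec_pair (crec_fst crec_id)
  (crec_snd (crec_snd crec_id)))) => g x.
by rewrite nfst_npair nsnd_npair.
Qed.

Lemma crec_prod (F : (nat -> nat) -> nat -> nat -> nat) N :
  crec (fun g y => F g (nfst y) (nsnd y)) -> crec N ->
  crec (fun g x => \prod_(k < N g x) F g k x)%N.
Proof.
move=> hF hN.
apply: crec_ext (crec_rec (crec_const 1) (H := fun g n r x => (r * F g n x)%N) _ hN).
  by move=> g x; elim: (N g x) => [|n /= ->]; rewrite ?big_ord0 ?big_ord_recr.
apply: crec_mul; first by apply/crec_fst/crec_snd/crec_id.
apply: crec_ext (crec_comp hF (crec_pair (crec_fst crec_id)
  (crec_snd (crec_snd crec_id)))) => g x.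
by rewrite nfst_npair nsnd_npair.
Qed.

Definition crecb (P : (nat -> nat) -> nat -> bool) : Prop :=
  crec (fun g x => nat_of_bool (P g x)).

Lemma crecb_leq F G : crec F -> crec G -> crecb (fun g x => (F g x <= G g x)%N).
Proof.
move=> hF hG; apply: crec_ext (crec_sub (crec_const 1) (crec_sub hF hG)) => g x.
by rewrite /leq; case: (F g x - G g x)%N.
Qed.

Lemma crecb_neg P : crecb P -> crecb (fun g x => ~~ P g x).
Proof.
move=> hP; apply: crec_ext (crec_sub (crec_const 1) hP) => g x.
by case: (P g x).
Qed.

Lemma crecb_and P Q : crecb P -> crecb Q -> crecb (fun g x => P g x && Q g x).
Proof.
move=> hP hQ; apply: crec_ext (crec_mul hP hQ) => g x.
by case: (P g x); case: (Q g x).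
Qed.

Lemma crec_if P F G : crecb P -> crec F -> crec G ->
  crec (fun g x => if P g x then F g x else G g x).
Proof.
move=> hP hF hG.
apply: crec_ext (crec_add (crec_mul hP hF) (crec_mul (crecb_neg hP) hG)) => g x.
by case: (P g x); rewrite ?mul0n ?mul1n ?addn0.
Qed.

Lemma crecb_eq F G : crec F -> crec G -> crecb (fun g x => F g x == G g x).
Proof.
move=> hF hG; apply: crec_ext (crecb_and (crecb_leq hF hG) (crecb_leq hG hF)) => g x.
by rewrite eqn_leq.
Qed.

Lemma crecb_eqb P Q : crecb P -> crecb Q -> crecb (fun g x => P g x == Q g x).
Proof.
move=> hP hQ; apply: crec_ext (crecb_eq hP hQ) => g x.
by case: (P g x); case: (Q g x).
Qed.

Lemma crecb_has (P : (nat -> nat) -> nat -> nat -> bool) N :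
  crecb (fun g y => P g (nfst y) (nsnd y)) -> crec N ->
  crecb (fun g x => has (fun k => P g k x) (iota 0 (N g x))).
Proof.
move=> hP hN; apply: crec_ext
  (crecb_neg (crecb_eq (crec_sum (F := fun g k x => nat_of_bool (P g k x)) hP hN)
     (crec_const 0))) => g x.
congr nat_of_bool; rewrite sum_nat_eq0.
apply/idP/idP.
  rewrite negb_forall => /existsP[i]; rewrite implyTb eqb0 negbK => hi.
  by apply/hasP; exists (val i); rewrite // mem_iota /= add0n.
move=> /hasP[k]; rewrite mem_iota /= add0n => hk hP'.
by rewrite negb_forall; apply/existsP; exists (Ordinal hk); rewrite /= hP'.
Qed.

Lemma crecb_all (P : (nat -> nat) -> nat -> nat -> bool) N :
  crecb (fun g y => P g (nfst y) (nsnd y)) -> crec N ->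
  crecb (fun g x => all (fun k => P g k x) (iota 0 (N g x))).
Proof.
move=> hP hN; apply: crec_ext (crecb_neg (crecb_has
  (P := fun g k x => ~~ P g k x) (crecb_neg hP) hN)) => g x.
by congr nat_of_bool; rewrite -all_predC; apply: eq_all => k /=; rewrite negbK.
Qed.

Lemma crec_div F G : crec F -> crec G -> crec (fun g x => (F g x %/ G g x)%N).
Proof.
move=> hF hG.
(* the quotient counts the k < F with (k + 1) G <= F *)
apply: crec_ext (crec_mul (crecb_leq (crec_const 1) hG)
  (crec_sum (F := fun g k x => nat_of_bool (k.+1 * G g x <= F g x)%N) (N := F) _ hF)).
  move=> g x; have [->|hG0] := posnP (G g x); first by rewrite mul0n divn0.
  rewrite mul1n; under eq_bigr => k _ do rewrite -leq_divRL //.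
  have h : (F g x %/ G g x <= F g x)%N by exact: leq_div.
  rewrite -[RHS]card_ord -sum1_card (big_ord_widen _ (fun=> 1%N) h) [RHS]big_mkcond /=.
  by apply: eq_bigr => k _; case: ifP.
apply: crecb_leq; last exact: crec_comp hF (crec_snd crec_id).
apply: crec_mul; first exact: crec_succ (crec_fst crec_id).
by apply: crec_comp hG _; apply/crec_snd/crec_id.
Qed.

Lemma crec_half F : crec F -> crec (fun g x => (F g x)./2).
Proof.
move=> hF; apply: crec_ext (crec_div hF (crec_const 2)) => g x.
by rewrite divn2.
Qed.

Lemma crec_double F : crec F -> crec (fun g x => (F g x).*2).
Proof.
by move=> hF; apply: crec_ext (crec_add hF hF) => g x; rewrite addnn.
Qed.

Lemma crecb_odd F : crec F -> crecb (fun g x => odd (F g x)).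
Proof.
move=> hF; apply: crec_ext (crec_sub hF (crec_double (crec_half hF))) => g x.
by rewrite -{1}(odd_double_half (F g x)) addnK.
Qed.

Ltac crec1 := first
  [ exact: crec_id | exact: crec_const
  | apply: crec_fst | apply: crec_snd | apply: crec_succ | apply: crec_pair
  | apply: crec_add | apply: crec_mul | apply: crec_exp | apply: crec_sub
  | apply: crec_pred | apply: crec_half | apply: crec_double | apply: crec_div
  | apply: crecb_leq | apply: crecb_and | apply: crecb_neg | apply: crecb_eq
  | apply: crecb_eqb | apply: crecb_odd | apply: crec_orc ].

(** * Measures on Cantor space *)

Lemma size_pre b n : size (pre b n) = n.
Proof. exact: size_mkseq. Qed.

Lemma preS b n : pre b n.+1 = rcons (pre b n) (b n).
Proof. by rewrite /pre mkseqS. Qed.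

Lemma pre_take b m n : (m <= n)%N -> pre b m = take m (pre b n).
Proof. by move=> mn; rewrite /pre /mkseq -map_take take_iota (minn_idPl mn). Qed.

Lemma pre_eqP b b' n : pre b n = pre b' n <-> forall i, (i < n)%N -> b i = b' i.
Proof.
split=> [h i lt_in|h].
  by have /(congr1 (fun s => nth false s i)) := h; rewrite !nth_mkseq.
by apply/eq_in_map => i; rewrite mem_iota /= add0n => /h.
Qed.

Lemma cylE x b : cyl x b <-> forall i, (i < size x)%N -> b i = nth false x i.
Proof.
rewrite /cyl /=; split=> [<- i|h]; first by rewrite size_pre => lt; rewrite nth_mkseq.
by apply: (@eq_from_nth _ false); rewrite size_pre // => i lt; rewrite nth_mkseq // h.
Qed.

Lemma cyl_nil : cyl [::] = setT.
Proof. by apply/seteqP; split=> // b _; apply/cylE. Qed.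

Lemma cyl_sub_prefix x y : prefix x y -> cyl y `<=` cyl x.
Proof.
move=> /prefixP[s ->] b /cylE h; apply/cylE => i lt.
by rewrite h ?nth_cat ?lt // size_cat ltn_addr.
Qed.

Lemma cylI_comparable x y b : cyl x b -> cyl y b -> Defs.comparable x y.
Proof.
rewrite /Defs.comparable; wlog le : x y / (size x <= size y)%N.
  move=> h hx hy; case/orP: (leq_total (size x) (size y)) => le; first exact: (h x y).
  by rewrite orbC; exact: (h y x).
move=> hx hy; rewrite prefixE; apply/orP; left; apply/eqP.
by rewrite -[in RHS]hx -[in LHS]hy -pre_take.
Qed.

Lemma cyl_rcons x : cyl x = cyl (rcons x false) `|` cyl (rcons x true).
Proof.
apply/seteqP; split=> b; last first.
  by case; apply: cyl_sub_prefix; rewrite -cats1 prefix_prefix.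
rewrite /cyl /= !size_rcons preS => ->.
by case: (b (size x)); [right|left].
Qed.

Lemma cyl_rcons_disj x : cyl (rcons x false) `&` cyl (rcons x true) = set0.
Proof.
rewrite -subset0 => b [/cylE hf /cylE ht].
by have := hf (size x); rewrite ht !size_rcons // !nth_rcons ltnn eqxx => /(_ (ltnSn _)).
Qed.

Lemma measurable_cyl x : measurable (cyl x : set cantor).
Proof. by apply: sub_sigma_algebra; exists x. Qed.

(** The empty set is added to obtain a family closed under intersection, as uniqueness of measures
    and Dynkin induction require. *)
Definition cylinders : set (set (nat -> bool)) := range cyl `|` [set set0].

Lemma cylinders_setI : setI_closed cylinders.
Proof.
have comp x y : cylinders (cyl x `&` cyl y).
  have [[b [bx by_]]|/set0P/negP/negPn/eqP ->] := pselect ((cyl x `&` cyl y) !=set0); last by right.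
  left; case/orP: (cylI_comparable bx by_) => /cyl_sub_prefix/setIidPl h.
    by rewrite setIC h; exists y.
  by rewrite h; exists x.
by move=> _ _ [[x _ <-]|->] [[y _ <-]|->]; rewrite ?setI0 ?set0I //; right.
Qed.

Lemma measurable_cylinders : @measurable _ cantor = <<s cylinders >>.
Proof.
apply/seteqP; split.
  apply: smallest_sub; first exact: smallest_sigma_algebra.
  by move=> _ [x _ <-]; apply: sub_gen_smallest; left; exists x.
apply: smallest_sub; first exact: sigma_algebra_measurable.
by move=> _ [[x _ <-]|->]; [exact: measurable_cyl|exact: measurable0].
Qed.

Section cantor_measures.
Context {R : realType}.

Lemma cantor_measure_ext (m1 m2 : {measure set cantor -> \bar R}) :
  (m1 setT < +oo)%E -> (forall x, m1 (cyl x) = m2 (cyl x)) ->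
  forall A : set cantor, measurable A -> m1 A = m2 A.
Proof.
move=> fin h A mA.
apply: (@measure_unique _ R cantor cylinders (fun=> setT)) => //.
- exact: measurable_cylinders.
- exact: cylinders_setI.
- by left; exists [::]; rewrite ?cyl_nil.
- by rewrite bigcup_const.
- by move=> _ [[x _ <-]|->]; [exact: h|rewrite !measure0].
Qed.

Lemma pushforward_probability d d' (T : measurableType d) (T' : measurableType d')
    (P : probability T R) (f : T -> T') : measurable_fun setT f ->
  exists Q : probability T' R, forall A, Q A = P (f @^-1` A).
Proof.
move=> mf; pose X : {mfun T >-> T'} := HB.pack f (isMeasurableFun.Build _ _ _ _ f mf).
by exists (distribution P X).
Qed.

Lemma measurable_fun_cantor d (T : measurableType d) (f : T -> cantor) :
  (forall x, measurable (f @^-1` cyl x)) -> measurable_fun setT f.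
Proof.
move=> h; apply: (@measurability _ _ T cantor setT f (range cyl)) => //.
by move=> _ [_ [x _ <-] <-]; rewrite setTI.
Qed.

Lemma uniform_itv : exists U : probability (measurableTypeR R) R,
  forall a b : R, 0 <= a -> a <= b -> b <= 1 -> U `[a, b[%classic = (b - a)%:E.
Proof.
exists (@uniform_prob R 0 1 ltr01) => a b a0 ab b1.
rewrite (_ : _ `[a, b[%classic = @uniform_prob R 0 1 ltr01 `[a, b[%classic) // /uniform_prob integral_uniform_pdf setIidl; last first.
  move=> x /=; rewrite !in_itv /= => /andP[ax xb]; apply/andP; split; lra.
rewrite (eq_integral (cst 1%:E)); last first.
  move=> x /=; rewrite inE /= in_itv /= => /andP[ax xb].
  by rewrite /uniform_pdf ifT ?subr0 ?invr1 //; apply/andP; split; lra.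
rewrite integral_cst // mul1e; apply: etrans (lebesgue_measure_itv _) _.
by rewrite /= lte_fin; case: ltP => // ba; congr (_%:E); lra.
Qed.

Section nested_intervals.
Variable p : word -> R.
Hypotheses (p1 : p [::] = 1) (p0 : forall x, 0 <= p x)
  (pD : forall x, p x = p (rcons x false) + p (rcons x true)).

(* [t] in [[lo, lo + p w)] is followed through the halves of that interval *)
Fixpoint path_at (t : R) (n : nat) : R * word :=
  if n is n'.+1 then
    let: (lo, w) := path_at t n' in
    let c := lo + p (rcons w false) in
    if c <= t then (c, rcons w true) else (lo, rcons w false)
  else (0, [::]).

Definition path_of (t : R) : cantor :=
  fun n => last false (path_at t n.+1).2.

Lemma pre_path t n : pre (path_of t) n = (path_at t n).2.
Proof.
elim: n => // n IH; rewrite preS IH /path_of /=.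
by case: (path_at t n) => lo w /=; case: ifP => _ /=; rewrite last_rcons.
Qed.

(** The total weight of the words of the same length that precede [x] lexicographically. *)
Definition left_end (x : word) : R :=
  \sum_(i < size x) if nth false x i then p (rcons (take i x) false) else 0.

Lemma left_end_rcons x b :
  left_end (rcons x b) = left_end x + (if b then p (rcons x false) else 0).
Proof.
have tk i : (i <= size x)%N -> take i (rcons x b) = take i x.
  by move=> le; rewrite -cats1 takel_cat.
rewrite /left_end size_rcons big_ord_recr /=; congr (_ + _).
  by apply: eq_bigr => i _; rewrite nth_rcons ltn_ord tk // ltnW.
by rewrite nth_rcons ltnn eqxx tk // take_size.
Qed.

Lemma path_left t n : (path_at t n).1 = left_end (path_at t n).2.
Proof.
elim: n => [|n IH] /=; first by rewrite /left_end big_ord0.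
move: IH; case: (path_at t n) => lo w /= ->.
by case: ifP => _ /=; rewrite left_end_rcons ?addr0.
Qed.

Lemma left_end_ge0 x : 0 <= left_end x.
Proof. by apply: sumr_ge0 => i _; case: ifP. Qed.

Lemma left_end_le1 x : left_end x + p x <= 1.
Proof.
elim/last_ind: x => [|x b IH]; first by rewrite /left_end big_ord0 p1; lra.
rewrite left_end_rcons; have := pD x.
by have := p0 (rcons x true); case: b => /=; lra.
Qed.

Lemma path_in t n : 0 <= t < 1 ->
  left_end (path_at t n).2 <= t < left_end (path_at t n).2 + p (path_at t n).2.
Proof.
move=> t01; elim: n => [|n IH] /=; first by rewrite /left_end big_ord0 p1; lra.
move: IH (path_left t n); case: (path_at t n) => lo w /= IH ->.
have := pD w; case: ifPn; rewrite -?ltNge /= left_end_rcons; lra.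
Qed.

Lemma path_unique t x : left_end x <= t < left_end x + p x ->
  (path_at t (size x)).2 = x.
Proof.
elim/last_ind: x => // x b IH; rewrite left_end_rcons size_rcons /= => h.
have {}IH : (path_at t (size x)).2 = x.
  have := pD x; have := p0 (rcons x true); have := p0 (rcons x false).
  by move: h; case: (b) => /= h *; apply: IH; lra.
move: IH (path_left t (size x)); case: (path_at _ _) => lo w /= -> ->.
by move: h; case: b => /= h; [rewrite ifT|rewrite ifF] => //; have := pD x; lra.
Qed.

Lemma measurable_path : measurable_fun setT path_of.
Proof.
apply: measurable_fun_cantor => x.
have -> : path_of @^-1` cyl x = [set t | (path_at t (size x)).2 = x].
  by apply/seteqP; split=> t; rewrite /cyl /= pre_path.
elim/last_ind: x => [|x b IH].
  by rewrite [X in measurable X](_ : _ = setT) //; apply/seteqP; split.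
rewrite size_rcons.
have -> : [set t | (path_at t (size x).+1).2 = rcons x b] =
    [set t | (path_at t (size x)).2 = x] `&`
    (if b then `[(left_end x + p (rcons x false)), +oo[%classic
     else `]-oo, (left_end x + p (rcons x false))[%classic).
  apply/seteqP; split=> t /=.
    have := path_left t (size x); case: (path_at t _) => lo w /= ->.
    case: ifPn => [h /rcons_inj[<- <-]|].
      by split=> //=; rewrite in_itv /= h.
    by rewrite -ltNge => h /rcons_inj[<- <-]; split=> //=; rewrite in_itv.
  case; have := path_left t (size x); case: (path_at t _) => lo w /= -> -> /=.
  case: b => /=; rewrite in_itv /= ?andbT => h; first by rewrite h.
  by rewrite ifF //; lra.
by apply: measurableI => //; case: b; exact: measurable_itv.
Qed.

(** Push-forward of the uniform law on [[0, 1)]: inside that interval, the points whose path begins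
    with [x] are exactly those of [[left_end x, left_end x + p x)]. *)
Lemma cantor_measure_exists : exists P : probability cantor R, forall x, P (cyl x) = (p x)%:E.
Proof.
have [U hU] := uniform_itv.
have [P hP] := pushforward_probability U measurable_path.
exists P => x; rewrite hP.
have mS : measurable (path_of @^-1` cyl x).
  by rewrite -[X in measurable X]setTI; apply: measurable_path => //; exact: measurable_cyl.
(* Points outside [[0, 1)] also have a path, which may pass through [x]; they form a null set. *)
have -> : path_of @^-1` cyl x = `[left_end x, left_end x + p x[%classic `|`
   (path_of @^-1` cyl x `\` `[(0 : R), 1[%classic).
  apply/seteqP; split=> t /=.
    rewrite /cyl /= pre_path in_itv /= => h.
    have [t01|t01] := boolP (0 <= t < 1).
      by left; have := path_in (size x) t01; rewrite h.
    by right; rewrite in_itv /=; split=> //; exact/negP.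
  case=> [|[]//]; rewrite in_itv /= => h.
  by rewrite /cyl /= pre_path; exact: path_unique.
have p01 := left_end_ge0 x; have p11 := left_end_le1 x.
have U1 : U `[left_end x, left_end x + p x[%classic = (p x)%:E.
  by rewrite hU ?lerDl // addrAC subrr add0r.
have U0 : U (path_of @^-1` cyl x `\` `[(0 : R), 1[%classic) = 0%E.
  apply: (@subset_measure0 _ _ _ U _ (~` `[(0 : R), 1[%classic)).
  + by apply: measurableD => //; exact: measurable_itv.
  + by apply: measurableC; exact: measurable_itv.
  + by move=> t [].
  apply: etrans (probability_setC U _) _; first exact: measurable_itv.
  by rewrite hU // subr0 subee.
rewrite measureU //.
- by transitivity ((p x)%:E + 0)%E; [congr (_ + _)%E|rewrite adde0].
- by apply: measurableD => //; exact: measurable_itv.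
rewrite -subset0 => t [] /=; rewrite !in_itv /= => /andP[h1 h2] [_]; apply.
by apply/andP; split; lra.
Qed.

End nested_intervals.
End cantor_measures.

(** * Local events and independence *)

Section local_events.
Implicit Types (I J : pred nat) (b : nat -> bool).

Definition dep T I (f : (nat -> bool) -> T) : Prop :=
  forall b b', (forall k, I k -> b k = b' k) -> f b = f b'.

(** Dependence on finitely many coordinates, all in [I]. Such events are measurable, and their
    probabilities are finite sums. *)
Definition local I (E : (nat -> bool) -> bool) : Prop :=
  exists m, dep (fun k => I k && (k < m)%N) E.

Lemma dep_sub T I J (f : (nat -> bool) -> T) : subpred I J -> dep I f -> dep J f.
Proof. by move=> IJ h b b' e; apply: h => k /IJ; exact: e. Qed.

Lemma local_sub I J E : subpred I J -> local I E -> local J E.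
Proof.
move=> IJ [m h]; exists m; apply: dep_sub h => k /andP[/IJ Jk km].
by rewrite Jk km.
Qed.

Lemma localT I E : local I E -> local predT E.
Proof. exact: local_sub. Qed.

Lemma local_dep I E : local I E -> dep I E.
Proof. by case=> m; apply: dep_sub => k /andP[]. Qed.

Lemma local_const I c : local I (fun=> c).
Proof. by exists 0%N. Qed.

Lemma local_coord I k : I k -> local I (fun b => b k).
Proof. by move=> Ik; exists k.+1 => b b'; apply; rewrite Ik leqnn. Qed.

Lemma local_not I E : local I E -> local I (fun b => ~~ E b).
Proof. by case=> m h; exists m => b b' /h ->. Qed.

Lemma local_op2 (op : bool -> bool -> bool) I E F :
  local I E -> local I F -> local I (fun b => op (E b) (F b)).
Proof.
move=> [m hE] [n hF]; exists (maxn m n) => b b' e; congr op.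
  by apply: hE => k /andP[Ik lt]; apply: e; rewrite Ik leq_max lt.
by apply: hF => k /andP[Ik lt]; apply: e; rewrite Ik leq_max lt orbT.
Qed.

Lemma local_and I E F : local I E -> local I F -> local I (fun b => E b && F b).
Proof. exact: (local_op2 andb). Qed.

Lemma local_or I E F : local I E -> local I F -> local I (fun b => E b || F b).
Proof. exact: (local_op2 orb). Qed.

Lemma local_if I C E F : local I C -> local I E -> local I F ->
  local I (fun b => if C b then E b else F b).
Proof.
move=> hC hE hF; have := local_or (local_and hC hE) (local_and (local_not hC) hF).
by move=> [m h]; exists m => b b' /h; case: (C b); case: (C b') => /=; rewrite ?orbF.
Qed.

Lemma local_has (T : eqType) I (s : seq T) (E : T -> (nat -> bool) -> bool) :
  (forall t, t \in s -> local I (E t)) -> local I (fun b => has (E^~ b) s).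
Proof.
elim: s => [|t s IH] h; first exact: local_const.
apply: local_or; first by apply: h; rewrite mem_head.
by apply: IH => u us; apply: h; rewrite in_cons us orbT.
Qed.

Lemma local_all (T : eqType) I (s : seq T) (E : T -> (nat -> bool) -> bool) :
  (forall t, t \in s -> local I (E t)) -> local I (fun b => all (E^~ b) s).
Proof.
elim: s => [|t s IH] h; first exact: local_const.
apply: local_and; first by apply: h; rewrite mem_head.
by apply: IH => u us; apply: h; rewrite in_cons us orbT.
Qed.

Lemma local_comp I J E (s : nat -> nat) : local J E -> (forall k, J k -> I (s k)) ->
  local I (fun b => E (fun k => b (s k))).
Proof.
move=> [m h] IJ; exists (\max_(k < m) (s k).+1) => b b' e.
apply: h => k /andP[Jk km]; apply: e; rewrite IJ //=.
exact: (leq_bigmax (F := fun k : 'I_m => (s k).+1) (Ordinal km)).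
Qed.

End local_events.

(** * Means over finitely many Bernoulli coordinates *)

Section expectation.
Context {R : realType}.
Implicit Types (th : nat -> R) (f g : (nat -> bool) -> R).

Definition scons (c : bool) (b : nat -> bool) : nat -> bool :=
  fun n => if n is n'.+1 then b n' else c.

(* the mean of [f] when the first [m] coordinates are independent Bernoulli
   variables of parameters [th] and all others are [false] *)
Fixpoint Ex th (m : nat) f : R :=
  if m is m'.+1 then
    th 0%N * Ex (th \o S) m' (f \o scons true)
    + (1 - th 0%N) * Ex (th \o S) m' (f \o scons false)
  else f (fun=> false).

Lemma eq_Ex th m f g : f =1 g -> Ex th m f = Ex th m g.
Proof.
elim: m th f g => [|m IH] th f g fg /=; first exact: fg.
by congr (_ * _ + _ * _); apply: IH => b; exact: fg.
Qed.

Lemma dep_scons T I c (f : (nat -> bool) -> T) :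
  dep I f -> dep (I \o S) (f \o scons c).
Proof. by move=> h b b' e; apply: h => -[|k] //; exact: e. Qed.

(** The first coordinate lies in [I] or not, and the factor that ignores it has the same restriction
    to both values; induction handles the others. *)
Lemma ExM th m I f g : dep I f -> dep (predC I) g ->
  Ex th m (fun b => f b * g b) = Ex th m f * Ex th m g.
Proof.
elim: m th I f g => //= m IH th I f g hf hg.
have sc c : Ex (th \o S) m ((fun b => f b * g b) \o scons c) =
    Ex (th \o S) m (f \o scons c) * Ex (th \o S) m (g \o scons c).
  exact: IH (dep_scons c hf) (dep_scons c hg).
rewrite !sc; case I0: (I 0%N).
  have -> : g \o scons true = g \o scons false; last by ring.
  by apply/funext => b; apply: hg => -[|k] //=; rewrite I0.
have -> : f \o scons true = f \o scons false; last by ring.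
by apply/funext => b; apply: hf => -[|k] //=; rewrite I0.
Qed.

Lemma Ex_itv th m f : (forall k, 0 <= th k <= 1) -> (forall b, 0 <= f b <= 1) ->
  0 <= Ex th m f <= 1.
Proof.
elim: m th f => //= m IH th f hth hf.
have := IH (th \o S) _ (fun k => hth k.+1) (fun b => hf (scons true b)).
have := IH (th \o S) _ (fun k => hth k.+1) (fun b => hf (scons false b)).
rewrite /comp; set u := Ex _ _ _; set v := Ex _ _ _; have := hth 0%N.
by move: (th 0%N) => t *; nra.
Qed.

(** Needed because only approximations of the rates can be computed. Changing one parameter moves
    the mean by at most the change, as both conditional means lie in [[0, 1]]. *)
Lemma Ex_lipschitz th th' m f :
  (forall k, 0 <= th k <= 1) -> (forall k, 0 <= th' k <= 1) ->
  (forall b, 0 <= f b <= 1) ->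
  `|Ex th m f - Ex th' m f| <= \sum_(k < m) `|th k - th' k|.
Proof.
elim: m th th' f => [|m IH] th th' f hth hth' hf /=; first by rewrite big_ord0 subrr normr0.
rewrite big_ord_recl /=.
have ht := IH (th \o S) (th' \o S) (f \o scons true) (fun k => hth k.+1)
  (fun k => hth' k.+1) (fun b => hf (scons true b)).
have hu := IH (th \o S) (th' \o S) (f \o scons false) (fun k => hth k.+1)
  (fun k => hth' k.+1) (fun b => hf (scons false b)).
have := Ex_itv m (fun k => hth k.+1) (fun b => hf (scons true b)).
have := Ex_itv m (fun k => hth k.+1) (fun b => hf (scons false b)).
move: ht hu; rewrite /comp /=; have := hth' 0%N; move: (th 0%N) (th' 0%N) => t t'.
set u := Ex _ _ _; set u' := Ex _ _ _; set v := Ex _ _ _; set v' := Ex _ _ _.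
set s := \sum_(_ < _) _ => ht' hu hv v01 u01.
have -> : t * u + (1 - t) * v - (t' * u' + (1 - t') * v') =
  (t - t') * (u - v) + (t' * (u - u') + (1 - t') * (v - v')) by ring.
apply: le_trans (ler_normD _ _) (lerD _ _).
  rewrite normrM ler_piMr //; rewrite ler_norml; lra.
apply: le_trans (ler_normD _ _) _; rewrite !normrM (ger0_norm (x := t')); last lra.
rewrite (ger0_norm (x := 1 - t')); last lra.
by move: hu hv; move: `|u - u'| `|v - v'| => x y *; nra.
Qed.

Definition cat_seq (x : word) (b : nat -> bool) : nat -> bool :=
  fun n => if (n < size x)%N then nth false x n else b (n - size x)%N.

Lemma cat_seq_rcons x c b : cat_seq (rcons x c) b = cat_seq x (scons c b).
Proof.
apply/funext => n; rewrite /cat_seq size_rcons nth_rcons ltnS.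
case: (ltngtP n (size x)) => [//|gt|->]; last by rewrite subnn.
by rewrite /= -(prednK (n := n - size x)) ?subn_gt0 //= -subnS.
Qed.

Lemma cyl_cat_seq x b : cyl x b -> b = cat_seq x (fun k => b (size x + k)%N).
Proof.
move=> /cylE h; apply/funext => n; rewrite /cat_seq; case: ltnP => [|le]; first exact: h.
by rewrite subnKC.
Qed.

Definition bweight th (x : word) : R :=
  \prod_(i < size x) (if nth false x i then th i else 1 - th i).

Lemma bweight_rcons th x c :
  bweight th (rcons x c) = bweight th x * (if c then th (size x) else 1 - th (size x)).
Proof.
rewrite /bweight size_rcons big_ord_recr /= nth_rcons ltnn eqxx; congr (_ * _).
by apply: eq_bigr => i _; rewrite nth_rcons ltn_ord.
Qed.

Lemma bernoulli_measure_exists th : (forall k, 0 <= th k <= 1) ->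
  exists mu : probability cantor R, forall x, mu (cyl x) = (bweight th x)%:E.
Proof.
move=> hth; apply: cantor_measure_exists; rewrite /bweight.
- by rewrite big_ord0.
- by move=> x; apply: prodr_ge0 => i _; have := hth i; case: ifP => _; lra.
by move=> x; rewrite -/(bweight th x) -!/(bweight th (rcons _ _)) !bweight_rcons; ring.
Qed.

End expectation.

Section local_measurable.
Implicit Types (E F : (nat -> bool) -> bool).

Lemma measurable_cyl_local x m E : dep (fun k => (k < size x + m)%N) E ->
  measurable (cyl x `&` [set b | E b] : set cantor).
Proof.
elim: m x => [|m IH] x hE; last first.
  rewrite cyl_rcons setIUl; apply: measurableU; apply: IH.
    by rewrite size_rcons addSnnS.
  by rewrite size_rcons addSnnS.
have e b : cyl x b -> E b = E (cat_seq x (fun=> false)).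
  move=> xb; rewrite (cyl_cat_seq xb); apply: hE => k; rewrite addn0 /cat_seq.
  by move=> ->.
case Ex0: (E (cat_seq x (fun=> false))).
  rewrite (_ : _ `&` _ = cyl x); first exact: measurable_cyl.
  by apply/setIidPl => b /e /=; rewrite Ex0.
rewrite (_ : _ `&` _ = set0) //; rewrite -subset0 => b [/e /= ->].
by rewrite Ex0.
Qed.

Lemma measurable_local I E : local I E -> measurable ([set b | E b] : set cantor).
Proof.
move=> [m hE]; rewrite -[X in measurable X]setTI -cyl_nil.
by apply: (@measurable_cyl_local _ m); apply: dep_sub hE => k /andP[].
Qed.

End local_measurable.

(** * Probabilities of Boolean events *)

Section events.
Context {R : realType}.
Variable mu : probability cantor R.
Implicit Types (E F : (nat -> bool) -> bool).

Definition event E : Prop := measurable ([set b | E b] : set cantor).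

Definition pr E : R := fine (mu [set b | E b]).

Lemma mu_pr E : event E -> mu [set b | E b] = (pr E)%:E.
Proof. by move=> mE; rewrite /pr fineK // fin_num_measure. Qed.

Lemma event_not E : event E -> event (fun b => ~~ E b).
Proof.
move=> /measurableC; rewrite /event; congr measurable.
by apply/seteqP; split=> b /= /negP.
Qed.

Lemma event_and E F : event E -> event F -> event (fun b => E b && F b).
Proof.
move=> hE hF; have := measurableI _ _ hE hF; rewrite /event; congr measurable.
by apply/seteqP; split=> b /=; [case=> -> ->|move/andP].
Qed.

Lemma event_or E F : event E -> event F -> event (fun b => E b || F b).
Proof.
move=> hE hF; have := measurableU _ _ hE hF; rewrite /event; congr measurable.
by apply/seteqP; split=> b /=; [case=> ->; rewrite ?orbT|move/orP].
Qed.

Lemma pr_ge0 E : 0 <= pr E.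
Proof. by rewrite /pr fine_ge0. Qed.

Lemma pr_mono E F : event E -> event F -> (forall b, E b -> F b) -> pr E <= pr F.
Proof.
move=> mE mF h; rewrite -lee_fin -!mu_pr //.
by apply: le_measure; rewrite ?inE // => b; exact: h.
Qed.

Lemma eq_pr E F : E =1 F -> pr E = pr F.
Proof. by move=> h; rewrite (_ : E = F) //; apply/funext. Qed.

Lemma pr_true : pr (fun=> true) = 1.
Proof.
rewrite /pr (_ : [set _ | _] = setT) ?probability_setT //.
by apply/seteqP; split.
Qed.

Lemma pr_false : pr (fun=> false) = 0.
Proof.
rewrite /pr (_ : [set _ | _] = set0) ?measure0 //.
by apply/seteqP; split.
Qed.

Lemma pr_split E F : event E -> event F ->
  pr E = pr (fun b => E b && F b) + pr (fun b => E b && ~~ F b).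
Proof.
move=> mE mF; apply: EFin_inj; rewrite EFinD.
have mI := event_and mE mF; have mD := event_and mE (event_not mF).
rewrite -!mu_pr //.
have -> : mu [set b | E b] =
    mu ([set b | E b && F b] `|` [set b | E b && ~~ F b]).
  congr (mu _); apply/seteqP; split=> b /=; last by case=> /andP[].
  by move=> ->; case: (F b); [left|right].
apply: measureU.
- exact: event_and.
- by apply: event_and => //; exact: event_not.
by rewrite -subset0 => b /= [/andP[_ ->]] /andP[].
Qed.

Lemma pr_le1 E : event E -> pr E <= 1.
Proof. by move=> mE; rewrite -lee_fin -mu_pr // probability_le1. Qed.

Lemma pr_not E : event E -> pr (fun b => ~~ E b) = 1 - pr E.
Proof.
move=> mE; have := pr_split (event_not (E := fun=> false) _) mE.
rewrite /= pr_true => -> //; first by ring.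
by rewrite /event (_ : [set _ | _] = set0) //; apply/seteqP; split.
Qed.

Lemma pr_or E F : event E -> event F -> pr (fun b => E b || F b) <= pr E + pr F.
Proof.
move=> mE mF; rewrite (pr_split (event_or mE mF) mE).
apply: lerD; apply: pr_mono => //.
- by apply: event_and => //; exact: event_or.
- by move=> b /andP[].
- by apply: event_and; [exact: event_or|exact: event_not].
by move=> b; case: (E b); case: (F b).
Qed.

Lemma pr_has T (F : T -> (nat -> bool) -> bool) (s : seq T) :
  (forall j, event (F j)) ->
  event (fun b => has (F^~ b) s) /\
  pr (fun b => has (F^~ b) s) <= \sum_(j <- s) pr (F j).
Proof.
move=> mF; elim: s => [|j s [mI IH]] /=.
  rewrite big_nil pr_false /event; split=> //.
  by rewrite (_ : [set _ | _] = set0) //; apply/seteqP; split.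
split; first exact: event_or.
by rewrite big_cons; apply: le_trans (pr_or _ _) _ => //; rewrite lerD2l.
Qed.

Lemma pr_exists E (F : nat -> (nat -> bool) -> bool) (c : R) :
  event E -> (forall j, event (F j)) -> (forall b, E b -> exists j, F j b) ->
  (forall n, \sum_(j < n) pr (F j) <= c) -> pr E <= c.
Proof.
move=> mE mF h hc; rewrite -lee_fin -mu_pr //.
have := @measure_sigma_subadditive _ _ _ mu [set b | E b] (fun j => [set b | F j b]) mF mE.
move=> /(_ _) /le_trans; apply; first by move=> b /= /h[j ?]; exists j.
apply: lime_le; first exact: is_cvg_nneseries.
near=> n; rewrite (eq_bigr (fun j => (pr (F j))%:E)); last by move=> j _; rewrite -mu_pr.
by rewrite sumEFin lee_fin big_mkord.
Unshelve. all: by end_near. Qed.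

End events.

Section product_measure.
Context {R : realType} (th : nat -> R).
Variable mu : probability cantor R.
Hypothesis muE : forall x, mu (cyl x) = (bweight th x)%:E.
Implicit Types (E F : (nat -> bool) -> bool).

(** Ties the abstract measure to the recursive mean: a cylinder is split into its two halves until
    [E] is constant on it. *)
Lemma mu_cyl_local x m E : dep (fun k => (k < size x + m)%N) E ->
  mu (cyl x `&` [set b | E b]) = (bweight th x *
    Ex (fun k => th (size x + k)%N) m (fun b => (E (cat_seq x b))%:R))%:E.
Proof.
elim: m x => [|m IH] x hE; last first.
  have hE' c : dep (fun k => (k < size (rcons x c) + m)%N) E.
    by rewrite size_rcons addSnnS.
  have -> : mu (cyl x `&` [set b | E b]) = (mu (cyl (rcons x false) `&` [set b | E b])
      + mu (cyl (rcons x true) `&` [set b | E b]))%E.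
    rewrite cyl_rcons setIUl; apply: measureU.
    - exact: measurable_cyl_local (hE' _).
    - exact: measurable_cyl_local (hE' _).
    - by rewrite setIACA cyl_rcons_disj set0I.
  rewrite !IH //= -EFinD !bweight_rcons !size_rcons /=; congr EFin.
  have e c : Ex (fun k => th ((size x).+1 + k)%N) m (fun b => (E (cat_seq (rcons x c) b))%:R)
      = Ex ((fun k => th (size x + k)%N) \o S) m ((fun b => (E (cat_seq x b))%:R) \o scons c).
    rewrite (_ : (fun k => th _) \o S = (fun k => th ((size x).+1 + k)%N)).
      by apply: eq_Ex => b; rewrite cat_seq_rcons.
    by apply/funext => k /=; rewrite addSnnS.
  by rewrite !e addn0; ring.
have e b : cyl x b -> E b = E (cat_seq x (fun=> false)).
  move=> xb; rewrite (cyl_cat_seq xb); apply: hE => k; rewrite addn0 /cat_seq.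
  by move=> ->.
rewrite /=; case Ex0: (E (cat_seq x (fun=> false))).
  rewrite (_ : _ `&` _ = cyl x); first by rewrite muE mulr1.
  by apply/setIidPl => b /e /=; rewrite Ex0.
rewrite (_ : _ `&` _ = set0) ?measure0 ?mulr0 //; rewrite -subset0 => b [/e /= ->].
by rewrite Ex0.
Qed.

Lemma pr_Ex m E : dep (fun k => (k < m)%N) E -> pr mu E = Ex th m (fun b => (E b)%:R).
Proof.
move=> hE; rewrite /pr -[X in mu X]setTI -cyl_nil (mu_cyl_local (m := m)) //=.
rewrite /bweight big_ord0 mul1r; apply: eq_Ex => b.
by congr ((E _)%:R); apply/funext => k; rewrite /cat_seq subn0.
Qed.

Lemma pr_indep I E F : local I E -> local (predC I) F ->
  pr mu (fun b => E b && F b) = pr mu E * pr mu F.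
Proof.
move=> lE lF; have [m hm] := localT (local_and (localT lE) (localT lF)).
have [m1 h1] := localT lE; have [m2 h2] := localT lF.
pose M := maxn m1 m2.
have hE : dep (fun k => (k < M)%N) E.
  by apply: dep_sub h1 => k /= h; rewrite leq_max h.
have hF : dep (fun k => (k < M)%N) F.
  by apply: dep_sub h2 => k /= h; rewrite leq_max h orbT.
rewrite !(pr_Ex (m := M)) //; last by move=> b b' h; rewrite (hE _ _ h) (hF _ _ h).
rewrite -(ExM th M (I := I)); first by apply: eq_Ex => b; rewrite -natrM mulnb.
  by move=> b b' h; rewrite (local_dep lE h).
by move=> b b' h; rewrite (local_dep lF h).
Qed.

Lemma pr_coord k : pr mu (fun b => b k) = th k.
Proof.
rewrite (pr_Ex (m := k.+1)); last by move=> b b'; apply.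
elim: k (th) => [|k IH] t; first by rewrite /= mulr1 mulr0 addr0.
transitivity (t 0%N * t k.+1 + (1 - t 0%N) * t k.+1); last by ring.
by congr (_ * _ + _ * _); exact: (IH (t \o S)).
Qed.

End product_measure.

(** * The Bernoulli shift *)

Section bernoulli_shift.
Context {R : realType} (th : nat -> R).
Variable mu : probability cantor R.
Hypothesis muE : forall x, mu (cyl x) = (bweight th x)%:E.
Implicit Types (E F : (nat -> bool) -> bool) (A : set cantor).

(** One invariance principle for both the shift and the flip of a single fair coin. The image
    coordinates are independent because [s] is injective, and the second hypothesis gives coordinate
    [n] its parameter [th n]. *)
Lemma relabel_preserves (c : nat -> bool) (s : nat -> nat) : injective s ->
  (forall n, (if c n then 1 - th (s n) else th (s n)) = th n) ->
  forall A, measurable A -> measurable ([set b | A (fun n => c n (+) b (s n))] : set cantor) /\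
    mu [set b | A (fun n => c n (+) b (s n))] = mu A.
Proof.
move=> s_inj hs; pose f (b : cantor) : cantor := fun n => c n (+) b (s n).
pose I (x : word) k := [exists i : 'I_(size x), k == s i].
have lE x : local (I x) (fun b => pre (f b) (size x) == x).
  exists (\max_(i < size x) (s i).+1) => b b' h; congr (_ == _).
  apply/pre_eqP => i lt; congr addb; apply: h; apply/andP; split.
    by apply/existsP; exists (Ordinal lt).
  exact: (leq_bigmax (F := fun i : 'I_(size x) => (s i).+1) (Ordinal lt)).
have prE x : pr mu (fun b => pre (f b) (size x) == x) = bweight th x.
  elim/last_ind: x => [|x d IH].
    rewrite /bweight big_ord0 -(pr_true mu); apply: eq_pr => b.
    by rewrite /pre /=.
  have -> : (fun b => pre (f b) (size (rcons x d)) == rcons x d) =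
      (fun b => (pre (f b) (size x) == x) && (b (s (size x)) == c (size x) (+) d)).
    apply/funext => b; rewrite size_rcons preS eqseq_rcons; congr (_ && _).
    by rewrite /f; case: (c _); case: (b _); case: (d).
  rewrite (pr_indep muE (I := I x)); [|exact: (lE x)|]; last first.
    apply: (local_op2 (fun u v => u == v)); last exact: local_const.
    apply: local_coord; apply/existsP => -[i /eqP/s_inj/eqP].
    by rewrite gtn_eqF.
  rewrite IH bweight_rcons -[in RHS]hs; congr (_ * _).
  have mC : event (fun b => b (s (size x))) := measurable_local (local_coord (I := predT) isT).
  have prC : pr mu (fun b => b (s (size x))) = th (s (size x)) by exact: pr_coord.
  case: (c _); case: d => /=.
  - rewrite (@eq_pr _ _ _ (fun b => ~~ b (s (size x)))) => [|b]; last by case: (b _).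
    by rewrite pr_not // prC.
  - rewrite (@eq_pr _ _ _ (fun b => b (s (size x)))) => [|b]; last by case: (b _).
    by rewrite prC; ring.
  - rewrite (@eq_pr _ _ _ (fun b => b (s (size x)))) => [|b]; last by case: (b _).
    by rewrite prC.
  - rewrite (@eq_pr _ _ _ (fun b => ~~ b (s (size x)))) => [|b]; last by case: (b _).
    by rewrite pr_not // prC.
have cylE' x : f @^-1` cyl x = [set b | pre (f b) (size x) == x].
  by apply/seteqP; split=> b /eqP.
have mf : measurable_fun setT f.
  apply: measurable_fun_cantor => x; rewrite cylE'.
  exact: (measurable_local (lE x)).
have [Q hQ] := pushforward_probability mu mf.
move=> A mA; have -> : [set b | A (fun n => c n (+) b (s n))] = f @^-1` A by [].
split; first by rewrite -[X in measurable X]setTI; exact: mf.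
rewrite -hQ; apply: cantor_measure_ext mA => [|x].
  exact: le_lt_trans (probability_le1 Q measurableT) (ltry _).
apply: etrans (esym (muE x)); apply: etrans (hQ _) _; rewrite cylE'.
by apply: etrans (mu_pr mu (measurable_local (lE x))) _; rewrite prE.
Qed.

(** Since [npair i.+1 k = (npair i k).*2.+1], this moves every site one step to the left and keeps
    the label [k]. *)
Definition bshift (b : nat -> bool) : nat -> bool := fun k => b k.*2.+1.

Hypothesis th_shift : forall k, th k.*2.+1 = th k.

Lemma bshift_preserves A : measurable A ->
  measurable (bshift @^-1` A : set cantor) /\ mu (bshift @^-1` A) = mu A.
Proof.
apply: (relabel_preserves (c := fun=> false)) => //.
by move=> m n [/double_inj].
Qed.

Lemma bshift_iter_preserves g A : measurable A ->
  measurable ((fun b => iter g bshift b) @^-1` A : set cantor) /\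
  mu ((fun b => iter g bshift b) @^-1` A) = mu A.
Proof.
move=> mA; elim: g => [|g [mI IH]] //=.
have [m e] := bshift_preserves mI; rewrite -[in RHS]IH -e.
have -> : (fun b => bshift (iter g bshift b)) @^-1` A =
    bshift @^-1` ((fun b => iter g bshift b) @^-1` A).
  by apply/seteqP; split=> b /=; rewrite -iterSr.
by [].
Qed.

Lemma pr_bshift_iter g E : event E ->
  event (fun b => E (iter g bshift b)) /\
  pr mu (fun b => E (iter g bshift b)) = pr mu E.
Proof. by move=> /(bshift_iter_preserves g)[m e]; split=> //; rewrite /pr -e. Qed.

(** The sets approximable by local events contain the cylinders and form a Dynkin class. *)
Lemma local_approx A : measurable A -> forall e : R, 0 < e ->
  exists2 E, local predT E & pr mu (fun b => `[<A b>] (+) E b) <= e.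
Proof.
have evA (B : set cantor) : measurable B -> event (fun b => `[<B b>]).
  by rewrite /event; congr measurable; apply/seteqP; split=> b /=; rewrite asboolE.
have evX E F : event E -> event F -> event (fun b => E b (+) F b).
  move=> mE mF; have := event_or (event_and mE (event_not mF)) (event_and (event_not mE) mF).
  rewrite /event; congr measurable; apply/seteqP; split=> b /=;
    by case: (E b); case: (F b).
move=> mA; have {mA} : <<s cylinders >> A by rewrite -measurable_cylinders.
move: A; apply: (@dynkin_induction _ cantor cylinders (fun A => forall e : R, 0 < e ->
  exists2 E, local predT E & pr mu (fun b => `[<A b>] (+) E b) <= e)).
- exact: measurable_cylinders.
- exact: cylinders_setI.
- move=> e e0; exists (fun=> true); first exact: local_const.
  rewrite (eq_pr _ (F := fun=> false)) ?pr_false ?ltW // => b.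
  by rewrite asboolT.
- move=> _ [[x _ <-]|->] e e0; last first.
    exists (fun=> false); first exact: local_const.
    rewrite (eq_pr _ (F := fun=> false)) ?pr_false ?ltW // => b.
    by rewrite asboolF.
  exists (fun b => pre b (size x) == x).
    exists (size x) => b b' h; congr (_ == _); apply/pre_eqP => i lt; exact: h.
  rewrite (eq_pr _ (F := fun=> false)) ?pr_false ?ltW // => b.
  rewrite (_ : `[< _ >] = (pre b (size x) == x)) ?addbb //.
  by apply/asboolP/eqP.
- move=> B mB hB e e0; have [E lE hE] := hB e e0.
  exists (fun b => ~~ E b); first exact: local_not.
  rewrite (eq_pr _ (F := fun b => `[<B b>] (+) E b)) // => b.
  by rewrite asbool_neg addbN addNb negbK.
move=> F mF _ hF e e0.
have mU : measurable (\bigcup_k F k) by apply: bigcupT_measurable.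
have cvF : mu (\bigcup_(k < n) F k) @[n --> \oo] --> mu (\bigcup_k F k).
  have e' : \bigcup_k F k = \bigcup_n (\bigcup_(k < n) F k).
    apply/seteqP; split=> [b [k _ Fk]|b [n _ [k _ Fk]]]; last by exists k.
    by exists k.+1 => //; exists k => /=.
  rewrite e'; apply: nondecreasing_cvg_mu => //.
  - by move=> n; apply: bigcup_measurable.
  - by rewrite -e'.
  - by move=> m n mn; apply/subsetPset => b [k /= km Fk]; exists k => //=; exact: leq_trans mn.
(* Half of [e] pays for truncating the union; the other half is shared by the approximations of the
   finitely many remaining sets. *)
have [n hn] : exists n, pr mu (fun b => `[<(\bigcup_k F k) b>] &&
    ~~ `[<(\bigcup_(k < n) F k) b>]) <= e / 2.
  have mUn n : measurable (\bigcup_(k < n) F k) by apply: bigcup_measurable.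
  have prU (A : set cantor) : fine (mu A) = pr mu (fun b => `[<A b>]).
    by congr (fine (mu _)); apply/seteqP; split=> b /=; rewrite asboolE.
  have fU : mu (\bigcup_k F k) \is a fin_num by rewrite fin_num_measure.
  have := cvF; rewrite -(fineK fU) => /fine_cvgP[_ /cvgrPdist_le /(_ (e / 2))].
  rewrite divr_gt0 // => /(_ isT)[n _ /(_ n (leqnn n)) /=]; rewrite !prU => hn.
  exists n; move: hn; rewrite (pr_split mu (evA _ mU) (evA _ (mUn n))).
  rewrite (eq_pr _ (E := fun b => _ && _) (F := fun b => `[<(\bigcup_(k < n) F k) b>])).
    by rewrite addrAC subrr add0r => /(le_trans (ler_norm _)).
  move=> b; case: asboolP => [_|nU] /=; first by [].
  by rewrite asboolF // => -[k _ Fk]; apply: nU; exists k.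
have d0 : 0 < e / 2 / n.+1%:R by rewrite !divr_gt0 // ltr0n.
have /choice[E hE] : forall k, exists E, local predT E /\
    pr mu (fun b => `[<F k b>] (+) E b) <= e / 2 / n.+1%:R.
  by move=> k; have [E lE hE] := hF k _ d0; exists E.
exists (fun b => has (fun k => E k b) (iota 0 n)).
  by apply: local_has => k _; exact: (hE k).1.
have mX k : event (fun b => `[<F k b>] (+) E k b).
  by apply: evX; [apply: evA|exact: (measurable_local (hE k).1)].
have mUn : measurable (\bigcup_(k < n) F k) by apply: bigcup_measurable.
have mT : event (fun b => `[<(\bigcup_k F k) b>] && ~~ `[<(\bigcup_(k < n) F k) b>]).
  exact: event_and (evA _ mU) (event_not (evA _ mUn)).
have [mH pH] := pr_has mu (iota 0 n) mX.
have mEn : event (fun b => has (fun k => E k b) (iota 0 n)).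
  by apply: (@measurable_local predT); apply: local_has => k _; have [] := hE k.
apply: le_trans (pr_mono mu _ (event_or mT mH) _) _.
- by apply: evX => //; exact: evA.
- move=> b; case: (asboolP ((\bigcup_k F k) b)) => [U|nU] /=.
    case: (asboolP ((\bigcup_(k < n) F k) b)) => [[k /= kn Fk]|//] hn'.
    apply/hasP; exists k; first by rewrite mem_iota.
    rewrite asboolT //=; apply: contra hn' => Ek.
    by apply/hasP; exists k; rewrite ?mem_iota.
  move=> /hasP[k ki Ek]; apply/hasP; exists k => //.
  by rewrite Ek asboolF // => Fk; apply: nU; exists k.
apply: le_trans (pr_or _ mT mH) _.
have : \sum_(j <- iota 0 n) pr mu (fun b => `[<F j b>] (+) E j b) <= e / 2.
  apply: le_trans (ler_sum _ (fun k _ => (hE k).2)) _.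
  rewrite big_const_seq count_predT size_iota iter_addr_0 -[leLHS]mulr_natr mulrAC.
  by rewrite ler_pdivrMr ?ltr0n // ler_wpM2l ?ler_nat // divr_ge0 // ltW.
by move: hn pH; lra.
Qed.

(** Each application of [k |-> 2k + 1] raises every index, so after [m] shifts [F] reads only
    coordinates from [m] on, whereas [E] reads those below [m]: the two are exactly independent. *)
Lemma local_mixing E F : local predT E -> local predT F ->
  exists g, pr mu (fun b => E b && F (iter g bshift b)) = pr mu E * pr mu F.
Proof.
move=> [m hE] lF; exists m.
have -> : pr mu F = pr mu (fun b => F (iter m bshift b)).
  by have [] := pr_bshift_iter m (measurable_local lF).
apply: (pr_indep muE (I := fun k => (k < m)%N)).
  by exists m; apply: dep_sub hE => k /= ->.
have hi g b : iter g bshift b = fun k => b (iter g (fun k => k.*2.+1) k).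
  by elim: g b => // g IH b; rewrite iterSr IH; apply/funext => k; rewrite iterS.
have hg g k : (g <= iter g (fun k => k.*2.+1) k)%N.
  by elim: g => // g IH; rewrite iterS ltnS -addnn; apply: leq_trans IH (leq_addr _ _).
have -> : (fun b => F (iter m bshift b)) =
    (fun b => F (fun k => b (iter m (fun k => k.*2.+1) k))).
  by apply/funext => b; rewrite hi.
by apply: local_comp lF _ => k _ /=; rewrite -leqNgt.
Qed.

(** An invariant set of measure [a] is close to a local event [E] and equally close to every shift
    of it. By mixing, [a] is then close both to the probability of [E] and to its square, so
    [a = a^2]. *)
Lemma bshift_ergodic A : measurable A -> bshift @^-1` A = A -> mu A = 0%E \/ mu A = 1%E.
Proof.
move=> mA iA.
have evA : event (fun b => `[<A b>]).
  by move: mA; rewrite /event; congr measurable; apply/seteqP; split=> b /=; rewrite asboolE.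
have -> : mu A = (pr mu (fun b => `[<A b>]))%:E.
  by rewrite -mu_pr //; congr (mu _); apply/seteqP; split=> b /=; rewrite asboolE.
set a := pr mu _.
have ig g b : A (iter g bshift b) = A b.
  by elim: g => //= g <-; rewrite -[in RHS]iA.
have haa : a = a ^+ 2.
  apply/eqP; rewrite -subr_eq0 -normr_le0; apply/ler_addgt0Pr => e e0; rewrite add0r.
  have [E lE hE] := local_approx mA (divr_gt0 e0 (ltr0n _ 8)).
  have [g hg] := local_mixing lE lE.
  have mE : event E := measurable_local lE.
  have [mEg prEg] := pr_bshift_iter g mE.
  have evX G : event G -> event (fun b => `[<A b>] (+) G b).
    move=> mG; have := event_or (event_and evA (event_not mG)) (event_and (event_not evA) mG).
    rewrite /event; congr measurable; apply/seteqP; split=> b /=;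
      by case: (`[<_>]); case: (G b).
  have [mXg prXg] := pr_bshift_iter g (evX _ mE).
  have prA : pr mu (fun b => `[<A b>] (+) E (iter g bshift b)) <= e / 8%:R.
    rewrite -prXg in hE; rewrite (eq_pr _ (F := fun b => `[<A (iter g bshift b)>] (+)
      E (iter g bshift b))) // => b; by rewrite ig.
  have hx G (H : (nat -> bool) -> bool) : event G -> event H ->
      (forall b, G b -> H b || (`[<A b>] (+) E b) || (`[<A b>] (+) E (iter g bshift b))) ->
      pr mu G <= pr mu H + e / 4%:R.
    move=> mG mH h; apply: le_trans (pr_mono mu mG _ h) _.
      by apply: event_or; [apply: event_or => //|]; exact: evX.
    apply: le_trans (pr_or _ _ _) _; [by apply: event_or => //; exact: evX|exact: evX|].
    apply: le_trans (lerD (pr_or _ _ _) (lexx _)) _ => //; first exact: evX.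
    by lra.
  have h1 := hx (fun b => `[<A b>]) E evA mE; have h2 := hx E (fun b => `[<A b>]) mE evA.
  have mEE := event_and mE mEg.
  have h3 := hx (fun b => `[<A b>]) (fun b => E b && E (iter g bshift b)) evA mEE.
  have h4 := hx (fun b => E b && E (iter g bshift b)) (fun b => `[<A b>]) mEE evA.
  have a01 : 0 <= a <= 1 by rewrite pr_ge0 pr_le1.
  have e01 : 0 <= pr mu E <= 1 by rewrite pr_ge0 pr_le1.
  rewrite hg -/a in h1 h2 h3 h4.
  have {}h1 : a <= pr mu E + e / 4%:R by apply: h1 => b; case: (`[<_>]); case: (E b).
  have {}h2 : pr mu E <= a + e / 4%:R by apply: h2 => b; case: (`[<_>]); case: (E b).
  have {}h3 : a <= pr mu E * pr mu E + e / 4%:R.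
    by apply: h3 => b; case: (`[<_>]); case: (E b); case: (E _).
  have {}h4 : pr mu E * pr mu E <= a + e / 4%:R.
    by apply: h4 => b; case: (`[<_>]); case: (E b); case: (E _).
  rewrite ler_norml expr2; apply/andP; split; nra.
have /eqP : a * (a - 1) = 0 by rewrite mulrBr mulr1 -expr2 -haa subrr.
rewrite mulf_eq0 subr_eq0 => /orP[] /eqP ->; [by left|by right].
Qed.

End bernoulli_shift.

(** * The block process *)

Section process.
Variables (u : nat -> nat) (r : nat).
Implicit Types (b : nat -> bool) (i j J n : nat).

Definition blen j : nat := (r.+1 * u j)%N.

Lemma blenE j : blen j = (r * u j + u j)%N.
Proof. by rewrite /blen mulSn addnC. Qed.

(** Site [i] owns the coordinates [npair i k]: label [0] is its fair bit, label [j + 1] its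
    level-[j] mark. *)
Definition mark b i j : bool := b (npair i j.+1).

Definition marked b j i n : bool := has (fun m => mark b m j) (iota i n).

(* a level-[j] mark at [m] covers [(m - blen j, m]]; the highest level covering
   a position decides; nearest marks at distance at least [r * u j] make it fair *)
Fixpoint mode J i b : bool :=
  if J is j.+1 then
    if marked b j i (blen j) then ~~ marked b j i (r * u j) else mode j i b
  else false.

Definition out J b : nat -> bool := fun i => mode J i b && b (npair i 0).

(** Eventual truth stands in for a limit, which fails to exist when infinitely many levels cover [i]
    with conflicting verdicts; it is still a countable union of intersections of local events. *)
Definition fair i b : bool :=
  `[< exists J, forall J', (J <= J')%N -> mode J' i b >].

Definition outF b : cantor := fun i => fair i b && b (npair i 0).

Lemma marked_bshift b j i n : marked (bshift b) j i n = marked b j i.+1 n.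
Proof.
rewrite /marked -addn1 addnC iotaDl has_map; apply: eq_has => m /=.
by rewrite /mark /bshift add1n npairS.
Qed.

Lemma mode_bshift J i b : mode J i (bshift b) = mode J i.+1 b.
Proof. by elim: J => //= J ->; rewrite !marked_bshift. Qed.

Lemma outF_bshift b : outF (bshift b) = Defs.shift (outF b).
Proof.
apply/funext => i; rewrite /outF /Defs.shift /bshift npairS; congr (_ && _).
by rewrite /fair; under eq_exists do under eq_forall do rewrite mode_bshift.
Qed.

Lemma marked_sub b j i n i' n' : (i' <= i)%N -> (i + n <= i' + n')%N ->
  marked b j i n -> marked b j i' n'.
Proof.
move=> le le' /hasP[m]; rewrite mem_iota => /andP[im mn] mm.
by apply/hasP; exists m => //; rewrite mem_iota; lia.
Qed.

Lemma mode_quiet J J' i b : (J <= J')%N ->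
  (forall j, (J <= j < J')%N -> ~~ marked b j i (blen j)) -> mode J' i b = mode J i b.
Proof.
move=> /subnKC <-; elim: (J' - J)%N => [|n IH] h; first by rewrite addn0.
rewrite addnS /= (negbTE (h (J + n)%N _)); last lia.
by apply: IH => j hj; apply: h; lia.
Qed.

Lemma out_quiet J J' n b : (J <= J')%N ->
  (forall j, (J <= j < J')%N -> ~~ marked b j 0 (n + blen j)) ->
  pre (out J' b) n = pre (out J b) n.
Proof.
move=> JJ' h; apply/pre_eqP => i lt; rewrite /out (@mode_quiet J J') // => j hj.
by apply: contra (h j hj); apply: marked_sub; lia.
Qed.

Lemma outF_quiet J n b : (forall j, (J <= j)%N -> ~~ marked b j 0 (n + blen j)) ->
  pre (outF b) n = pre (out J b) n.
Proof.
move=> h; apply/pre_eqP => i lt; rewrite /outF /out; congr (_ && _).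
have st J' : (J <= J')%N -> mode J' i b = mode J i b.
  move=> JJ'; apply: mode_quiet => // j /andP[Jj _].
  by apply: contra (h j Jj); apply: marked_sub; lia.
apply/asboolP/idP => [[K hK]|m]; last by exists J => J' /st ->.
by rewrite -(st (maxn J K)) ?leq_maxl // hK // leq_maxr.
Qed.

Definition level j : pred nat := fun k => nsnd k == j.+1.

Lemma local_marked j i n : local (level j) (fun b => marked b j i n).
Proof. by apply: local_has => m _; apply: local_coord; rewrite /level nsnd_npair. Qed.

Lemma local_mode J i : local (fun k => 0 < nsnd k <= J)%N (mode J i).
Proof.
elim: J => [|J IH] /=; first exact: local_const.
apply: local_if.
- by apply: local_sub (local_marked _ _ _) => k /eqP ->; rewrite /= leqnn.
- by apply/local_not/local_sub/(local_marked J) => k /eqP ->; rewrite /= leqnn.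
by apply: local_sub IH => k /andP[-> /leqW ->].
Qed.

Lemma local_pre (I : pred nat) (f : (nat -> bool) -> nat -> bool) n (op : pred word) :
  (forall i, (i < n)%N -> local I (fun b => f b i)) ->
  local I (fun b => op (pre (f b) n)).
Proof.
move=> hf; have [m hm] : exists m, forall i, (i < n)%N ->
    dep (fun k => I k && (k < m)%N) (fun b => f b i).
  elim: n hf => [|n IH] hf; first by exists 0%N.
  have [|m hm] := IH; first by move=> i lt; apply: hf; exact: leqW.
  have [m' hm'] := hf n (leqnn _); exists (maxn m m') => i.
  rewrite ltnS leq_eqVlt => /orP[/eqP ->|lt].
    by apply: dep_sub hm' => k /andP[-> lt]; rewrite leq_max lt orbT.
  by apply: dep_sub (hm i lt) => k /andP[-> lt']; rewrite leq_max lt'.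
by exists m => b b' e; congr (op _); apply/pre_eqP => i lt; apply: hm.
Qed.

Lemma local_out J i : local (fun k => nsnd k <= J)%N (fun b => out J b i).
Proof.
apply: local_and; first by apply: local_sub (local_mode J i) => k /andP[].
by apply: local_coord; rewrite nsnd_npair.
Qed.

Lemma local_pre_out J n (x : word) : local (fun k => nsnd k <= J)%N
  (fun b => pre (out J b) n == x).
Proof.
by apply: (@local_pre _ _ _ (pred1 x)) => i _; exact: local_out.
Qed.

Lemma event_fair i : event (fair i).
Proof.
rewrite /event (_ : [set _ | _] =
  \bigcup_J \bigcap_(J' in [set J' | (J <= J')%N]) [set b | mode J' i b]).
  apply: bigcupT_measurable => J; apply: bigcap_measurableType => J' _.
  exact: (measurable_local (local_mode J' i)).
apply/seteqP; split=> b /=; rewrite asboolE.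
  by move=> [J h]; exists J => // J' /h.
by move=> [J _ h]; exists J => J' /h.
Qed.

Lemma event_outF i : event (fun b => outF b i).
Proof.
apply: event_and; first exact: event_fair.
exact: (measurable_local (local_coord (I := predT) isT)).
Qed.

Lemma event_pre_outF n (x : word) : event (fun b => pre (outF b) n == x).
Proof.
elim/last_ind: x n => [|x c IH] [|n].
- exact: (measurable_local (local_const predT true)).
- rewrite (_ : (fun b => _) = (fun=> false)); last by apply/funext => b; rewrite -size_eq0 size_pre.
  exact: (measurable_local (local_const predT false)).
- rewrite (_ : (fun b => _) = (fun=> false)); last by apply/funext => b; case: x {IH}.
  exact: (measurable_local (local_const predT false)).
rewrite (_ : (fun b => _) = (fun b => (pre (outF b) n == x) && (outF b n == c))).
  apply: event_and => //; case: c.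
    by rewrite (_ : (fun b => _) = (fun b => outF b n)); [exact: event_outF|apply/funext => b; case: (outF b n)].
  rewrite (_ : (fun b => _) = (fun b => ~~ outF b n)); first exact: event_not (event_outF n).
  by apply/funext => b; case: (outF b n).
by apply/funext => b; rewrite preS eqseq_rcons.
Qed.

Lemma measurable_outF : measurable_fun setT (outF : cantor -> cantor).
Proof.
apply: measurable_fun_cantor => x.
rewrite (_ : _ @^-1` _ = [set b | pre (outF b) (size x) == x]); first exact: event_pre_outF.
by apply/seteqP; split=> b /eqP.
Qed.

(* [hit j] puts a whole level-[j] block at a start in [(u j, 2 u j]];
   no mark below the window can interfere with it *)
Definition hit j b : bool :=
  ~~ marked b j 0 (blen j + u j) && marked b j (blen j + u j) (u j).

(** For [r > 0] the range [2 * blen j] contains the window of [hit j], so a level cannot be both hit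
    and vacant. *)
Definition vacant j b : bool := ~~ marked b j 0 (2 * blen j).

Definition all_vacant J n b : bool := all (vacant^~ b) (iota J n).

(* exactly one hit, all other levels vacant *)
Fixpoint group J n b : bool :=
  if n is n'.+1 then
    group J n' b && vacant (J + n') b || all_vacant J n' b && hit (J + n') b
  else false.

Lemma groupP J n b : group J n b -> exists2 j, (J <= j < J + n)%N &
  hit j b /\ forall j', (J <= j' < J + n)%N -> j' != j -> vacant j' b.
Proof.
elim: n => //= n IH /orP[/andP[/IH[j hj [h ha]] hv]|/andP[/allP ha h]].
  exists j; [lia|split=> // j' hj' ne].
  have [->//|ne'] := eqVneq j' (J + n)%N; apply: ha => //; lia.
exists (J + n)%N; [lia|split=> // j' hj' ne].
by apply: ha; rewrite mem_iota; lia.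
Qed.

Lemma local_hit j : local (level j) (hit j).
Proof. by apply: local_and; [apply: local_not|]; exact: local_marked. Qed.

Lemma local_vacant j : local (level j) (vacant j).
Proof. by apply: local_not; exact: local_marked. Qed.

Lemma local_all_vacant J n : local (fun k => J < nsnd k <= J + n)%N (all_vacant J n).
Proof.
apply: local_all => j; rewrite mem_iota => hj.
by apply: local_sub (local_vacant j) => k /eqP ->; lia.
Qed.

Lemma local_group J n : local (fun k => J < nsnd k <= J + n)%N (group J n).
Proof.
elim: n => [|n IH] /=; first exact: local_const.
apply: local_or; apply: local_and.
- by apply: local_sub IH => k; lia.
- by apply: local_sub (local_vacant _) => k /eqP ->; lia.
- by apply: local_sub (local_all_vacant _ _) => k; lia.
by apply: local_sub (local_hit _) => k /eqP ->; lia.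
Qed.

Hypotheses (u_gt0 : forall j, (0 < u j)%N)
  (u_growth : forall j, (blen j + 2 * u j <= u j.+1)%N).

Lemma u_le_blen j : (u j <= blen j)%N.
Proof. by rewrite leq_pmull. Qed.

Lemma u_mono j j' : (j <= j')%N -> (u j <= u j')%N.
Proof.
move=> /subnKC <-; elim: (j' - j)%N => [|n IH]; first by rewrite addn0.
by apply: leq_trans IH _; rewrite addnS; apply: leq_trans (u_growth _); lia.
Qed.

Lemma u_ge j : (j <= u j)%N.
Proof. by elim: j => // j IH; have := u_growth j; have := u_gt0 j; lia. Qed.

(** A mark at [blen j + u j] or later covers only positions beyond [u j], so no level of the group
    disturbs the first [u j] positions. *)
Lemma group_quiet J n j b : group J n b -> (J <= j < J + n)%N ->
  ~~ marked b j 0 (blen j + u j).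
Proof.
move=> /groupP[j0 _ [/andP[h0 _] ha]] /ha {}ha.
have [->//|/ha] := eqVneq j j0; apply: contra; apply: marked_sub => //.
by have := u_le_blen j; lia.
Qed.

(** The first mark [m] of the hit level lies in [[blen j + u j, blen j + 2 * u j)], and its block
    [(m - blen j, m]] is seen intact: levels above [j] do not reach it, and levels below are
    overridden. *)
Lemma group_block J n K b : (J + n <= K)%N -> group J n b ->
  (forall j, (J + n <= j < K)%N -> ~~ marked b j 0 (blen j + u j)) ->
  exists j t, [/\ (J <= j < J + n)%N, (u j < t <= 2 * u j)%N,
    forall i, (t <= i < t + u j)%N -> mode K i b &
    forall i, (t + u j <= i < t + blen j)%N -> ~~ mode K i b].
Proof.
move=> J'K /groupP[j hj [/andP[h0 h1] ha]] hq.
have exm : exists m, mark b m j by case/hasP: h1 => m _; exists m.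
case: (ex_minnP exm) => m mm minm.
have m_ge : (blen j + u j <= m)%N.
  rewrite leqNgt; apply: contra h0 => lt.
  by apply/hasP; exists m; rewrite ?mem_iota.
have m_lt : (m < blen j + 2 * u j)%N.
  case/hasP: h1 => m'; rewrite mem_iota => /andP[_ lt] /minm; lia.
(* Levels above [j] are silent up to [m], by vacancy inside the group and by [hq] beyond it:
   [u_growth] makes [u j'] exceed [m - blen j']. *)
have hi i : (i <= m)%N -> mode K i b =
    if marked b j i (blen j) then ~~ marked b j i (r * u j) else mode j i b.
  move=> im; rewrite (@mode_quiet j.+1 K) //; first lia.
  move=> j' hj'.
  have uj' : (blen j + 2 * u j <= u j')%N.
    by apply: leq_trans (u_growth j) _; apply: u_mono; lia.
  have [lt|le] := ltnP j' (J + n)%N; last first.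
    have := hq j' => /(_ _)/negP h; apply/negP => hm; apply: h; first lia.
    by apply: marked_sub hm => //; lia.
  have : vacant j' b by apply: ha; [lia|apply/eqP; lia].
  by apply: contra; apply: marked_sub => //; have := u_le_blen j'; lia.
have mkd i l : (i <= m)%N -> marked b j i l = (m < i + l)%N.
  move=> im; apply/hasP/idP => [[m' ]|lt]; last by exists m; rewrite ?mem_iota ?im.
  by rewrite mem_iota => hm' /minm; lia.
have be := blenE j.
have uj := u_gt0 j.
(* Because [m] is the first mark, the distance from [i] to [m] alone decides the mode: at least
   [r * u j] in the first [u j] positions of the block, less in the rest. *)
exists j, (m.+1 - blen j)%N; split; [lia|lia| |] => i hi'.
  by rewrite hi ?mkd ?ifT; lia.
by rewrite hi ?mkd ?ifT; lia.
Qed.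

End process.

(** * Probabilities of groups and of words in the block process *)

Section process_law.
Context {R : realType} (u : nat -> nat) (r : nat) (q tl : nat -> R).
Hypotheses (u_gt0 : forall j, (0 < u j)%N) (r_gt0 : (0 < r)%N)
  (u_growth : forall j, (blen u r j + 2 * u j <= u j.+1)%N)
  (q01 : forall j, 0 <= q j <= 1)
  (q_tail : forall J n, \sum_(k < n) q (J + k)%N * (blen u r (J + k))%:R <= tl J)
  (tl_small : forall J, tl J <= 1 / 4).

Local Notation blen := (blen u r).
Local Notation out := (out u r).
Local Notation outF := (outF u r).

Definition theta k : R := if nsnd k is j.+1 then q j else 1 / 2.

Lemma theta01 k : 0 <= theta k <= 1.
Proof. by rewrite /theta; case: (nsnd k) => [|j] //; lra. Qed.

Lemma theta_shift k : theta k.*2.+1 = theta k.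
Proof. by rewrite /theta -[k in LHS]npair_eta -npairS nsnd_npair. Qed.

Variable mu : probability cantor R.
Hypothesis muE : forall x, mu (cyl x) = (bweight theta x)%:E.

Let mloc I E (h : local I E) : event E := measurable_local h.

Lemma pr_mark m j : pr mu (fun b => mark b m j) = q j.
Proof. by rewrite (pr_coord (th := theta)) // /theta nsnd_npair. Qed.

Lemma pr_marked j i n : pr mu (fun b => marked b j i n) <= n%:R * q j.
Proof.
have [_ /le_trans] := pr_has mu (F := fun m b => mark b m j) (iota i n)
  (fun m => mloc (local_coord (I := predT) isT)).
apply; rewrite (eq_bigr (fun=> q j)); last by move=> m _; exact: pr_mark.
by rewrite big_const_seq count_predT size_iota iter_addr_0 mulr_natl.
Qed.

Lemma tl_ge0 J : 0 <= tl J.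
Proof. by have := q_tail J 0; rewrite big_ord0. Qed.

Lemma q_blen j : q j * (blen j)%:R <= tl j.
Proof. by have := q_tail j 1; rewrite big_ord_recl big_ord0 addn0 addr0. Qed.

Lemma q_u j : q j * (u j)%:R <= tl j.
Proof.
apply: le_trans (q_blen j); apply: ler_wpM2l; first by have /andP[] := q01 j.
by rewrite ler_nat u_le_blen.
Qed.

(** Marks are added one at a time. By independence each new one contributes [(1 - p) * q j], where
    [p], the probability of an earlier mark, is at most [1/4]. *)
Lemma pr_marked_ge j i n : (n <= u j)%N ->
  n%:R * q j / 2 <= pr mu (fun b => marked b j i n).
Proof.
elim: n => [|n IH] le; first by rewrite !mul0r pr_ge0.
have lm : local (fun k => k \in [seq npair m j.+1 | m <- iota i n]) (fun b => marked b j i n).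
  apply: local_has => m hm; apply: local_coord; exact: map_f.
have lk : local (predC (fun k => k \in [seq npair m j.+1 | m <- iota i n]))
    (fun b => mark b (i + n) j).
  apply: local_coord; apply/mapP => -[m hm /npair_inj[e _]].
  by move: hm; rewrite mem_iota; lia.
have mE := mloc (localT lm); have mF := mloc (localT lk).
rewrite (eq_pr _ (F := fun b => marked b j i n || mark b (i + n) j)); last first.
  by move=> b; rewrite /marked -addn1 iotaD has_cat /= orbF.
rewrite (pr_split mu (event_or mE mF) mE).
rewrite (eq_pr _ (F := fun b => marked b j i n)); last first.
  by move=> b; rewrite [LHS]andb_idl // => ->.
rewrite (eq_pr _ (E := fun b => _ && ~~ _) (F := fun b => ~~ marked b j i n && mark b (i + n) j)); last first.
  by move=> b; case: (marked _ _ _ _); case: (mark _ _ _).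
rewrite (pr_indep muE (local_not lm) lk) pr_not // pr_mark.
have h1 := IH (ltnW le); have h2 := pr_marked j i n.
have h3 : n%:R * q j <= 1 / 4.
  apply: le_trans (tl_small j); apply: le_trans (q_u j); rewrite mulrC.
  by apply: ler_wpM2l; [have /andP[] := q01 j|rewrite ler_nat ltnW].
by have /andP[q0 _] := q01 j; rewrite -natr1; nra.
Qed.

Lemma pr_hit j : q j * (u j)%:R / 4 <= pr mu (hit u r j).
Proof.
pose I := fun k => k \in [seq npair m j.+1 | m <- iota 0 (blen j + u j)].
have lm : local I (fun b => marked b j 0 (blen j + u j)).
  apply: local_has => m hm; apply: local_coord; exact: map_f.
have lk : local (predC I) (fun b => marked b j (blen j + u j) (u j)).
  apply: local_has => m hm; apply: local_coord; apply/mapP => -[m' hm' /npair_inj[e _]].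
  by move: hm hm'; rewrite !mem_iota; lia.
rewrite (pr_indep muE (local_not lm) lk) (pr_not mu (mloc lm)).
have h1 := pr_marked_ge (blen j + u j) (leqnn (u j)).
have h2 := pr_marked j 0 (blen j + u j); rewrite natrD mulrDl in h2.
have h3 := q_u j; have h4 := q_blen j; have h5 := tl_small j.
have /andP[q0 _] := q01 j.
have uq : 0 <= q j * (u j)%:R by rewrite mulr_ge0.
have : pr mu (fun b => marked b j 0 (blen j + u j)) <= 1 / 2 by lra.
move: h1 (pr_ge0 mu (fun b => marked b j 0 (blen j + u j))).
set x := pr _ _; set y := pr _ _ => h1 y0 x2; nra.
Qed.

Lemma pr_all_vacant J n :
  1 - 2 * \sum_(k < n) q (J + k)%N * (blen (J + k))%:R <= pr mu (all_vacant u r J n).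
Proof.
have mm k := mloc (local_marked (J + k) 0 (2 * blen (J + k))).
have e : all_vacant u r J n =1 (fun b => ~~ has (fun k => marked b (J + k) 0 (2 * blen (J + k))) (iota 0 n)).
  move=> b; rewrite /all_vacant -all_predC -[in iota J n](addn0 J) iotaDl all_map.
  by apply: eq_all.
have [mh] := pr_has mu (F := fun k b => marked b (J + k) 0 (2 * blen (J + k))) (iota 0 n) mm.
rewrite (eq_pr _ e) pr_not // => h; rewrite lerD2l lerN2; apply: le_trans h _.
have -> : iota 0 n = index_iota 0 n by rewrite /index_iota subn0.
rewrite big_mkord mulr_sumr.
apply: ler_sum => k _.
by apply: le_trans (pr_marked _ _ _) _; rewrite natrM -mulrA (mulrC (blen _)%:R).
Qed.

Lemma hit_vacant j b : hit u r j b -> ~~ vacant u r j b.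
Proof.
move=> /andP[_ h]; rewrite /vacant negbK; apply: marked_sub h => //.
have : (u j <= r * u j)%N by rewrite leq_pmull.
by have := blenE u r j; lia.
Qed.

(** The two cases of [group] are disjoint and factor over independent levels, which gives the
    recursion [G' = G v + V h] with [V' = V v <= V]. *)
Lemma pr_group_aux J n :
  pr mu (all_vacant u r J n) * \sum_(k < n) pr mu (hit u r (J + k)) <= pr mu (group u r J n).
Proof.
elim: n => [|n IH]; first by rewrite big_ord0 mulr0 pr_ge0.
have lg := local_group u r J n; have lv := local_all_vacant u r J n.
have lvo := local_vacant u r (J + n); have lh := local_hit u r (J + n).
have cmp : subpred (level (J + n)) (predC (fun k => J < nsnd k <= J + n)%N).
  by move=> k /eqP /= ->; lia.
have -> : pr mu (all_vacant u r J n.+1) = pr mu (all_vacant u r J n) * pr mu (vacant u r (J + n)).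
  rewrite -(pr_indep muE lv (local_sub cmp lvo)); apply: eq_pr => b.
  by rewrite /all_vacant -addn1 iotaD all_cat /= andbT.
have mgv := event_and (mloc lg) (mloc lvo); have mvh := event_and (mloc lv) (mloc lh).
rewrite big_ord_recr /= (pr_split mu (event_or mgv mvh) mgv).
rewrite (eq_pr _ (E := fun b => (_ || _) && _) (F := fun b => group u r J n b && vacant u r (J + n) b)); last first.
  by move=> b; rewrite [LHS]andb_idl // => ->.
rewrite (eq_pr _ (E := fun b => _ && ~~ _)
  (F := fun b => all_vacant u r J n b && hit u r (J + n) b)); last first.
  move=> b; have := @hit_vacant (J + n) b.
  by case: (hit _ _ _ _) => [/(_ isT)/negbTE ->|_]; rewrite ?andbF ?orbF ?andbT ?andbN.
rewrite (pr_indep muE lg (local_sub cmp lvo)) (pr_indep muE lv (local_sub cmp lh)).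
have v1 := pr_le1 mu (mloc lvo); have v0 := pr_ge0 mu (vacant u r (J + n)).
have a0 := pr_ge0 mu (all_vacant u r J n); have h0 := pr_ge0 mu (hit u r (J + n)).
rewrite mulrDr; apply: lerD.
  by rewrite mulrAC; apply: ler_wpM2r.
by rewrite mulrAC ler_piMr // mulr_ge0.
Qed.

Lemma pr_group J n :
  (\sum_(k < n) q (J + k)%N * (u (J + k))%:R) / 8 <= pr mu (group u r J n).
Proof.
apply: le_trans (pr_group_aux J n).
have h1 := pr_all_vacant J n; have h2 := q_tail J n; have h3 := tl_small J.
have : 1 / 2 <= pr mu (all_vacant u r J n) by lra.
have : (\sum_(k < n) q (J + k)%N * (u (J + k))%:R) / 4 <= \sum_(k < n) pr mu (hit u r (J + k)).
  by rewrite mulr_suml; apply: ler_sum => k _; exact: pr_hit.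
have : 0 <= \sum_(k < n) q (J + k)%N * (u (J + k))%:R.
  by apply: sumr_ge0 => k _; rewrite mulr_ge0 //; have /andP[] := q01 (J + k).
by set x := \sum_(_ < _) _; set y := \sum_(_ < _) _; set z := pr _ _; nra.
Qed.

Definition law (x : word) : R := pr mu (fun b => pre (outF b) (size x) == x).

(** Only marks below [n + blen j] let level [j] touch the first [n] positions. The factor [c]
    compares this window with [blen j], to which the tail bound applies. *)
Lemma pr_active J n (c : R) : (forall k, (n + blen (J + k))%:R <= c * (blen (J + k))%:R) ->
  forall N, \sum_(k < N) pr mu (fun b => marked b (J + k) 0 (n + blen (J + k))) <= c * tl J.
Proof.
move=> hc N; have c0 : 0 <= c.
  have := hc 0%N; rewrite -[X in X%:R <= _]add0n => h.
  have bl : (0 : R) < (blen (J + 0))%:R by rewrite ltr0n muln_gt0 u_gt0.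
  by rewrite -(pmulr_lge0 _ bl); apply: le_trans h; rewrite ler0n.
apply: le_trans (ler_wpM2l c0 (q_tail J N)); rewrite mulr_sumr; apply: ler_sum => k _.
apply: le_trans (pr_marked _ _ _) _; rewrite mulrCA mulrC.
by apply: ler_wpM2l (hc k); have /andP[] := q01 (J + k).
Qed.

Lemma law_approx J (x : word) :
  `|law x - pr mu (fun b => pre (out J b) (size x) == x)| <= (size x).+1%:R * tl J.
Proof.
set n := size x; have mF := event_pre_outF u r n x.
have mO := mloc (local_pre_out u r J n x).
have mm k := mloc (local_marked (J + k) 0 (n + blen (J + k))).
have hc k : (n + blen (J + k))%:R <= n.+1%:R * (blen (J + k))%:R :> R.
  by rewrite -natrM ler_nat mulSn addnC leq_add2l leq_pmulr // muln_gt0 u_gt0.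
have act := pr_active hc.
have quiet b : (forall k, ~~ marked b (J + k) 0 (n + blen (J + k))) ->
    pre (outF b) n = pre (out J b) n.
  by move=> h; apply: outF_quiet => j /subnKC <-; exact: h.
have bad E F : event E -> event F ->
    (forall b, pre (outF b) n = pre (out J b) n -> E b = F b) ->
    pr mu E <= pr mu F + n.+1%:R * tl J.
  move=> mE mF' h; rewrite (pr_split mu mE mF'); apply: lerD.
    by apply: pr_mono; [exact: event_and|exact: mF'|move=> b /andP[]].
  apply: (pr_exists _ mm) act; first exact: event_and mE (event_not mF').
  move=> b /andP[Eb nFb]; apply: contrapT => nex; move: nFb; rewrite -h ?Eb //.
  by apply: quiet => k; apply/negP => hk; apply: nex; exists k.
rewrite ler_norml /law -/n; apply/andP; split.
  rewrite lerBrDr addrC -lerBrDr opprK.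
  by apply: bad => // b ->.
by rewrite lerBlDl; apply: bad => // b ->.
Qed.

(** An additive error would be useless for words of tiny probability. Here the interfering marks
    belong to levels from [J] on, hence are independent of [out J], and the loss is at most
    [2 * tl J <= 1/2] of the probability itself. *)
Lemma law_ge J (x : word) : (size x <= u J)%N ->
  pr mu (fun b => pre (out J b) (size x) == x) <= 2 * law x.
Proof.
set n := size x => le; have mF := event_pre_outF u r n x.
have lO := local_pre_out u r J n x; have mO := mloc lO.
have mm k := mloc (local_marked (J + k) 0 (n + blen (J + k))).
have hc k : (n + blen (J + k))%:R <= 2 * (blen (J + k))%:R :> R.
  rewrite -natrM ler_nat mul2n -addnn leq_add2r; apply: leq_trans le _.
  by apply: leq_trans (u_mono u_growth (leq_addr k J)) (u_le_blen _ _ _).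
have act := pr_active hc.
rewrite -/(law x); set p := pr mu _.
have p0 : 0 <= p by exact: pr_ge0.
have : p <= law x + p * (2 * tl J).
  rewrite {1}/p (pr_split mu mO mF); apply: lerD.
    by apply: pr_mono; [exact: event_and|exact: mF|move=> b /andP[]].
  apply: (pr_exists (F := fun k b => (pre (out J b) n == x) &&
     marked b (J + k) 0 (n + blen (J + k)))).
  - exact: event_and mO (event_not mF).
  - by move=> k; apply: event_and.
  - move=> b /andP[Ob nFb]; apply: contrapT => nex; move/negP: nFb; apply.
    rewrite -(eqP Ob); apply/eqP/outF_quiet => j /subnKC <-; apply/negP => hk.
    by apply: nex; exists (j - J)%N; rewrite Ob.
  move=> N; apply: le_trans (ler_wpM2l p0 (act N)); rewrite mulr_sumr.
  apply: ler_sum => k _; rewrite (pr_indep muE lO) //.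
  by apply: local_sub (local_marked _ _ _) => i /eqP /= ->; lia.
by have := tl_small J; have := tl_ge0 J; nra.
Qed.

End process_law.

(** * Entropy *)

Section words.

Definition words n : seq word := [seq tval t | t : n.-tuple bool].

Lemma mem_words n w : (w \in words n) = (size w == n).
Proof.
apply/mapP/eqP => [[t _ ->]|e]; first exact: size_tuple.
by rewrite -e; exists (in_tuple w); rewrite ?mem_enum.
Qed.

Lemma uniq_words n : uniq (words n).
Proof. by rewrite map_inj_uniq ?enum_uniq //; exact: val_inj. Qed.

Lemma size_words n : size (words n) = (2 ^ n)%N.
Proof. by rewrite size_map -cardE card_tuple card_bool. Qed.

Lemma sum_words (V : nmodType) n (f : word -> V) :
  \sum_(x : n.-tuple bool) f x = \sum_(w <- words n) f w.
Proof. by rewrite big_map big_enum. Qed.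

Lemma sum_words_cat (V : nmodType) m n (f : word -> V) :
  \sum_(w <- words (m + n)) f w = \sum_(x <- words m) \sum_(y <- words n) f (x ++ y).
Proof.
have cat_inj x x' (y y' : word) : size x = size x' -> x ++ y = x' ++ y' -> (x, y) = (x', y').
  by move=> e /eqP; rewrite eqseq_cat // => /andP[/eqP -> /eqP ->].
transitivity (\sum_(w <- [seq x ++ y | x <- words m, y <- words n]) f w); last by rewrite big_allpairs_dep.
apply: perm_big; apply: uniq_perm; first exact: uniq_words.
  apply: allpairs_uniq; rewrite ?uniq_words // => -[x y] [x' y'].
  move=> /allpairsP[[a b] /= [ha hb [-> ->]]] /allpairsP[[a' b'] /= [ha' hb' [-> ->]]].
  by apply: cat_inj; move: ha ha'; rewrite !mem_words => /eqP -> /eqP ->.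
move=> w; rewrite mem_words; apply/eqP/allpairsP => [e|[[x y] /= [+ + ->]]].
  exists (take m w, drop m w); rewrite /= !mem_words cat_take_drop size_take size_drop e.
  by rewrite addKn eqxx; split=> //; case: ltnP; lia.
by rewrite !mem_words size_cat => /eqP -> /eqP ->.
Qed.

Lemma words0 : words 0 = [:: [::]].
Proof.
have := size_words 0; have := mem_words 0; case: (words 0) => [|x []] //= h _.
by have := h x; rewrite inE eqxx => /esym/nilP ->.
Qed.

Lemma words1 : words 1 = [:: [:: true]; [:: false]] \/ words 1 = [:: [:: false]; [:: true]].
Proof.
have := size_words 1; have := uniq_words 1; have := mem_words 1.
case: (words 1) => [|x [|y []]] //= h /andP[xy _] _.
have := h x; have := h y; rewrite !inE !eqxx ?orbT => /esym/eqP sy /esym/eqP sx.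
move: x y sx sy xy {h} => [|[] []] // [|[] []] // _ _; rewrite inE ?eqxx //=.
  by left.
by right.
Qed.

Lemma sum_words1 (V : nmodType) (f : word -> V) :
  \sum_(w <- words 1) f w = f [:: false] + f [:: true].
Proof. by case: words1 => ->; rewrite !big_cons big_nil addr0 // addrC. Qed.

Lemma sum_words_rcons (V : nmodType) n (f : word -> V) :
  \sum_(w <- words n.+1) f w = \sum_(x <- words n) (f (rcons x false) + f (rcons x true)).
Proof.
rewrite -addn1 sum_words_cat; apply: eq_bigr => x _.
by rewrite sum_words1 !cats1.
Qed.

End words.

Section entropy_inequalities.
Context {R : realType}.
Implicit Types a b c p : R.

Lemma ln_le_sub1 a : 0 < a -> ln a <= a - 1.
Proof. by move=> a0; have := @le_ln1Dx R (a - 1); rewrite (addrC 1) subrK; apply; lra. Qed.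

Lemma ln2_gt0 : 0 < ln (2 : R).
Proof. by apply: ln_gt0; lra. Qed.

Lemma ln2_ge_half : 1 / 2 <= ln (2 : R).
Proof.
have := @ln_le_sub1 2^-1; rewrite lnV ?posrE ?invr_gt0 // => /(_ (ltr0n R 2)).
have e : (2 : R)^-1 = 1 / 2 by rewrite div1r.
by rewrite e; lra.
Qed.

Lemma negplogpE p : negplogp p = - (p * ln p) / ln 2.
Proof.
rewrite /negplogp /log2; case: eqP => [->|_]; first by rewrite mul0r oppr0 mul0r.
by rewrite mulrA mulNr.
Qed.

Lemma negplogp_ge0 p : 0 <= p <= 1 -> 0 <= negplogp p.
Proof.
move=> /andP[p0 p1]; rewrite negplogpE divr_ge0 ?(ltW ln2_gt0) //.
by rewrite -mulrN mulr_ge0 // oppr_ge0 ln_le0.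
Qed.

(* [ln t <= t - 1] at [t = b c / a] *)
Lemma gibbs_term a b c : 0 <= a -> a <= b -> a <= c ->
  a * (ln b + ln c - ln a) <= b * c - a.
Proof.
rewrite le_eqVlt => /orP[/eqP <- b0 c0|a0 ab ac]; first by rewrite mul0r subr0 mulr_ge0.
have b0 := lt_le_trans a0 ab; have c0 := lt_le_trans a0 ac.
rewrite -lnM ?posrE // -ln_div ?posrE ?mulr_gt0 //.
have h := ln_le_sub1 (divr_gt0 (mulr_gt0 b0 c0) a0).
apply: le_trans (ler_wpM2l (ltW a0) h) _.
by rewrite mulrBr mulr1 mulrC divfK // gt_eqF.
Qed.

(** Up to the factor [ln 2], the gain is at least the harmonic mean [2ab / (a + b)], which is never
    below the smaller of [a] and [b]. *)
Lemma negplogp_split a b c : 0 <= c -> c <= a -> c <= b ->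
  negplogp (a + b) + c / ln 2 <= negplogp a + negplogp b.
Proof.
move=> c0 ca cb; rewrite !negplogpE -!mulrDl ler_pM2r ?invr_gt0 ?ln2_gt0 //.
have [a0|a0] := eqVneq a 0; first by rewrite a0 add0r mul0r; lra.
have [b0|b0] := eqVneq b 0; first by rewrite b0 addr0 mul0r; lra.
have {a0} a0 : 0 < a by rewrite lt_def a0 (le_trans c0).
have {b0} b0 : 0 < b by rewrite lt_def b0 (le_trans c0).
have s0 : 0 < a + b by rewrite addr_gt0.
have ha := ln_le_sub1 (divr_gt0 a0 s0); have hb := ln_le_sub1 (divr_gt0 b0 s0).
rewrite ln_div ?posrE // in ha; rewrite ln_div ?posrE // in hb.
have ea : a / (a + b) - 1 = - (b / (a + b)) by field; lra.
have eb : b / (a + b) - 1 = - (a / (a + b)) by field; lra.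
rewrite ea in ha; rewrite eb in hb.
have h1 := ler_wpM2l (ltW a0) ha; have h2 := ler_wpM2l (ltW b0) hb.
have h3 : c <= a * (b / (a + b)) + b * (a / (a + b)).
  have -> : a * (b / (a + b)) + b * (a / (a + b)) = 2 * a * b / (a + b) by field; lra.
  by rewrite ler_pdivlMr //; nra.
by nra.
Qed.

(** With [s = sqrt p], the inequality [ln t <= t - 1] at [1/s] and at [1/(1 - p)] bounds the two
    terms by [2s] and [s] in natural units; dividing by [ln 2 >= 1/2] gives 6. *)
Lemma negplogp_pair_le p : 0 <= p <= 1 ->
  negplogp p + negplogp (1 - p) <= 6 * Num.sqrt p.
Proof.
move=> /andP[]; rewrite le_eqVlt => /orP[/eqP <- _|p0 p1].
  by rewrite subr0 !negplogpE ln1 mul0r mulr0 oppr0 !mul0r addr0 sqrtr0 mulr0 lexx.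
set s := Num.sqrt p; have s0 : 0 < s by rewrite sqrtr_gt0.
have ps : p = s ^+ 2 by rewrite sqr_sqrtr // ltW.
have s1 : s <= 1 by rewrite /s -[leRHS]sqrtr1 ler_sqrt.
have h1 : - (p * ln p) <= 2 * s.
  rewrite ps lnXn // -mulrN.
  have := @ln_le_sub1 s^-1; rewrite lnV ?posrE // invr_gt0 => /(_ s0).
  rewrite -(ler_pM2l (exprn_gt0 2 s0)) => h.
  have e : s ^+ 2 * (s^-1 - 1) = s - s ^+ 2 by field; lra.
  by rewrite e in h; rewrite mulr2n; have := exprn_gt0 2 s0; nra.
have h2 : - ((1 - p) * ln (1 - p)) <= s.
  have [->|np1] := eqVneq p 1; first by rewrite subrr mul0r oppr0 ltW.
  have q0 : 0 < 1 - p by rewrite subr_gt0 lt_neqAle np1.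
  have := @ln_le_sub1 (1 - p)^-1; rewrite lnV ?posrE // invr_gt0 => /(_ q0).
  rewrite -(ler_pM2l q0) => h.
  have e : (1 - p) * ((1 - p)^-1 - 1) = p by field; lra.
  by rewrite e in h; rewrite -mulrN; apply: le_trans h _; rewrite ps; nra.
rewrite !negplogpE -mulrDl ler_pdivrMr ?ln2_gt0 //.
have := ler_wpM2l (ltW s0) ln2_ge_half; lra.
Qed.

(** Fekete's lemma. The limit is the infimum of [a n / n] over [n >= 1], whence the two bounds on
    it. *)
Lemma subadditive_cvg (a : nat -> R) : (forall n, 0 <= a n) ->
  (forall m n, a (m + n)%N <= a m + a n) ->
  exists L, [/\ (fun n => a n / n%:R) @ \oo --> L, L <= a 1%N &
    forall c, (forall n, c * n%:R <= a n) -> c <= L].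
Proof.
move=> a0 asub; pose A : set R := [set a n.+1 / n.+1%:R | n in [set: nat]].
have lbA c : (forall n, c * n%:R <= a n) -> lbound A c.
  by move=> h _ [n _ <-]; rewrite ler_pdivlMr ?ltr0n.
have infA : has_inf A.
  split; first by exists (a 1%N / 1%:R), 0%N.
  by exists 0; apply: lbA => n; rewrite mul0r.
have infle n : inf A <= a n.+1 / n.+1%:R by apply: ge_inf => //; [case: infA|exists n].
exists (inf A); split; last first.
- by move=> c h; apply: lb_le_inf; [case: infA|exact: lbA].
- by have := infle 0%N; rewrite divr1.
apply/cvgrPdist_le => e e0.
have [_ [m _ <-] hm] := inf_adherent (divr_gt0 e0 (ltr0n _ 2)) infA.
pose M := m.+1; have M0 : (0 : R) < M%:R by rewrite ltr0n.
have amul q : a (q * M)%N <= q%:R * a M + a 0%N.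
  elim: q => [|q IH]; first by rewrite mul0n mul0r add0r.
  by rewrite mulSn -natr1 mulrDl mul1r; apply: le_trans (asub _ _) _; lra.
pose C := a 0%N + \sum_(k < M) a k.
have bound n : a n <= n%:R / M%:R * a M + C.
  rewrite {1}(divn_eq n M); apply: le_trans (asub _ _) _.
  have h1 := amul (n %/ M)%N.
  have h2 : a (n %% M)%N <= \sum_(k < M) a k.
    have lt : (n %% M < M)%N by rewrite ltn_mod.
    rewrite (bigD1 (Ordinal lt)) //= lerDl; exact: sumr_ge0.
  have h3 : (n %/ M)%:R * a M <= n%:R / M%:R * a M.
    apply: ler_wpM2r => //; rewrite ler_pdivlMr // -natrM ler_nat; exact: leq_trunc_div.
  by rewrite /C; lra.
have C0 : 0 <= C by rewrite addr_ge0 // sumr_ge0.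
near=> n.
have n0 : (0 < n)%N by near: n; exists 1%N.
have n0R : (0 : R) < n%:R by rewrite ltr0n.
have hn : C / (e / 2) <= n%:R by near: n; exact: nbhs_infty_ger.
have inf_n : inf A <= a n / n%:R by rewrite -(prednK n0); exact: infle.
rewrite ler_norml; apply/andP; split; last by lra.
rewrite lerNl opprB lerBlDr.
have hC : C / n%:R <= e / 2.
  by rewrite ler_pdivrMr // mulrC -ler_pdivrMr // divr_gt0.
have hb : a n / n%:R <= a M / M%:R + C / n%:R.
  apply: le_trans (ler_wpM2r _ (bound n)) _; first by rewrite invr_ge0 ltW.
  by rewrite mulrDl lerD2r le_eqVlt; apply/orP; left; apply/eqP; field; rewrite !gt_eqF.
by move: hm hb hC; rewrite -/M; lra.
Unshelve. all: by end_near. Qed.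

End entropy_inequalities.

(** * Entropy rate of a stationary measure *)

Section entropy_rate.
Context {R : realType} (P : probability cantor R).
Hypothesis stat : stationary P.

Lemma Pw_ge0 x : 0 <= Pw P x.
Proof. by rewrite fine_ge0. Qed.

Lemma PwE x : P (cyl x) = (Pw P x)%:E.
Proof. by rewrite /Pw fineK // fin_num_measure //; exact: measurable_cyl. Qed.

Lemma Pw_nil : Pw P [::] = 1.
Proof. by rewrite /Pw cyl_nil probability_setT. Qed.

Lemma Pw_rcons x : Pw P x = Pw P (rcons x false) + Pw P (rcons x true).
Proof.
apply: EFin_inj; rewrite EFinD -!PwE cyl_rcons; apply: measureU.
- exact: measurable_cyl.
- exact: measurable_cyl.
- exact: cyl_rcons_disj.
Qed.

Lemma pre_cons b n : pre b n.+1 = b 0%N :: pre (Defs.shift b) n.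
Proof.
by rewrite /pre /mkseq /= (iotaDl 1 0) -map_comp.
Qed.

Lemma Pw_cons x : Pw P x = Pw P (false :: x) + Pw P (true :: x).
Proof.
apply: EFin_inj; rewrite EFinD -!PwE -stat; last exact: measurable_cyl.
have -> : Defs.shift @^-1` cyl x = cyl (false :: x) `|` cyl (true :: x).
  apply/seteqP; split=> b; rewrite /cyl /= !pre_cons.
    by move=> ->; case: (b 0%N); [right|left].
  by case=> -[].
apply: measureU.
- exact: measurable_cyl.
- exact: measurable_cyl.
rewrite -subset0 => b [/cylE h0 /cylE h1].
by have := h0 0%N isT; rewrite (h1 0%N isT).
Qed.

Lemma Pw_prefix_sum n x : Pw P x = \sum_(y <- words n) Pw P (x ++ y).
Proof.
elim: n x => [|n IH] x; last by rewrite sum_words_rcons (IH x); apply: eq_bigr => y _;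
  rewrite (Pw_rcons (x ++ y)) !rcons_cat.
by rewrite words0 big_seq1 cats0.
Qed.

Lemma Pw_suffix_sum n y : Pw P y = \sum_(x <- words n) Pw P (x ++ y).
Proof.
elim: n => [|n IH]; first by rewrite words0 big_seq1.
rewrite -add1n sum_words_cat sum_words1 /= IH -big_split /=.
by apply: eq_bigr => x _; rewrite Pw_cons.
Qed.

Lemma Pw_le1 x : Pw P x <= 1.
Proof. by rewrite -lee_fin -PwE probability_le1 //; exact: measurable_cyl. Qed.

Definition block_entropy n : R := \sum_(x <- words n) negplogp (Pw P x).

Lemma block_entropy_ge0 n : 0 <= block_entropy n.
Proof. by apply: sumr_ge0 => x _; apply: negplogp_ge0; rewrite Pw_ge0 Pw_le1. Qed.

Lemma block_entropy_subadditive m n :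
  block_entropy (m + n) <= block_entropy m + block_entropy n.
Proof.
rewrite /block_entropy sum_words_cat.
under eq_bigr do under eq_bigr do rewrite negplogpE.
under [X in _ <= X + _]eq_bigr do rewrite negplogpE.
under [X in _ <= _ + X]eq_bigr do rewrite negplogpE.
rewrite -!mulr_suml; under eq_bigr do rewrite -mulr_suml.
rewrite -mulr_suml -mulrDl ler_pM2r ?invr_gt0 ?ln2_gt0 //.
have -> : \sum_(x <- words m) - (Pw P x * ln (Pw P x)) =
    \sum_(x <- words m) \sum_(y <- words n) - (Pw P (x ++ y) * ln (Pw P x)).
  by apply: eq_bigr => x _; rewrite {1}(Pw_prefix_sum n x) mulr_suml sumrN.
have -> : \sum_(y <- words n) - (Pw P y * ln (Pw P y)) =
    \sum_(x <- words m) \sum_(y <- words n) - (Pw P (x ++ y) * ln (Pw P y)).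
  rewrite exchange_big /=; apply: eq_bigr => y _.
  by rewrite {1}(Pw_suffix_sum m y) mulr_suml sumrN.
rewrite -subr_ge0 -big_split /= -sumrB.
(* The joint weights and the products of marginals both sum to 1, so the lower bound collected from
   [gibbs_term] is zero. *)
apply: (@le_trans _ _ (\sum_(x <- words m) \sum_(y <- words n)
    (Pw P (x ++ y) - Pw P x * Pw P y))).
  have sum1 k : \sum_(x <- words k) Pw P x = 1 by rewrite -Pw_nil (Pw_prefix_sum k [::]).
  under eq_bigr do rewrite sumrB -Pw_prefix_sum -mulr_sumr sum1 mulr1 subrr.
  by rewrite big1.
apply: ler_sum => x _; rewrite -big_split /= -sumrB; apply: ler_sum => y _.
have le1 : Pw P (x ++ y) <= Pw P x.
  rewrite (Pw_prefix_sum (size y) x) (bigD1_seq y) ?uniq_words ?mem_words //= lerDl.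
  by apply: sumr_ge0 => z _; exact: Pw_ge0.
have le2 : Pw P (x ++ y) <= Pw P y.
  rewrite (Pw_suffix_sum (size x) y) (bigD1_seq x) ?uniq_words ?mem_words //= lerDl.
  by apply: sumr_ge0 => z _; exact: Pw_ge0.
by have := gibbs_term (Pw_ge0 (x ++ y)) le1 le2; lra.
Qed.

(** [h x] is a mass present in both continuations of [x], so each further letter adds at least
    [rho / ln 2] to the block entropy. Above, the rate is at most the entropy of one letter. *)
Lemma entropy_bounds (h : word -> R) (rho eps : R) :
  (forall x, 0 <= h x) -> (forall x c, h x <= Pw P (rcons x c)) ->
  0 < rho -> (forall n, rho <= \sum_(x <- words n) h x) ->
  6 * Num.sqrt (Pw P [:: true]) <= eps ->
  exists H, entropy_is P H /\ 0 < H <= eps.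
Proof.
move=> h0 hP rho0 hrho heps.
have [L [cv L1 Lc]] := subadditive_cvg block_entropy_ge0 block_entropy_subadditive.
exists L; split.
  rewrite /entropy_is (_ : block_entropy_rate P = fun n => block_entropy n / n%:R) //.
  by apply/funext => n; rewrite /block_entropy_rate /block_entropy -(sum_words n (fun w => negplogp (Pw P w))).
have grow n : block_entropy n + rho / ln 2 <= block_entropy n.+1.
  rewrite /block_entropy sum_words_rcons.
  apply: (@le_trans _ _ (\sum_(x <- words n) (negplogp (Pw P x) + h x / ln 2))).
    rewrite big_split /= lerD2l -mulr_suml ler_pM2r ?invr_gt0 ?ln2_gt0 //.
  by apply: ler_sum => x _; rewrite Pw_rcons; apply: negplogp_split.
apply/andP; split.
  apply: lt_le_trans (Lc (rho / ln 2) _); first by rewrite divr_gt0 ?ln2_gt0.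
  elim=> [|n IH]; first by rewrite mulr0 block_entropy_ge0.
  by apply: le_trans (grow n); rewrite -(natr1 n) mulrDr mulr1 lerD2r.
apply: le_trans L1 _; rewrite /block_entropy sum_words1.
have e : Pw P [:: false] = 1 - Pw P [:: true].
  by have := Pw_rcons [::]; rewrite Pw_nil /= => ->; ring.
rewrite e addrC; apply: le_trans heps; apply: negplogp_pair_le.
by rewrite Pw_ge0 Pw_le1.
Qed.

End entropy_rate.

(** * Complexity *)

Section word_codes.

Lemma enc_word_rcons w c : enc_word (rcons w c) = ((enc_word w).*2 + 1 + c)%N.
Proof. by rewrite /enc_word foldl_rcons. Qed.

Lemma enc_word_inj : injective enc_word.
Proof.
elim/last_ind => [|w c IH] v; case/lastP: v => [|v d] //.
- by rewrite enc_word_rcons addn1.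
- by rewrite enc_word_rcons addn1.
rewrite !enc_word_rcons => e; have : odd ((enc_word w).*2 + 1 + c) = odd ((enc_word v).*2 + 1 + d) by rewrite e.
rewrite !oddD !odd_double /= !oddb => /negb_inj cd; rewrite cd in e *.
by move: e; move/addIn/addIn/double_inj/IH => ->.
Qed.

Lemma enc_word_bounds w : (2 ^ size w <= (enc_word w).+1 < 2 ^ (size w).+1)%N.
Proof.
elim/last_ind: w => // w c IH; rewrite enc_word_rcons size_rcons !expnS in IH *.
by case: c; lia.
Qed.

(** The integer part of [log2 (n + 1)], counted by a bounded sum so that [crec_sum] applies. *)
Definition code_size n : nat := (\sum_(k < n.+1) (2 ^ k.+1 <= n.+1))%N.

Lemma code_sizeE w : code_size (enc_word w) = size w.
Proof.
have /andP[lo hi] := enc_word_bounds w; rewrite /code_size.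
have sz : (size w <= (enc_word w).+1)%N.
  by apply: leq_trans lo; apply: ltnW; exact: ltn_expl.
rewrite -[RHS]card_ord -sum1_card (big_ord_widen _ (fun=> 1%N) sz) [RHS]big_mkcond /=.
apply: eq_bigr => k _; case: ltnP => hk.
  by rewrite (leq_trans _ lo) // leq_exp2l.
rewrite leqNgt (leq_trans hi) // leq_exp2l //.
Qed.

Lemma crec_code_size F : crec F -> crec (fun g x => code_size (F g x)).
Proof.
move=> hF; apply: (crec_comp (F := fun _ => code_size)) hF.
apply: (crec_sum (F := fun _ k n => nat_of_bool (2 ^ k.+1 <= n.+1)%N)); last by repeat crec1.
by repeat crec1.
Qed.

(** [(enc_word w).+1] is the number written in binary as 1 followed by [w], so appending zeros
    multiplies it by a power of 2. *)
Lemma enc_word_nseq w m : enc_word (w ++ nseq m false) = ((enc_word w).+1 * 2 ^ m).-1.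
Proof.
elim: m => [|m IH]; first by rewrite cats0 expn0 muln1.
have -> : w ++ nseq m.+1 false = rcons (w ++ nseq m false) false.
  by rewrite -cats1 -catA -(nseqD m 1) addn1.
by rewrite enc_word_rcons IH expnS; have := expn_gt0 2 m; nia.
Qed.

(** A decoder under which a word followed by [r] times as many zeros is described by the word
    alone. *)
Definition pad r (w : word) : option word := Some (w ++ nseq (r * size w) false).

Lemma pcomputable_pad r : pcomputable (pad r).
Proof.
have [c hc] : crec (fun _ x => (x.+1 * 2 ^ (r * code_size x)).-1).
  apply: crec_pred; apply: crec_mul; first by repeat crec1.
  apply: crec_exp; first by repeat crec1.
  by apply: crec_mul; [exact: crec_const|exact: crec_code_size crec_id].
exists c => w v; have h := hc no_oracle (enc_word w).
rewrite code_sizeE -enc_word_nseq in h; split=> [[<-] //|h'].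
by congr Some; apply: enc_word_inj; exact: evalp_det h h'.
Qed.

End word_codes.

Section complexity.
Context {R : realType}.

Lemma Kdec_pad psi r : optimal_decoder (R := R) psi ->
  exists c : nat, forall w, (Kdec psi (w ++ nseq (r * size w) false) <= ((size w + c)%:R : R)%:E)%E.
Proof.
move=> [_ /(_ _ (pcomputable_pad r))[c hc]]; exists c => w.
apply: le_trans (hc _) _; rewrite natrD EFinD leeD2r //.
by apply: ereal_inf_lbound; exists w.
Qed.

Definition simple (psi : word -> option word) m (w : word) : Prop :=
  exists2 p, (size p < m)%N & psi p = Some w.

Lemma Kdec_ge psi m w : ~ simple psi m w -> ((m%:R : R)%:E <= Kdec psi w)%E.
Proof.
move=> h; apply: le_ereal_inf_tmp => _ [p pw <-]; rewrite lee_fin ler_nat leqNgt.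
by apply/negP => lt; apply: h; exists p.
Qed.

Lemma pr_sum_disjoint (mu : probability cantor R) (T : eqType) (s : seq T)
    (F : T -> (nat -> bool) -> bool) : uniq s -> (forall x, event (F x)) ->
  (forall x y b, x \in s -> y \in s -> F x b -> F y b -> x = y) ->
  \sum_(x <- s) pr mu (F x) <= pr mu (fun b => has (F^~ b) s).
Proof.
elim: s => [|x s IH] /=; first by rewrite big_nil pr_ge0.
move=> /andP[xs us] mF dis; rewrite big_cons.
have [mh _] := pr_has mu s mF.
rewrite (pr_split mu (event_or (mF x) mh) (mF x)); apply: lerD.
  rewrite le_eqVlt; apply/orP; left; apply/eqP/eq_pr => b.
  by rewrite [RHS]andb_idl // => ->.
apply: le_trans (IH us mF _) _.
  by move=> y z b ys zs; apply: dis; rewrite inE ?ys ?zs orbT.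
apply: pr_mono => //; first by apply: event_and; [exact: event_or|exact: event_not].
move=> b hb; rewrite hb orbT /=; apply/negP => Fx; case/hasP: hb => y ys Fy.
by move: xs; rewrite (dis x y b) ?ys ?mem_head // inE ys orbT.
Qed.

Lemma fair_measure_exists : exists nu : probability cantor R,
  forall x : word, event (fun b => pre b (size x) == x) /\
    pr nu (fun b => pre b (size x) == x) = 2 ^- size x.
Proof.
have [|nu hnu] := @bernoulli_measure_exists R (fun=> 1 / 2); first by move=> _; lra.
exists nu => x; have e : [set b | pre b (size x) == x] = cyl x by apply/seteqP; split=> b /eqP.
split; first by rewrite /event e; exact: measurable_cyl.
rewrite /pr e hnu /= /bweight (eq_bigr (fun=> 2^-1)).
  by rewrite prodr_const card_ord exprVn.
by move=> i _; case: ifP => _; rewrite div1r //; lra.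
Qed.

(** Comparable programs have comparable outputs, so programs of incomparable words span disjoint
    cylinders, whose fair-coin measures sum to at most 1. *)
Lemma kraft (S : set (word * word)) (W : seq word) (prog : word -> word) :
  monotone_graph S -> uniq W ->
  {in W &, forall x y, Defs.comparable x y -> x = y} ->
  (forall x, x \in W -> prefix_of_output S (prog x) x) ->
  \sum_(x <- W) 2 ^- size (prog x) <= 1 :> R.
Proof.
move=> mono uW inc hW; have [nu hnu] := fair_measure_exists.
rewrite (eq_bigr (fun x => pr nu (fun b => pre b (size (prog x)) == prog x))); last first.
  by move=> x _; rewrite (hnu _).2.
have ev x : event (fun b => pre b (size (prog x)) == prog x) by exact: (hnu _).1.
apply: le_trans (pr_sum_disjoint nu uW ev _) _; last first.
  by apply: pr_le1; have [] := pr_has nu W ev.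
move=> x y b xW yW /eqP bx /eqP by_; apply: inc => //.
have cp : Defs.comparable (prog x) (prog y) by exact: cylI_comparable bx by_.
case: (hW x xW) => [nx|[x' [Sx px]]]; first by rewrite nx /Defs.comparable prefix0s.
case: (hW y yW) => [ny|[y' [Sy py]]]; first by rewrite ny /Defs.comparable prefix0s orbT.
have := mono _ _ _ _ Sx Sy cp; rewrite /Defs.comparable => /orP[] h.
  have {}h := prefix_trans px h.
  apply: (@cylI_comparable _ _ (cat_seq y' (fun=> false))).
    by apply: (cyl_sub_prefix h); apply/cylE => i lt; rewrite /cat_seq lt.
  by apply: (cyl_sub_prefix py); apply/cylE => i lt; rewrite /cat_seq lt.
have {}h := prefix_trans py h.
apply: (@cylI_comparable _ _ (cat_seq x' (fun=> false))).
  by apply: (cyl_sub_prefix px); apply/cylE => i lt; rewrite /cat_seq lt.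
by apply: (cyl_sub_prefix h); apply/cylE => i lt; rewrite /cat_seq lt.
Qed.

Definition short_words m : seq word := flatten [seq words l | l <- iota 0 m].

Lemma mem_short_words m p : (size p < m)%N -> p \in short_words m.
Proof.
move=> lt; apply/flatten_mapP; exists (size p); first by rewrite mem_iota.
by rewrite mem_words.
Qed.

Lemma size_short_words m : (size (short_words m) <= 2 ^ m)%N.
Proof.
rewrite /short_words size_flatten /shape -map_comp.
elim: m => // m IH; rewrite -addn1 iotaD map_cat sumn_cat /= add0n addn0 size_words addn1.
by rewrite expnS mul2n -addnn leq_add2r.
Qed.

Lemma deficiency_le (P : probability cantor R) (S : set (word * word)) x (s : R) :
  (forall p, prefix_of_output S p x -> 2 ^- size p <= Pw P x * 2 `^ s) ->
  (deficiency P S x <= s%:E)%E.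
Proof.
move=> h; rewrite /deficiency.
have [[p hp]|none] := pselect (exists p, prefix_of_output S p x); last first.
  rewrite (_ : Kmon S x = +oo%E) ?addeNy ?leNye //.
  apply/eqP; rewrite -leye_eq; apply: le_ereal_inf_tmp => e [p hp _].
  by case: none; exists p.
(* One program already bounds [Pw P x] below by a positive number, so the [+oo] branch of the
   deficiency does not arise. *)
have pos : 0 < Pw P x.
  rewrite lt_def; apply/andP; split; last exact: Pw_ge0.
  apply/eqP => e0; have := h p hp; rewrite e0 mul0r leNgt => /negP; apply.
  by rewrite invr_gt0 exprn_gt0.
rewrite (gt_eqF pos).
have : ((- log2 (Pw P x) - s)%:E <= Kmon S x)%E.
  apply: le_ereal_inf_tmp => _ [q hq <-]; rewrite lee_fin.
  have := h q hq; rewrite -ler_ln ?posrE ?mulr_gt0 ?invr_gt0 ?exprn_gt0 ?powR_gt0 //.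
  rewrite lnM ?posrE ?powR_gt0 // lnV ?posrE ?exprn_gt0 // lnXn // ln_powR => hl.
  have l2 := @ln2_gt0 R; rewrite /log2 -(ler_pM2r l2) mulrBl mulNr divfK ?gt_eqF //.
  by rewrite -[ln 2 *+ _]mulr_natl in hl; lra.
by case: (Kmon S x) => [k| |] //=; rewrite -?EFinB ?lee_fin; [lra|rewrite leNye].
Qed.

End complexity.

(** * The generic sequence *)

Lemma uniq_words_range m N : uniq (flatten [seq words n | n <- iota m N]).
Proof.
elim: N m => //= N IH m; rewrite cat_uniq uniq_words IH andbT.
apply/hasPn => x /flatten_mapP[l]; rewrite mem_iota !mem_words => h /eqP ->; lia.
Qed.

(** A word is [good] if every [C K] has a member extending it. If the child ending in [false] fails
    at [K0], members of [C K] for [K >= K0] must extend the other, and monotonicity covers smaller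
    [K]. Locality passes from the approximating members to the limit. *)
Lemma koenig (C : nat -> (nat -> bool) -> Prop) :
  (forall K w, C K.+1 w -> C K w) ->
  (forall K, exists M, forall w w', pre w M = pre w' M -> C K w -> C K w') ->
  (forall K, exists w, C K w) -> exists a, forall K, C K a.
Proof.
move=> dec loc ne.
have mon K K' w : (K <= K')%N -> C K' w -> C K w.
  by move=> /subnK <-; elim: (K' - K)%N => // n IH /dec.
pose good x := forall K, exists2 w, C K w & pre w (size x) = x.
have step x : good x -> ~ good (rcons x false) -> good (rcons x true).
  move=> gx /existsNP[K0 hK0] K; have [w Cw ew] := gx (maxn K K0).
  exists w; first exact: mon (leq_maxl _ _) Cw.
  rewrite size_rcons preS ew; case wx: (w (size x)) => //; case: hK0.
  by exists w; [exact: mon (leq_maxr _ _) Cw|rewrite size_rcons preS ew wx].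
pose ext x := rcons x (~~ `[<good (rcons x false)>]).
pose a n := last false (iter n.+1 ext [::]).
have sz n : size (iter n ext [::]) = n by elim: n => //= n IH; rewrite size_rcons IH.
have prea n : pre a n = iter n ext [::].
  by elim: n => // n IH; rewrite preS IH /a /= {2 3}/ext last_rcons.
have gooda n : good (pre a n).
  elim: n => [|n IH]; first by move=> K; have [w] := ne K; exists w.
  by rewrite prea iterS -prea /ext; case: asboolP => [//|]; exact: step.
exists a => K; have [M hM] := loc K; have [w Cw] := gooda M K.
by rewrite size_pre => e; exact: hM e Cw.
Qed.

Section generic_sequence.
Context {R : realType} (u v : nat -> nat) (r : nat) (q tl T : nat -> R) (sigma : nat -> R).
Hypotheses (u_gt0 : forall j, (0 < u j)%N) (r_gt0 : (0 < r)%N)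
  (u_growth : forall j, (blen u r j + 2 * u j <= u j.+1)%N)
  (q01 : forall j, 0 <= q j <= 1)
  (q_tail : forall J n, \sum_(k < n) q (J + k)%N * (blen u r (J + k))%:R <= tl J)
  (tl_small : forall J, tl J <= 1 / 4).
Variables (c : R) (J0 : nat).
Hypotheses (u4v : forall j, u j = (4 * v j)%N) (c_gt0 : 0 < c)
  (q_tele : forall J n, \sum_(k < n) q (J + k)%N * (u (J + k))%:R = c * (T J - T (J + n)%N))
  (TE : forall j, T j = (1 + sigma (u j))^-1)
  (v_sum : forall J n, (J0 <= J)%N ->
     \sum_(k < n) (u (J + k))%:R * 2 ^- (v (J + k)) <= 1 / 4 :> R).
Hypotheses (sigma_ge0 : forall n, 0 <= sigma n)
  (sigma_mono : {homo sigma : m n / (m <= n)%N >-> m <= n})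
  (sigma_unbounded : forall M : R, exists n, M < sigma n).

Local Notation blen := (blen u r).
Local Notation out := (out u r).

Lemma sigma_u_unbounded (M : R) J : exists2 j, (J < j)%N & M <= sigma (u j).
Proof.
have [n hn] := sigma_unbounded M; exists (maxn n J.+1); first by rewrite leq_maxr.
apply: le_trans (ltW hn) _; apply: sigma_mono; apply: leq_trans (u_ge u_gt0 u_growth _).
exact: leq_maxl.
Qed.

Lemma pow2_ge (s : R) : 0 <= s -> s ^+ 2 / 16 <= 2 `^ s.
Proof.
move=> s0; rewrite /powR pnatr_eq0 /=.
have -> : s * ln 2 = s * ln 2 / 2 + s * ln 2 / 2 :> R by field.
rewrite expRD; set e := expR (s * ln 2 / 2).
have he : 1 + s * ln 2 / 2 <= e := expR_ge1Dx _.
have h1 : s / 4 <= e by have := ler_wpM2l s0 (@ln2_ge_half R); lra.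
have s4 : 0 <= s / 4 by lra.
by have := ler_pM s4 s4 h1 h1; lra.
Qed.

(** [g] is a lower bound for what has been imposed so far. The last inequality reserves, before the
    next group is imposed, room for its factor [(c / 16) * T J'] within the allowance [2^sigma]. *)
Lemma next_level (g : R) J : 0 < g -> exists J', [/\ (J < J')%N, T J' <= T J / 2 &
  8 * 2 `^ (- sigma (u J')) <= g * (c / 16) * T J'].
Proof.
(* [A (1 + s) <= 2^s] is the required inequality. It follows from [s >= 1] and [s >= 32 A], since
   then [A (1 + s) <= 2 A s <= s^2 / 16]; the last summand of the threshold halves the tail. *)
move=> g0; pose A := 128 / (g * c); have A0 : 0 < A by rewrite divr_gt0 ?mulr_gt0.
have [J' JJ' hs] := sigma_u_unbounded (1 + 32 * A + 2 * (1 + sigma (u J))) J.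
exists J'; split => //; rewrite !TE; set s := sigma (u J'); rewrite -/s in hs.
  have s0 := sigma_ge0 (u J).
  rewrite -[_ / 2]invfM lef_pV2 ?posrE; [lra|lra|].
  by rewrite mulr_gt0 //; lra.
have s0 : 0 <= s by exact: sigma_ge0.
have hp := pow2_ge s0; have sJ := sigma_ge0 (u J).
have hA : A * (1 + s) <= 2 `^ s by apply: le_trans hp; nra.
rewrite powRN ler_pdivlMr; last lra.
rewrite mulrAC ler_pdivrMr ?powR_gt0 //.
have -> : 8 * (1 + s) = g * (c / 16) * (A * (1 + s)) by rewrite /A; field; rewrite !gt_eqF.
by apply: ler_wpM2l => //; rewrite mulr_ge0 ?divr_ge0 ?ltW.
Qed.

Lemma T_gt0 j : 0 < T j.
Proof. by rewrite TE invr_gt0; have := sigma_ge0 (u j); lra. Qed.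

(** A group from [J k] to [J k.+1] has probability at least [(c / 8) (T (J k) - T (J k.+1))], hence
    at least [(c / 16) T (J k)] by halving. Its price thus depends on its start only, and [J k.+1]
    can be chosen after [g k.+1]. *)
Lemma levels_exist : exists (J : nat -> nat) (g : nat -> R),
  [/\ (J0 <= J 0%N)%N, forall k, (J k < J k.+1)%N, forall k, T (J k.+1) <= T (J k) / 2,
   g 0%N = 1 & forall k, g k.+1 = g k * (c / 16) * T (J k) /\
    8 * 2 `^ (- sigma (u (J k))) <= g k.+1].
Proof.
have /choice[next hnext] : forall p : nat * R, exists J', 0 < p.2 ->
    [/\ (p.1 < J')%N, T J' <= T p.1 / 2 &
      8 * 2 `^ (- sigma (u J')) <= p.2 * (c / 16) * T J'].
  move=> [J g] /=; have [g0|g0] := ltP 0 g; last by exists 0%N.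
  by have [J' h] := next_level J g0; exists J'.
pose st k := iter k (fun p : nat * R =>
  let g := p.2 * (c / 16) * T p.1 in (next (p.1, g), g)) (next (J0, 1), 1).
have st0 k : 0 < (st k).2.
  by elim: k => //= k IH; rewrite !mulr_gt0 ?T_gt0 // divr_gt0.
have h0 := hnext (J0, 1) ltr01.
have hS k := hnext ((st k).1, (st k.+1).2) (st0 k.+1).
exists (fun k => (st k).1), (fun k => (st k).2); split=> //.
- by case: h0 => /ltnW.
- by move=> k; case: (hS k).
- by move=> k; case: (hS k).
move=> k; split=> //; case: k => [|k]; first by case: h0.
by case: (hS k).
Qed.

Variable mu : probability cantor R.
Hypothesis muE : forall x, mu (cyl x) = (bweight (theta q) x)%:E.
Let law := law u r mu.

Variables (psi : word -> option word) (S : set (word * word)).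
Hypothesis monoS : monotone_graph S.

(** Deficiency above [sigma], phrased through single programs to avoid logarithms of zero and
    infinite values. *)
Definition defbad (x : word) : Prop :=
  exists2 p, prefix_of_output S p x & law x * 2 `^ sigma (size x) < 2 ^- size p.

(** * Conditioning on a sequence of groups *)

Section chosen_levels.
Variables (J : nat -> nat) (g : nat -> R).
Hypotheses (J_ge : (J0 <= J 0%N)%N) (J_lt : forall k, (J k < J k.+1)%N)
  (J_half : forall k, T (J k.+1) <= T (J k) / 2) (g0 : g 0%N = 1)
  (gS : forall k, g k.+1 = g k * (c / 16) * T (J k) /\
    8 * 2 `^ (- sigma (u (J k))) <= g k.+1).

Lemma J_mono k k' : (k <= k')%N -> (J k <= J k')%N.
Proof.
move=> /subnK <-; elim: (k' - k)%N => // n IH; apply: leq_trans IH _.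
exact/ltnW/J_lt.
Qed.

Definition stage k b := group u r (J k) (J k.+1 - J k) b.
Definition stages k n b := all (stage^~ b) (iota k n).

Lemma local_stages k n : local (fun i => J k < nsnd i <= J (k + n))%N (stages k n).
Proof.
apply: local_all => k'; rewrite mem_iota => hk.
apply: local_sub (local_group _ _ _ _) => i /=.
have := J_lt k'; have := @J_mono k k'; have := @J_mono k'.+1 (k + n)%N; lia.
Qed.

Lemma stages_cat k n b : stages 0 (k + n) b = stages 0 k b && stages k n b.
Proof. by rewrite /stages iotaD all_cat. Qed.

Lemma pr_stages_cat k n : pr mu (stages 0 (k + n)) = pr mu (stages 0 k) * pr mu (stages k n).
Proof.
rewrite -(pr_indep muE (local_stages 0 k)); first by apply: eq_pr => b; exact: stages_cat.
by apply: local_sub (local_stages k n) => i /=; rewrite add0n; lia.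
Qed.

Lemma pr_stages k : g k <= pr mu (stages 0 k).
Proof.
elim: k => [|k IH]; first by rewrite g0 (pr_true mu).
rewrite -addn1 pr_stages_cat addn1 (gS k).1 -mulrA.
have gk : 0 < g k.
  by case: k {IH} => [|k]; [rewrite g0|apply: lt_le_trans (gS k).2; rewrite mulr_gt0 ?powR_gt0].
apply: ler_pM => //; [exact: ltW|by rewrite mulr_ge0 ?divr_ge0 ?ltW ?T_gt0|].
rewrite (eq_pr _ (F := stage k)); last by move=> b; rewrite /stages /= andbT.
apply: le_trans (pr_group r_gt0 q01 q_tail tl_small muE _ _).
rewrite q_tele subnKC; last exact/ltnW/J_lt.
by have := ler_wpM2l (ltW c_gt0) (J_half k); lra.
Qed.

Lemma pr_stages_gt0 k : 0 < pr mu (stages 0 k).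
Proof.
apply: lt_le_trans (pr_stages k); case: k => [|k]; first by rewrite g0.
by apply: lt_le_trans (gS k).2; rewrite mulr_gt0 ?powR_gt0.
Qed.

Lemma event_stages k n : event (stages k n).
Proof. exact: measurable_local (local_stages k n). Qed.

Lemma stages_quiet k n b j : stages k n b -> (J k <= j < J (k + n))%N ->
  ~~ marked b j 0 (blen j + u j).
Proof.
elim: n => [|n IH]; first by rewrite addn0; lia.
rewrite /stages -addn1 iotaD all_cat addnA addn1 /= andbT => /andP[/IH {}IH h] hj.
have [lt|le] := ltnP j (J (k + n)); first by apply: IH; lia.
apply: (group_quiet h); have := J_lt (k + n); lia.
Qed.

(* The stages from [k] on leave the first [u (J k)] positions alone, so conditioning
   on all of them costs, up to a factor 2, no more than conditioning on the first [k]. *)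
Lemma pr_stages_out k K x : (k <= K)%N -> (size x <= u (J k))%N ->
  pr mu (fun b => stages 0 K b && (pre (out (J K) b) (size x) == x)) * pr mu (stages 0 k)
    <= 2 * law x * pr mu (stages 0 K).
Proof.
move=> /subnKC <- le; set n := (K - k)%N; rewrite pr_stages_cat.
have lO := local_pre_out u r (J k) (size x) x.
have lS := local_stages k n.
have ind : local (predC (fun i => nsnd i <= J k)%N) (stages k n).
  by apply: local_sub lS => i /=; lia.
have evO K' : event (fun b => pre (out (J K') b) (size x) == x).
  exact: measurable_local (local_pre_out u r (J K') (size x) x).
have h : pr mu (fun b => stages 0 (k + n) b && (pre (out (J (k + n)) b) (size x) == x))
    <= pr mu (fun b => (pre (out (J k) b) (size x) == x) && stages k n b).
  apply: pr_mono; [by apply: event_and => //; exact: event_stages|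
                   by apply: event_and => //; exact: event_stages|].
  move=> b; rewrite stages_cat => /andP[/andP[_ hs] /eqP <-]; rewrite hs andbT size_pre.
  apply/eqP/esym/out_quiet; first by apply: J_mono; exact: leq_addr.
  move=> j hj; apply: contra (stages_quiet hs hj); apply: marked_sub => //.
  have : (u (J k) <= u j)%N by apply: (u_mono u_growth); lia.
  by lia.
rewrite (pr_indep muE lO ind) in h.
have hl := law_ge u_gt0 r_gt0 u_growth q01 q_tail tl_small muE le.
have p0 := pr_ge0 mu (stages 0 k); have p1 := pr_ge0 mu (stages k n).
apply: le_trans (ler_wpM2r p0 h) _.
apply: le_trans (ler_wpM2r (mulr_ge0 p0 p1) hl).
by rewrite le_eqVlt; apply/orP; left; apply/eqP; rewrite mulrA mulrAC.
Qed.

Definition defbad_at (w : nat -> bool) n : bool := `[<defbad (pre w n)>].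

(** Given the stages, a minimal bad word has probability at most [law x * 2^sigma / 4], which is
    less than a quarter of the Kraft weight of its program. *)
Lemma pr_defbad K : let N := (u (J K) - u (J 0%N))%N in
  let E b := has (defbad_at (out (J K) b)) (iota (u (J 0%N)) N) in
  event E /\ pr mu (fun b => stages 0 K b && E b) <= pr mu (stages 0 K) / 4.
Proof.
move=> N E; set n0 := u (J 0%N) in N E *.
have lE : local (fun i => nsnd i <= J K)%N E.
  apply: local_has => n _.
  by apply: (@local_pre _ _ _ (fun x => `[<defbad x>])) => i _; exact: local_out.
have mE := measurable_local lE; split=> //.
pose fresh x := all (fun m => ~~ `[<defbad (take m x)>]) (iota n0 (size x - n0)).
pose W := [seq x <- flatten [seq words n | n <- iota n0 N] | `[<defbad x>] && fresh x].
have memW x : x \in W = [&& `[<defbad x>], fresh x & (n0 <= size x < n0 + N)%N].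
  rewrite mem_filter -andbA; congr [&& _, _ & _].
  apply/flatten_mapP/idP => [[n]|h]; first by rewrite mem_iota mem_words => h /eqP ->.
  by exists (size x); rewrite ?mem_iota ?mem_words.
have uW : uniq W.
  by apply: filter_uniq; exact: uniq_words_range.
(* minimal bad words are incomparable, so the Kraft inequality applies to their programs *)
have incW : {in W &, forall x y, Defs.comparable x y -> x = y}.
  have aux x y : x \in W -> y \in W -> prefix x y -> x = y.
    rewrite !memW => /and3P[bx _ /andP[nx _]] /and3P[_ /allP fy _] pxy.
    have [z ez] := prefixP pxy; case: z ez => [|z0 z] ez; first by rewrite ez cats0.
    have lt : (size x < size y)%N by rewrite ez size_cat /=; lia.
    have /fy : size x \in iota n0 (size y - n0) by rewrite mem_iota; lia.
    by rewrite ez take_size_cat // bx.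
  by move=> x y xW yW /orP[/aux -> //|/aux ->].
have /choice[prog hprog] : forall x, exists p, x \in W ->
    prefix_of_output S p x /\ law x * 2 `^ sigma (size x) < 2 ^- size p.
  move=> x; case xW: (x \in W); last by exists [::].
  by move: xW; rewrite memW => /and3P[/asboolP[p h1 h2] _ _]; exists p.
have kr := @kraft R S W prog monoS uW incW (fun x xW => (hprog x xW).1).
pose F x b := stages 0 K b && (pre (out (J K) b) (size x) == x).
have mF x : event (F x).
  apply: event_and; first exact: event_stages.
  exact: measurable_local (local_pre_out u r (J K) (size x) x).
have [mH pH] := pr_has mu W mF.
apply: le_trans (pr_mono mu (event_and (event_stages 0 K) mE) mH _) _.
  move=> b /andP[hs /hasP[n]]; rewrite mem_iota => hn bn.
  have ex : exists n, [&& (n0 <= n)%N, (n < n0 + N)%N & defbad_at (out (J K) b) n].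
    by exists n; rewrite bn andbT.
  case: (ex_minnP ex) => m /and3P[m1 m2 m3] minm.
  apply/hasP; exists (pre (out (J K) b) m); last by rewrite /F hs size_pre eqxx.
  rewrite memW size_pre m1 m2 !andbT; apply/andP; split; first exact: m3.
  apply/allP => l; rewrite size_pre mem_iota => hl; apply/negP.
  rewrite -pre_take; last lia.
  by move=> h; have := minm l; rewrite /defbad_at h andbT => /(_ _); lia.
apply: le_trans pH _.
apply: (@le_trans _ _ (\sum_(x <- W) 2 ^- size (prog x) * (pr mu (stages 0 K) / 4))).
  rewrite big_seq [leRHS]big_seq; apply: ler_sum => x xW.
  have [_ hx] := hprog x xW.
  move: xW; rewrite memW => /and3P[_ _ hsz].
  (* A word with length in [[u (J k), u (J k.+1))] is charged for the stages [0] to [k] only; their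
     price was reserved at length [u (J k)], and [sigma] is monotone. *)
  have [k kK hk] : exists2 k, (k < K)%N & (u (J k) <= size x < u (J k.+1))%N.
    have : (n0 <= size x < u (J K))%N by rewrite /N in hsz; lia.
    elim: (K) => [|k IH]; first by rewrite /n0; lia.
    move=> h; have [lt|le] := ltnP (size x) (u (J k)).
      by have [|k' h1 h2] := IH; [lia|exists k' => //; exact: leqW].
    by exists k => //; rewrite le; lia.
  have hq := pr_stages_out kK (ltnW (andP hk).2).
  have hE : 8 * 2 `^ (- sigma (size x)) <= pr mu (stages 0 k.+1).
    apply: le_trans (pr_stages k.+1); apply: le_trans (gS k).2.
    apply: ler_wpM2l => //; rewrite ler_powR ?ler1n // lerN2; apply: sigma_mono.
    by have /andP[] := hk.
  rewrite powRN in hE; set s := 2 `^ _ in hE hx.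
  have s0 : 0 < s by rewrite powR_gt0.
  have f0 := pr_ge0 mu (F x); have e0 := pr_stages_gt0 K.
  rewrite -/(F x) in hq; set e := pr mu (stages 0 K) in hq e0 *.
  have {}hE : pr mu (F x) * (8 * s^-1) <= 2 * law x * e by apply: le_trans hq; exact: ler_wpM2l.
  have : pr mu (F x) * 8 <= 2 * (law x * s) * e.
    have -> : pr mu (F x) * 8 = pr mu (F x) * (8 * s^-1) * s by field; rewrite gt_eqF.
    apply: le_trans (ler_wpM2r (ltW s0) hE) _.
    by rewrite le_eqVlt; apply/orP; left; apply/eqP; ring.
  have := ler_wpM2r (ltW e0) (ltW hx); set t := 2 ^- _; lra.
rewrite -mulr_suml; apply: ler_piMl => //.
by rewrite divr_ge0 // ltW // pr_stages_gt0.
Qed.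

Definition fairbits t b : nat -> bool := fun i => b (npair (t + i) 0).

Lemma pr_fairbits t (y : word) : local (fun i => nsnd i == 0%N)
    (fun b => pre (fairbits t b) (size y) == y) /\
  pr mu (fun b => pre (fairbits t b) (size y) == y) = 2 ^- size y.
Proof.
pose F n b := pre (fairbits t b) n == take n y.
have lf n : local (fun i => (nsnd i == 0%N) && (i \in [seq npair (t + i) 0 | i <- iota 0 n])) (F n).
  apply: (@local_pre _ _ _ (fun x => x == take n y)) => i lt.
  apply: local_coord; rewrite nsnd_npair eqxx /=.
  by apply: map_f; rewrite mem_iota.
have [->|] := eqVneq y [::]; first by split; [exact: local_const|rewrite expr0 invr1; exact: pr_true].
move=> _; have -> : (fun b => pre (fairbits t b) (size y) == y) = F (size y).
  by rewrite /F take_size.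
split; first by apply: local_sub (lf (size y)) => i /andP[].
suff h n : (n <= size y)%N -> pr mu (F n) = 2 ^- n by exact: h.
elim: n => [|n IH] le; first by rewrite /F take0 expr0 invr1; exact: pr_true.
have lk : local (predC (fun i => (nsnd i == 0%N) && (i \in [seq npair (t + i) 0 | i <- iota 0 n])))
    (fun b => b (npair (t + n) 0) == nth false y n).
  apply: (local_op2 (fun a d => a == d)); last exact: local_const.
  apply: local_coord; rewrite /= nsnd_npair /=; apply/mapP => -[i + /npair_inj[e _]].
  by rewrite mem_iota; lia.
rewrite (eq_pr _ (F := fun b => F n b && (b (npair (t + n) 0) == nth false y n))); last first.
  move=> b; rewrite /F preS (take_nth false) //.
  apply/eqP/andP => [/rcons_inj[-> e]|[/eqP -> /eqP e]]; last by rewrite -e.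
  by rewrite eqxx -e.
rewrite (pr_indep muE (lf n) lk) IH ?(ltnW le) // exprS invfM mulrC; congr (_ * _).
have pc : pr mu (fun b => b (npair (t + n) 0)) = 2^-1.
  by rewrite (pr_coord (th := theta q)) // /theta nsnd_npair div1r.
have mC : event (fun b => b (npair (t + n) 0)) := measurable_local (local_coord (I := predT) isT).
case: (nth _ _ _).
  by rewrite (eq_pr _ (F := fun b => b (npair (t + n) 0))) // => b; rewrite eqb_id.
rewrite (eq_pr _ (F := fun b => ~~ b (npair (t + n) 0))) => [|b]; last by rewrite eqbF_neg.
by rewrite pr_not // pc; field.
Qed.

(** A program fixes its output and therefore the fair bits it would have to match. Dropping the
    first [t] letters lets the count ignore everything before the block. *)
Definition bitbad j t b : bool :=
  has (fun p => if psi p is Some w then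
     (size (drop t w) == u j) && (pre (fairbits t b) (size (drop t w)) == drop t w) else false)
    (short_words (3 * v j)).

(** The start of a block is random, so every start in [(u, 2 u]] is excluded; [v_sum] pays for this
    union. *)
Definition bitbads j n b : bool :=
  has (fun k => has (fun t => bitbad (j + k) t b) (iota (u (j + k)).+1 (u (j + k)))) (iota 0 n).

Lemma local_bitbad j t : local (fun i => nsnd i == 0%N) (bitbad j t).
Proof.
apply: local_has => p _; case: (psi p) => [w|]; last exact: local_const.
by apply: local_and; [exact: local_const|exact: (pr_fairbits t (drop t w)).1].
Qed.

(** At most [2^(3v)] programs, each matching [4v] fair bits with probability [2^(-4v)]. *)
Lemma pr_bitbad j t : pr mu (bitbad j t) <= 2 ^- v j.
Proof.
pose F p b := if psi p is Some w then
  (size (drop t w) == u j) && (pre (fairbits t b) (size (drop t w)) == drop t w) else false.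
have mF p : event (F p).
  rewrite /F; case: (psi p) => [w|]; last exact: (measurable_local (local_const predT false)).
  apply: event_and; first exact: (measurable_local (local_const predT _)).
  exact: measurable_local (pr_fairbits t (drop t w)).1.
have pF p : pr mu (F p) <= 2 ^- u j.
  have n0 : (0 : R) <= 2 ^- u j by rewrite invr_ge0 exprn_ge0.
  rewrite /F; case: (psi p) => [w|]; last by rewrite pr_false.
  case: eqP => [<-|_]; last by rewrite pr_false.
  by rewrite (pr_fairbits t (drop t w)).2.
have [_ h] := pr_has mu (short_words (3 * v j)) mF; apply: le_trans h _.
apply: le_trans (ler_sum _ (fun p _ => pF p)) _.
rewrite big_const_seq count_predT iter_addr_0 -[leLHS]mulr_natl u4v.
have := size_short_words (3 * v j); rewrite -(ler_nat R) natrX => h.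
apply: le_trans (ler_wpM2r _ h) _; first by rewrite invr_ge0 exprn_ge0.
have -> : (4 * v j = 3 * v j + v j)%N by lia.
by rewrite exprD invfM mulrA divff ?mul1r // expf_neq0.
Qed.

Lemma pr_bitbads n : local (fun i => nsnd i == 0%N) (bitbads (J 0%N) n) /\
  pr mu (bitbads (J 0%N) n) <= 1 / 4.
Proof.
have lb : local (fun i => nsnd i == 0%N) (bitbads (J 0%N) n).
  by apply: local_has => k _; apply: local_has => t _; exact: local_bitbad.
split=> //; apply: le_trans (v_sum n J_ge).
pose j k := (J 0%N + k)%N.
have mb k t : event (bitbad (j k) t) := measurable_local (local_bitbad (j k) t).
have hk k := pr_has mu (iota (u (j k)).+1 (u (j k))) (mb k).
have [_ h] := pr_has mu (iota 0 n) (fun k => (hk k).1); apply: le_trans h _.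
have -> : iota 0 n = index_iota 0 n by rewrite /index_iota subn0.
rewrite big_mkord; apply: ler_sum => k _.
apply: le_trans (hk k).2 _.
apply: le_trans (ler_sum _ (fun t _ => pr_bitbad (j k) t)) _.
by rewrite big_const_seq count_predT size_iota iter_addr_0 mulr_natl.
Qed.

Definition milestone k (w : nat -> bool) : Prop := exists j t,
  [/\ (J k <= j < J k.+1)%N, (u j < t <= 2 * u j)%N,
      ~ simple psi (3 * v j) (pre w (t + u j)) &
      forall i, (t + u j <= i < t + blen j)%N -> ~~ w i].

Definition good_up_to K (w : nat -> bool) : Prop :=
  (forall n, (u (J 0%N) <= n < u (J K))%N -> ~ defbad (pre w n)) /\
  forall k, (k < K)%N -> milestone k w.

(** Within the stages, a bad deficiency takes at most a quarter of the probability; compressible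
    fair bits, which carry label [0] and are independent of all marks, take another quarter. *)
Lemma good_exists K : exists w, good_up_to K w.
Proof.
have [mD pD] := pr_defbad K; set D := (fun b => has _ _) in mD pD.
set n := (J K - J 0%N)%N; have [lB pB] := pr_bitbads n.
have mB : event (bitbads (J 0%N) n) := measurable_local lB.
have p0 := pr_stages_gt0 K; have mS := event_stages 0 K.
have pSB : pr mu (fun b => stages 0 K b && bitbads (J 0%N) n b) <= pr mu (stages 0 K) / 4.
  rewrite (pr_indep muE (local_stages 0 K)); last first.
    by apply: local_sub lB => i /= /eqP ->.
  by rewrite ler_wpM2l ?pr_ge0 // -div1r.
have [b /and3P[hs nD nB]] : exists b, [&& stages 0 K b, ~~ D b & ~~ bitbads (J 0%N) n b].
  apply: contrapT => none; have : pr mu (stages 0 K) <= pr mu (stages 0 K) / 4 + pr mu (stages 0 K) / 4.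
    apply: le_trans (lerD pD pSB); apply: le_trans (pr_or mu _ _).
    - apply: pr_mono => //; first by apply: event_or; exact: event_and.
      move=> b hs; rewrite hs /=; apply: contraPT none => /norP[h1 h2]; apply.
      by exists b; rewrite hs h1 h2.
    - exact: event_and.
    - exact: event_and.
  by lra.
exists (out (J K) b); split=> [m hm hbad|k kK].
  move: nD => /hasPn/(_ m); rewrite mem_iota => /(_ _)/negP; apply; first lia.
  by apply/asboolP.
have hk : group u r (J k) (J k.+1 - J k) b.
  by move: hs => /allP; apply; rewrite mem_iota.
have Jk := J_lt k; have JK : (J k.+1 <= J K)%N by exact: J_mono.
have [|j0 hj0|j [t [hj ht fm zm]]] := group_block u_gt0 u_growth _ hk (K := J K).
- by lia.
- have st : stages k.+1 (K - k.+1) b.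
    by move: hs; rewrite -{1}(subnKC kK) stages_cat => /andP[].
  by apply: (stages_quiet st); rewrite subnKC //; lia.
rewrite subnKC in hj; last exact: ltnW.
exists j, t; split=> //; last by move=> i /zm; rewrite /out => /negbTE ->.
(* A short program for this prefix would reproduce the fair part of the block, contradicting
   [nB]. *)
move=> [p sp hp]; move: nB => /hasPn/(_ (j - J 0%N)%N).
have J0k : (J 0%N <= J k)%N by exact: J_mono.
rewrite mem_iota subnKC; last lia.
move=> /(_ _)/hasPn/(_ t); rewrite mem_iota => /(_ _ _)/hasPn/(_ p (mem_short_words sp)).
have sz : size (drop t (pre (out (J K) b) (t + u j))) = u j by rewrite size_drop size_pre addKn.
rewrite hp sz eqxx /= => H.
have c1 : (0 <= j - J 0 < 0 + n)%N by lia.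
have c2 : (u j < t < (u j).+1 + u j)%N by lia.
move/negP: (H c1 c2); apply.
apply/eqP/(@eq_from_nth _ false); rewrite ?size_pre ?sz // => i lt.
rewrite nth_drop !nth_mkseq ?ltn_add2l // /out /fairbits fm //; lia.
Qed.

Lemma milestone_ext k w w' : pre w (u (J k.+1)) = pre w' (u (J k.+1)) ->
  milestone k w -> milestone k w'.
Proof.
move=> /pre_eqP e [j [t [hj ht hs hz]]].
have lt : (t + blen j <= u (J k.+1))%N.
  apply: leq_trans (u_mono u_growth (andP hj).2); have := u_growth j; lia.
have be := blenE u r j; have rj : (u j <= r * u j)%N by rewrite leq_pmull.
exists j, t; split=> // [|i hi]; last by rewrite -e ?hz //; lia.
rewrite (_ : pre w' _ = pre w (t + u j)) //; apply/pre_eqP => i hi; rewrite e //; lia.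
Qed.

Lemma good_sequence : exists w, (forall n, (u (J 0%N) <= n)%N -> ~ defbad (pre w n)) /\
  forall k, milestone k w.
Proof.
have [||K|w hw] := @koenig good_up_to; last first.
- exists w; split=> [n hn|k]; last exact: (hw k.+1).2.
  apply: (hw n.+1).1; rewrite hn /=; apply: leq_trans (u_ge u_gt0 u_growth _).
  have : forall k, (k <= J k)%N by elim=> // k IH; have := J_lt k; lia.
  exact.
- exact: good_exists.
- move=> K; exists (u (J K)) => w w' e [h1 h2]; split=> [n hn|k kK].
    rewrite (_ : pre w' n = pre w n); first exact: h1.
    by rewrite !(@pre_take _ n (u (J K))) ?e //; lia.
  apply: milestone_ext (h2 k kK); have le := u_mono u_growth (J_mono kK).
  by rewrite !(pre_take _ le) e.
move=> K w [h1 h2]; split=> [n hn|k kK]; last by apply: h2; exact: leqW.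
apply: h1; have := u_mono u_growth (ltnW (J_lt K)); lia.
Qed.

End chosen_levels.

Lemma alpha_exists : exists (w : nat -> bool) n0,
  (forall n, (n0 <= n)%N -> ~ defbad (pre w n)) /\
  forall k, exists j t, [/\ (k <= j)%N, (u j < t <= 2 * u j)%N,
      ~ simple psi (3 * v j) (pre w (t + u j)) &
      forall i, (t + u j <= i < t + blen j)%N -> ~~ w i].
Proof.
have [J [g [h1 h2 h3 h4 h5]]] := levels_exist.
have [w [hw1 hw2]] := good_sequence h1 h2 h3 h4 h5.
exists w, (u (J 0%N)); split=> // k; have [j [t [hj ? ? ?]]] := hw2 k.
have : forall k, (k <= J k)%N by elim=> // l IH; have := h2 l; lia.
by move=> /(_ k) kJ; exists j, t; split=> //; lia.
Qed.

End generic_sequence.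

(** * Computability of the law *)

Section bits.
Context {R : realType}.

Definition bits y : nat -> bool := fun k => odd (y %/ 2 ^ k).

Lemma bits_double y (c : bool) : bits (y.*2 + c) = scons c (bits y).
Proof.
apply/funext => -[|k]; rewrite /bits /=; first by rewrite expn0 divn1 oddD odd_double oddb.
by rewrite expnS divnMA; congr (odd (_ %/ _)); case: c; lia.
Qed.

Lemma bits0 : bits 0 = fun=> false.
Proof. by apply/funext => k; rewrite /bits div0n. Qed.

Lemma sum_double (V : nmodType) n (F : nat -> V) :
  \sum_(y < n.*2) F y = \sum_(y < n) (F y.*2 + F y.*2.+1).
Proof.
elim: n => [|n IH]; first by rewrite !big_ord0.
by rewrite doubleS !big_ord_recr /= IH addrA.
Qed.

(** Configurations of [m] coordinates are enumerated as the binary digits of the numbers below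
    [2 ^ m], which turns the mean into a sum that a code can evaluate. *)
Lemma Ex_bits (th : nat -> R) m (f : (nat -> bool) -> R) :
  Ex th m f = \sum_(y < 2 ^ m) (\prod_(k < m) if bits y k then th k else 1 - th k) * f (bits y).
Proof.
elim: m th f => [|m IH] th f.
  by rewrite expn0 big_ord1 big_ord0 mul1r /= bits0.
rewrite expnS mul2n (sum_double _ (fun y =>
  (\prod_(k < m.+1) if bits y k then th k else 1 - th k) * f (bits y))) /= !IH !mulr_sumr -big_split /=; apply: eq_bigr => y _.
have e0 : bits y.*2 = scons false (bits y) by rewrite -bits_double addn0.
have e1 : bits y.*2.+1 = scons true (bits y) by rewrite -bits_double addn1.
rewrite e0 e1.
by rewrite !big_ord_recl /= addrC; congr (_ + _); rewrite mulrA.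
Qed.

End bits.

Section approximate_law.
Local Open Scope nat_scope.
Variables (B r D : nat).

Let u j := (4 * B ^ j)%N.
Local Notation blen := (blen u r).

Definition word_bit w i : bool := odd (w.+1 %/ 2 ^ ((code_size w).-1 - i)).

Lemma word_bitE x i : (i < size x)%N -> word_bit (enc_word x) i = nth false x i.
Proof.
rewrite /word_bit code_sizeE; elim/last_ind: x i => // x c IH i.
rewrite size_rcons ltnS enc_word_rcons nth_rcons leq_eqVlt => /orP[/eqP ->|lt].
  rewrite ltnn eqxx subnn expn0 divn1 /= oddD addn1 /= odd_double.
  by case: c.
rewrite lt -IH //; have -> : ((size x).+1.-1 - i)%N = ((size x).-1 - i).+1 by lia.
rewrite expnS divnMA; congr (odd (_ %/ _)).
by case: c; lia.
Qed.

(* numerator of the nonnegative part of [dec_rat c], whose denominator is [nsnd c] *)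
Definition numer c : nat := if odd (nfst c) then 0 else (nfst c)./2.

(** [npair 2 L] is the code of the rational [1 / L], as the integer 1 has code 2. *)
Definition sigma_query (g : nat -> nat) L j : nat := g (npair (u j) (npair 2 L)).

(** The integer part of [L / (1 + s)] for the queried value [s]. A zero denominator stands for
    [s = 0] and gives [L]. *)
Definition T_approx g L j : nat :=
  if nsnd (sigma_query g L j) == 0%N then L
  else (nsnd (sigma_query g L j) * L) %/
    (numer (sigma_query g L j) + nsnd (sigma_query g L j)).

(** Numerators over the common denominator [L]. Truncated subtraction is harmless, since the true
    difference is nonnegative. *)
Definition theta_approx g L k : nat :=
  if nsnd k == 0%N then L./2
  else (T_approx g L (nsnd k).-1 - T_approx g L (nsnd k)) %/ (D * blen (nsnd k).-1).

Definition out_matches J w y : bool :=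
  all (fun i => out u r J (bits y) i == word_bit w i) (iota 0 (code_size w)).

(** Exceeds every index [npair i k] with [i < code_size w + blen J] and [k <= J], the coordinates
    that [out J] can read on a word of that length. *)
Definition depth J w : nat := 2 ^ (code_size w + blen J) * J.*2.+1.

(** Each of the [depth] parameters is known up to [5 / L], so this [L] gives a total error of
    [1 / (2 * den)]. It is even, which makes the approximate fair coin exact. *)
Definition precision J w den : nat := 10 * den * depth J w.

Definition law_numer g J w den : nat :=
  \sum_(y < 2 ^ depth J w) out_matches J w y *
    \prod_(k < depth J w) (if bits y k then theta_approx g (precision J w den) k
      else precision J w den - theta_approx g (precision J w den) k).

(** The query has error at most 1, so success certifies that [sigma (u J)] is at least
    [2 * den * (n + 1)] for words of length [n]; the levels from [J] on then change the law by at
    most [1 / (2 * den)]. *)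
Definition level_test g J w den : bool :=
  (0 < nsnd (sigma_query g 1 J)) &&
  ((2 * den * (code_size w).+1).+1 * nsnd (sigma_query g 1 J) <= numer (sigma_query g 1 J)).

Lemma crec_lift F : crec F -> crec (fun g y => F g (nsnd y)).
Proof. by move=> hF; exact: crec_comp hF (crec_snd crec_id). Qed.

Lemma crecb_bits Y K : crec Y -> crec K -> crecb (fun g x => bits (Y g x) (K g x)).
Proof. by move=> hY hK; apply: crecb_odd; repeat (assumption || crec1). Qed.

Lemma crec_u F : crec F -> crec (fun g x => u (F g x)).
Proof. by move=> hF; rewrite /u; repeat (assumption || crec1). Qed.

Lemma crec_blen F : crec F -> crec (fun g x => blen (F g x)).
Proof. by move=> hF; apply: crec_mul; [exact: crec_const|exact: crec_u]. Qed.

Lemma crecb_marked Y F I N : crec Y -> crec F -> crec I -> crec N ->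
  crecb (fun g x => marked (bits (Y g x)) (F g x) (I g x) (N g x)).
Proof.
move=> hY hF hI hN; apply: crec_ext (crecb_has
  (P := fun g k x => bits (Y g x) (npair (I g x + k) (F g x).+1)) _ hN).
  move=> g x; congr nat_of_bool.
  by rewrite /marked -[in iota (I g x) _](addn0 (I g x)) iotaDl has_map.
apply: crecb_bits; first exact: crec_lift.
apply: crec_pair; last by apply: crec_succ; exact: crec_lift.
by apply: crec_add; [exact: crec_lift|exact: crec_fst crec_id].
Qed.

Lemma crecb_mode Y F I : crec Y -> crec F -> crec I ->
  crecb (fun g x => mode u r (F g x) (I g x) (bits (Y g x))).
Proof.
move=> hY hF hI; apply: crec_ext (crec_rec (crec_const 0) (H := fun g j m x =>
   if marked (bits (Y g x)) j (I g x) (blen j)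
   then nat_of_bool (~~ marked (bits (Y g x)) j (I g x) (r * u j)) else m) _ hF).
  by move=> g x; elim: (F g x) => //= j ->; case: ifP.
have hY' := crec_lift (crec_lift hY); have hI' := crec_lift (crec_lift hI).
have hj := crec_fst crec_id.
apply: crec_if; last exact: crec_fst (crec_snd crec_id).
  by apply: crecb_marked => //; exact: crec_blen.
apply: crecb_neg; apply: crecb_marked => //.
by apply: crec_mul; [exact: crec_const|exact: crec_u].
Qed.

Lemma crecb_word_bit W I : crec W -> crec I -> crecb (fun g x => word_bit (W g x) (I g x)).
Proof.
move=> hW hI; apply: crecb_odd; apply: crec_div; first exact: crec_succ.
apply: crec_exp; first exact: crec_const.
by apply: crec_sub => //; apply: crec_pred; exact: crec_code_size.
Qed.

Lemma crecb_out_matches J W Y : crec J -> crec W -> crec Y ->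
  crecb (fun g x => out_matches (J g x) (W g x) (Y g x)).
Proof.
move=> hJ hW hY; have hi := crec_fst crec_id.
apply: (crecb_all (P := fun g i x => out u r (J g x) (bits (Y g x)) i == word_bit (W g x) i)).
  apply: crecb_eqb; last by apply: crecb_word_bit => //; exact: crec_lift.
  apply: crecb_and; first by apply: crecb_mode => //; exact: crec_lift.
  apply: crecb_bits; first exact: crec_lift.
  by apply: crec_pair => //; exact: crec_const.
exact: crec_code_size.
Qed.

Lemma crec_numer F : crec F -> crec (fun g x => numer (F g x)).
Proof.
move=> hF; apply: crec_if; first by apply: crecb_odd; exact: crec_fst.
  exact: crec_const.
exact: crec_half (crec_fst hF).
Qed.

Lemma crec_sigma_query L J : crec L -> crec J ->
  crec (fun g x => sigma_query g (L g x) (J g x)).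
Proof.
move=> hL hJ; apply: crec_orc; apply: crec_pair; first exact: crec_u.
by apply: crec_pair => //; exact: crec_const.
Qed.

Lemma crec_T_approx L J : crec L -> crec J -> crec (fun g x => T_approx g (L g x) (J g x)).
Proof.
move=> hL hJ; have hq := crec_sigma_query hL hJ.
apply: crec_if => //; first by apply: crecb_eq; [exact: crec_snd|exact: crec_const].
apply: crec_div; first by apply: crec_mul => //; exact: crec_snd.
by apply: crec_add; [exact: crec_numer|exact: crec_snd].
Qed.

Lemma crec_theta_approx L K : crec L -> crec K ->
  crec (fun g x => theta_approx g (L g x) (K g x)).
Proof.
move=> hL hK; have hs := crec_snd hK; have hp := crec_pred hs.
apply: crec_if; first by apply: crecb_eq => //; exact: crec_const.
  exact: crec_half.
apply: crec_div; first by apply: crec_sub; exact: crec_T_approx.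
by apply: crec_mul; [exact: crec_const|exact: crec_blen].
Qed.

Lemma crec_depth J W : crec J -> crec W -> crec (fun g x => depth (J g x) (W g x)).
Proof.
move=> hJ hW; apply: crec_mul; last exact: crec_succ (crec_double hJ).
apply: crec_exp; first exact: crec_const.
by apply: crec_add; [exact: crec_code_size|exact: crec_blen].
Qed.

Lemma crec_precision J W N : crec J -> crec W -> crec N ->
  crec (fun g x => precision (J g x) (W g x) (N g x)).
Proof.
move=> hJ hW hN; apply: crec_mul; last exact: crec_depth.
by apply: crec_mul => //; exact: crec_const.
Qed.

Lemma crec_law_numer J W N : crec J -> crec W -> crec N ->
  crec (fun g x => law_numer g (J g x) (W g x) (N g x)).
Proof.
move=> hJ hW hN; have hd := crec_depth hJ hW; have hp := crec_precision hJ hW hN.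
apply: (crec_sum (F := fun g y x => (out_matches (J g x) (W g x) y *
    \prod_(k < depth (J g x) (W g x))
      (if bits y k then theta_approx g (precision (J g x) (W g x) (N g x)) k
      else precision (J g x) (W g x) (N g x) -
        theta_approx g (precision (J g x) (W g x) (N g x)) k))%N)); last first.
  by apply: crec_exp => //; exact: crec_const.
have hy := crec_fst crec_id.
apply: crec_mul; first exact: (crecb_out_matches (crec_lift hJ) (crec_lift hW) hy).
apply: (crec_prod (F := fun g k y => if bits (nfst y) k
    then theta_approx g (precision (J g (nsnd y)) (W g (nsnd y)) (N g (nsnd y))) k
    else (precision (J g (nsnd y)) (W g (nsnd y)) (N g (nsnd y)) -
      theta_approx g (precision (J g (nsnd y)) (W g (nsnd y)) (N g (nsnd y))) k)%N)).
  have hp' := crec_lift (crec_lift hp); have hk := crec_fst crec_id.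
  apply: crec_if; first exact: (crecb_bits (crec_fst (crec_snd crec_id)) hk).
    exact: crec_theta_approx.
  by apply: crec_sub => //; exact: crec_theta_approx.
exact: crec_lift hd.
Qed.

Lemma crecb_level_test J W N : crec J -> crec W -> crec N ->
  crecb (fun g x => level_test g (J g x) (W g x) (N g x)).
Proof.
move=> hJ hW hN; have hq := crec_sigma_query (crec_const 1) hJ.
have hs := crec_snd hq; apply: crecb_and; first by apply: crecb_leq => //; exact: crec_const.
apply: crecb_leq; last exact: crec_numer.
apply: crec_mul => //; apply: crec_succ; apply: crec_mul.
  by apply: crec_mul => //; exact: crec_const.
exact: crec_succ (crec_code_size hW).
Qed.

Lemma law_code_exists : exists c, forall g w dc,
  (exists J, level_test g J w (nsnd dc)) ->
  exists2 J, level_test g J w (nsnd dc) & evalp g c (npair w dc)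
    (npair (law_numer g J w (nsnd dc)).*2
       (precision J w (nsnd dc) ^ depth J w)).
Proof.
have hJ := crec_fst crec_id; have hW := crec_fst (crec_snd crec_id).
have hN := crec_snd (crec_snd (crec_snd crec_id)).
have [ct ht] := crecb_neg (crecb_level_test hJ hW hN).
have [cm hm] := crec_pair (crec_double (crec_law_numer hJ hW hN))
  (crec_exp (crec_precision hJ hW hN) (crec_depth hJ hW)).
have [ci hi] := crec_id.
(* [Cmu] searches for the least level that passes the test. The doubled numerator in the output is
   the code of a nonnegative integer. *)
exists (Ccomp cm (Cpair (Cmu ct) ci)) => g w dc ex.
case: (ex_minnP ex) => J hJt minJ; exists J => //.
apply: (@ev_comp _ _ _ _ (npair J (npair w dc))).
  apply: ev_pair; last exact: hi.
  apply: ev_mu.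
    by have := ht g (npair J (npair w dc)); rewrite !(nfst_npair, nsnd_npair) hJt.
  move=> J' lt; exists 1%N => //.
  have := ht g (npair J' (npair w dc)); rewrite !(nfst_npair, nsnd_npair).
  by case tJ': (level_test _ _ _ _) => //; have := minJ _ tJ'; lia.
by have := hm g (npair J (npair w dc)); rewrite !(nfst_npair, nsnd_npair).
Qed.

End approximate_law.

(** * Error of the approximate rates *)

Section approximation_error.
Context {R : realType} (B r D : nat) (sigma : nat -> R) (q : nat -> R).
Hypotheses (B_gt0 : (0 < B)%N) (D_gt0 : (0 < D)%N) (sigma_ge0 : forall n, 0 <= sigma n)
  (sigma_mono : {homo sigma : m n / (m <= n)%N >-> m <= n}).
Let u j := (4 * B ^ j)%N.
Local Notation blen := (blen u r).
Let T j : R := (1 + sigma (u j))^-1.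
Hypothesis qE : forall j, q j = (T j - T j.+1) / (D * blen j)%:R.
Variable g : nat -> nat.
Hypothesis g_name : is_name sigma g.

Lemma enc_rat_inv L : (0 < L)%N -> enc_rat (L%:R^-1) = npair 2 L.
Proof.
move=> L0; rewrite /enc_rat (_ : L%:R^-1 = 1%:~R / (Posz L)%:~R :> rat); last by rewrite mul1r.
case: L L0 => // L _.
by rewrite (@coprimeq_num 1 (Posz L.+1)) ?coprime1n // (@coprimeq_den 1 (Posz L.+1)) ?coprime1n.
Qed.

(** Replacing a negative answer by 0 does not increase the error, as [sigma] is nonnegative. *)
Lemma sigma_query_correct L j : (0 < L)%N ->
  `|(numer (sigma_query B g L j))%:R / (nsnd (sigma_query B g L j))%:R - sigma (u j)|
    <= L%:R^-1 :> R.
Proof.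
move=> L0; have d0 : (0 : rat) < L%:R^-1 by rewrite invr_gt0 ltr0n.
have := g_name (u j) d0; rewrite enc_rat_inv // -/(sigma_query B g L j).
set c := sigma_query B g L j.
rewrite /dec_rat fmorph_div rmorph_int rmorph_nat fmorphV rmorph_nat /dec_int /numer.
case: ifP => _; last by rewrite -pmulrn.
have s0 := sigma_ge0 (u j).
have : 0 <= ((nfst c)./2.+1)%:R / (nsnd c)%:R :> R by rewrite divr_ge0.
rewrite NegzE mulrNz mulNr -pmulrn => h0 h; rewrite mul0r sub0r normrN ger0_norm //.
move: h; rewrite ler_norml => /andP[h _]; lra.
Qed.

Lemma divn_error m d : (0 < d)%N ->
  (m %/ d)%:R <= m%:R / d%:R :> R /\ m%:R / d%:R <= (m %/ d)%:R + 1 :> R.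
Proof.
move=> d0; have d0' : (0 : R) < d%:R by rewrite ltr0n.
rewrite ler_pdivlMr // ler_pdivrMr // natr1 -!natrM !ler_nat leq_trunc_div.
by split=> //; apply: ltnW; exact: ltn_ceil.
Qed.

Lemma T_approx_le L j : (T_approx B g L j <= L)%N.
Proof.
rewrite /T_approx; case: eqP => // /eqP; rewrite -lt0n => b0.
have d0 : (0 < numer (sigma_query B g L j) + nsnd (sigma_query B g L j))%N by lia.
by rewrite -ltnS ltn_divLR //; nia.
Qed.

(** The map [x |-> 1 / (1 + x)] is 1-Lipschitz for [x >= 0], so the query costs [1 / L]; rounding
    costs another. *)
Lemma T_approx_correct L j : (0 < L)%N -> `|(T_approx B g L j)%:R / L%:R - T j| <= 2 / L%:R.
Proof.
move=> L0; have LR : (0 : R) < L%:R by rewrite ltr0n.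
have := sigma_query_correct j L0; rewrite /T_approx /T.
set a := numer _; set b := nsnd _; set s := sigma (u j).
have s0 : 0 <= s by exact: sigma_ge0.
have inv_lip (x y : R) : 0 <= x -> 0 <= y -> `|x - y| <= L%:R^-1 ->
    `|(1 + x)^-1 - (1 + y)^-1| <= L%:R^-1.
  move=> x0 y0; have -> : (1 + x)^-1 - (1 + y)^-1 = (y - x) / ((1 + x) * (1 + y)).
    by field; rewrite !gt_eqF //; lra.
  apply: le_trans; rewrite normrM distrC ler_piMr // normfV ger0_norm; last by nra.
  by rewrite invf_le1; nra.
case: eqP => [-> h|/eqP]; first rewrite invr0 mulr0 in h.
  have := inv_lip 0 s (lexx 0) s0 h; rewrite addr0 invr1 divff ?gt_eqF // => {}h.
  by apply: le_trans h _; rewrite ler_peMl ?invr_ge0 ?ltW //; lra.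
rewrite -lt0n => b0 h; have bR : (0 : R) < b%:R by rewrite ltr0n.
have aR : (0 : R) <= a%:R by [].
have ab : 0 <= a%:R / b%:R :> R by rewrite divr_ge0.
have := inv_lip _ _ ab s0 h.
have -> : (1 + a%:R / b%:R)^-1 = (b * L)%:R / (a + b)%:R / L%:R :> R.
  by rewrite natrD natrM; field; rewrite !gt_eqF //; lra.
have d0 : (0 < a + b)%N by lia.
have [f1 f2] := divn_error (b * L) d0.
move: f1 f2; set y := (b * L)%:R / _; set x := _%:R => f1 f2 {}h.
have i0 : 0 < L%:R^-1 :> R by rewrite invr_gt0.
by move: h; rewrite !ler_norml => /andP[h1 h2]; apply/andP; split; nra.
Qed.

Lemma blen_gt0 j : (0 < blen j)%N.
Proof. by rewrite muln_gt0 /= muln_gt0 /= expn_gt0 B_gt0. Qed.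

Lemma theta_approx_le L k : (theta_approx B r D g L k <= L)%N.
Proof.
rewrite /theta_approx; case: ifP => _; first by lia.
apply: leq_trans (leq_div _ _) _; apply: leq_trans (leq_subr _ _) _; exact: T_approx_le.
Qed.

Lemma T_decr j : T j.+1 <= T j.
Proof.
have h := sigma_ge0 (u j); rewrite lef_pV2 ?posrE; [|by have := sigma_ge0 (u j.+1); lra|by lra].
rewrite lerD2l; apply: sigma_mono; rewrite leq_mul2l /= leq_pexp2l //.
Qed.

(** Each of the two tails contributes [2 / L], and the final integer division [1 / L]. *)
Lemma theta_approx_correct L k : (0 < L)%N -> ~~ odd L ->
  `|(theta_approx B r D g L k)%:R / L%:R - theta q k| <= 5 / L%:R.
Proof.
move=> L0 oL; have LR : (0 : R) < L%:R by rewrite ltr0n.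
rewrite /theta_approx /theta; case: (nsnd k) => [|j] /=.
  have -> : L%:R = (L./2)%:R * 2 :> R by rewrite -natrM muln2 even_halfK // oL.
  have h0 : (0 : R) < (L./2)%:R by rewrite ltr0n; case: (L) L0 oL => [|[|]].
  rewrite invfM mulrA divff ?gt_eqF // subrr normr0.
  by rewrite !mulr_ge0 ?invr_ge0 ?mulr_ge0 ?ltW.
have t0 := T_approx_correct j L0; have t1 := T_approx_correct j.+1 L0; have td := T_decr j.
have M0 : (0 < D * blen j)%N by rewrite muln_gt0 D_gt0 blen_gt0.
rewrite qE; move: (D * blen j)%N M0 => M M0.
have MR : (1 : R) <= M%:R by rewrite ler1n.
have [f1 f2] := divn_error (T_approx B g L j - T_approx B g L j.+1) M0.
have i0 : 0 < L%:R^-1 :> R by rewrite invr_gt0.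
have m0 : 0 < M%:R^-1 :> R by rewrite invr_gt0 ltr0n.
have m1 : M%:R^-1 <= 1 :> R by rewrite invf_le1 // ltr0n.
set t := T_approx B g L j in t0 f1 f2 *; set t' := T_approx B g L j.+1 in t1 f1 f2 *.
have sub : `|(t - t')%:R / L%:R - (T j - T j.+1)| <= 4 / L%:R.
  move: t0 t1; rewrite !ler_norml => /andP[a1 a2] /andP[b1 b2].
  have [le|lt] := leqP t' t; first by rewrite natrB // mulrBl; apply/andP; split; lra.
  have -> : (t - t' = 0)%N by apply/eqP; rewrite subn_eq0 ltnW.
  have : t%:R / L%:R <= t'%:R / L%:R :> R by rewrite ler_pM2r // ler_nat ltnW.
  by rewrite mul0r; move=> ?; apply/andP; split; lra.
move: sub; rewrite !ler_norml => /andP[s1 s2].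
have k1 := ler_wpM2r (ltW m0) s1; have k2 := ler_wpM2r (ltW m0) s2.
have g1 := ler_wpM2r (ltW i0) f1; have g2 := ler_wpM2r (ltW i0) f2.
have im : 4 / L%:R / M%:R <= 4 / L%:R :> R by rewrite ler_piMr // mulr_ge0 // ltW.
apply/andP; split; lra.
Qed.

End approximation_error.

(** * The stationary measure *)

Section construction.
Context {R : realType} (r D : nat) (sigma : nat -> R).

Let B := (r + 3)%N.
(** The ratio [r + 3] is the least for which a block starting within [2 * u j] ends before the next
    scale; the factor 4 makes three quarters of a scale an integer. *)
Definition scale j : nat := (4 * B ^ j)%N.
Definition tail j : R := (1 + sigma (scale j))^-1.
(* Differences of the tails, because the rates have to be continuous in [sigma]:
   an integer-valued minorant of [sigma] cannot be read off its names extensionally. *)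
Definition rate j : R := (tail j - tail j.+1) / (D * blen scale r j)%:R.

Local Notation u := scale.
Local Notation blen := (blen scale r).
Local Notation q := rate.
Local Notation T := tail.

Let B_gt0 : (0 < B)%N. Proof. by rewrite /B addnC. Qed.

Lemma scale_gt0 j : (0 < u j)%N.
Proof. by rewrite muln_gt0 expn_gt0 B_gt0. Qed.

Lemma scale_growth j : (blen j + 2 * u j <= u j.+1)%N.
Proof. by rewrite -mulnDl /scale expnS /B; lia. Qed.

Hypothesis r_ge3 : (3 <= r)%N.
Let r_gt0 : (0 < r)%N. Proof. exact: leq_trans r_ge3. Qed.

(** With [m = B ^ j >= 16], which is where [J >= 2] enters, [32 m^2 <= 2^m] bounds the term
    [4 m 2^-m] by [1 / (8 m)], and the sum by a geometric series. *)
Lemma scale_sum J n : (2 <= J)%N ->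
  \sum_(k < n) (u (J + k))%:R * 2 ^- (B ^ (J + k)) <= 1 / 4 :> R.
Proof.
move=> J2; have big m : (16 <= m)%N -> (32 * (m * m) <= 2 ^ m)%N.
  elim: m => // m IH; rewrite leq_eqVlt => /orP[/eqP <- //|].
  by rewrite ltnS => /[dup] /IH h le; rewrite expnS; nia.
have pow4 j : (4 ^ j <= B ^ j)%N by case: j => // j; rewrite leq_exp2r // /B; lia.
have term j : (2 <= j)%N -> (u j)%:R * 2 ^- (B ^ j) <= 8^-1 * 2 ^- j :> R.
  move=> j2; have h16 : (16 <= B ^ j)%N.
    by apply: leq_trans (pow4 j); rewrite -[16%N]/(4 ^ 2)%N leq_exp2l.
  have hj : (2 ^ j <= B ^ j)%N.
    by apply: leq_trans (pow4 j); rewrite -[4%N]/(2 ^ 2)%N -expnM leq_exp2l //; lia.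
  have h := big _ h16.
  rewrite ler_pdivrMr ?exprn_gt0 // -invfM mulrC ler_pdivlMr; last by rewrite mulr_gt0 ?exprn_gt0.
  rewrite -!natrX -!natrM ler_nat /scale; nia.
have geo : \sum_(k < n) 8^-1 * 2 ^- k <= 4^-1 - 4^-1 * 2 ^- n :> R.
  elim: (n) => [|m IH]; first by rewrite big_ord0 expr0 invr1 mulr1 subrr.
  rewrite big_ord_recr /= exprS invfM; have e : (2 : R)^-1 = 1 / 2 by rewrite div1r.
  have e4 : (4 : R)^-1 = 1 / 4 by rewrite div1r.
  have e8 : (8 : R)^-1 = 1 / 8 by rewrite div1r.
  by rewrite e e4 e8 in IH *; lra.
apply: (@le_trans _ _ (\sum_(k < n) 8^-1 * 2 ^- k)).
  apply: ler_sum => k _; apply: le_trans (term _ _) _; first by lia.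
  rewrite ler_pM2l ?invr_gt0 // lef_pV2 ?posrE ?exprn_gt0 // ler_eXn2l ?ltr1n //.
  exact: leq_addl.
apply: le_trans geo _; rewrite div1r gerBl mulr_ge0 // invr_ge0 exprn_ge0 //.
Qed.

Hypotheses (D_ge4 : (4 <= D)%N) (sigma_ge0 : forall n, 0 <= sigma n)
  (sigma_mono : {homo sigma : m n / (m <= n)%N >-> m <= n})
  (sigma_unbounded : forall M : R, exists n, M < sigma n).
Let D_gt0 : (0 < D)%N. Proof. exact: leq_trans D_ge4. Qed.

Lemma tail_itv j : 0 < T j <= 1.
Proof.
have s0 := sigma_ge0 (u j); apply/andP; split; first by rewrite invr_gt0; lra.
by rewrite invf_le1; lra.
Qed.

Lemma tail_decr j : T j.+1 <= T j.
Proof. exact: T_decr. Qed.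

Let DbR j : (1 : R) <= (D * blen j)%:R.
Proof. by rewrite ler1n muln_gt0 D_gt0 /= muln_gt0 /= scale_gt0. Qed.

Lemma rate_itv j : 0 <= q j <= 1.
Proof.
have := tail_itv j; have := tail_itv j.+1; have := tail_decr j; have := DbR j.
move=> h1 h2 /andP[h3 h4] /andP[h5 h6]; apply/andP; split.
  by rewrite divr_ge0 // subr_ge0.
by rewrite ler_pdivrMr; lra.
Qed.

Lemma tail_telescope J n : \sum_(k < n) (T (J + k) - T (J + k).+1) = T J - T (J + n).
Proof.
elim: n => [|n IH]; first by rewrite big_ord0 addn0 subrr.
by rewrite big_ord_recr /= IH addnS; ring.
Qed.

Lemma rate_blen J n : \sum_(k < n) q (J + k) * (blen (J + k))%:R <= T J / D%:R.
Proof.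
rewrite (eq_bigr (fun k : 'I_n => (T (J + k) - T (J + k).+1) / D%:R)); last first.
  move=> k _; have bl : (blen (J + k))%:R != 0 :> R.
    by rewrite pnatr_eq0 -lt0n muln_gt0 /= scale_gt0.
  have Dn : D%:R != 0 :> R by rewrite pnatr_eq0 -lt0n.
  by rewrite /rate natrM; field; rewrite Dn bl.
rewrite -mulr_suml tail_telescope ler_pM2r ?invr_gt0 ?ltr0n //.
by have /andP[] := tail_itv (J + n); lra.
Qed.

Lemma rate_scale J n : \sum_(k < n) q (J + k) * (u (J + k))%:R =
  (D * r.+1)%:R^-1 * (T J - T (J + n)).
Proof.
rewrite -tail_telescope mulr_sumr; apply: eq_bigr => k _.
have un : (u (J + k))%:R != 0 :> R by rewrite pnatr_eq0 -lt0n scale_gt0.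
have Dn : D%:R != 0 :> R by rewrite pnatr_eq0 -lt0n.
have rn : r.+1%:R != 0 :> R by rewrite pnatr_eq0.
have e : (D * blen (J + k))%:R = D%:R * (r.+1%:R * (u (J + k))%:R) :> R by rewrite natrM (natrM _ r.+1).
rewrite /rate e (natrM _ D); move: un Dn rn; move: (T _ - T _) D%:R r.+1%:R (u _)%:R.
by move=> x d s y y0 d0 s0; field; rewrite y0 d0 s0.
Qed.

Lemma tail_small J : T J / D%:R <= 1 / 4.
Proof.
have /andP[h0 h1] := tail_itv J; rewrite ler_pdivrMr ?ltr0n //.
have : (4 : R) <= D%:R by rewrite ler_nat.
lra.
Qed.

Variable mu : probability cantor R.
Hypothesis muE : forall x, mu (cyl x) = (bweight (theta q) x)%:E.

Local Notation law := (law u r mu).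

Lemma rate_gt0_exists : exists j, 0 < q j.
Proof.
apply: contrapT => none.
have h j : T j = T 0.
  elim: j => // j <-; apply/eqP; rewrite eq_le tail_decr /= leNgt; apply/negP => lt.
  by apply: none; exists j; rewrite divr_gt0 ?subr_gt0 // (lt_le_trans ltr01) ?DbR.
have [j _] := sigma_u_unbounded scale_gt0 scale_growth sigma_mono sigma_unbounded
  (sigma (u 0) + 1) 0.
have := h j; rewrite /tail => /invr_inj; lra.
Qed.

(** At a level of positive rate, position 0 is fair when no mark falls in [[0, r u)] and one falls
    in [[r u, r u + u)]. Truncating just above this level makes it decisive. *)
Lemma law_true_gt0 : 0 < law [:: true].
Proof.
have [j qj] := rate_gt0_exists.
pose I := fun k => k \in [seq npair m j.+1 | m <- iota 0 (r * u j)].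
have lm : local I (fun b => marked b j 0 (r * u j)).
  by apply: local_has => m hm; apply: local_coord; exact: map_f.
have lk : local (predC I) (fun b => marked b j (r * u j) (u j)).
  apply: local_has => m hm; apply: local_coord; apply/mapP => -[m' hm' /npair_inj[e _]].
  by move: hm hm'; rewrite !mem_iota; lia.
have h1 := pr_marked_ge r_gt0 rate_itv rate_blen tail_small muE (r * u j) (leqnn (u j)).
have h2 := pr_marked muE j 0 (r * u j).
have uR : (0 : R) < (u j)%:R by rewrite ltr0n scale_gt0.
have h3 : (r * u j)%:R * q j <= 1 / 4.
  apply: le_trans (tail_small j); apply: le_trans (q_blen rate_blen j).
  by rewrite mulrC; apply: ler_wpM2l; [exact: ltW|rewrite ler_nat leq_mul2r leqW ?orbT].
have lB : local (fun k => nsnd k == 0%N) (fun b => b (npair 0 0)).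
  by apply: local_coord; rewrite nsnd_npair.
have lM : local (predC (fun k => nsnd k == 0%N)) (fun b =>
    ~~ marked b j 0 (r * u j) && marked b j (r * u j) (u j)).
  apply: local_and; [apply: local_not|]; apply: local_sub (local_marked _ _ _) => k;
    by move=> /eqP /= ->.
have pos : 0 < pr mu (fun b => b (npair 0 0) &&
    (~~ marked b j 0 (r * u j) && marked b j (r * u j) (u j))).
  rewrite (pr_indep muE lB lM) (pr_indep muE (local_not lm) lk) pr_not; last exact: measurable_local lm.
  rewrite (pr_coord (th := theta q)) // /theta nsnd_npair.
  rewrite !mulr_gt0 //; first by lra.
  apply: lt_le_trans h1; rewrite divr_gt0 // mulr_gt0 //.
have hl := @law_ge _ _ _ _ _ scale_gt0 r_gt0 scale_growth rate_itv rate_blen tail_small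
  mu muE j.+1 [:: true] (scale_gt0 _).
have : 0 < 2 * law [:: true]; last by rewrite pmulr_rgt0.
apply: lt_le_trans hl; apply: lt_le_trans pos _; apply: pr_mono.
- by apply: event_and; [exact: measurable_local lB|exact: measurable_local lM].
- exact: measurable_local (local_pre_out u r j.+1 1 [:: true]).
move=> b /and3P[hb h0 hm]; rewrite /pre /mkseq /= /out /= hb h0 andbT.
by rewrite (@marked_sub b j (r * u j) (u j) 0 (blen j)) // blenE.
Qed.

(** The process without levels is identically zero, so the truncation error at [J = 0] bounds the
    probability of a one. *)
Lemma law_true_le : law [:: true] <= 2 / D%:R.
Proof.
have := law_approx scale_gt0 rate_itv rate_blen muE 0 [:: true].
rewrite [X in `|_ - X|](_ : _ = 0); last first.
  by rewrite -(pr_false mu); apply: eq_pr => b; rewrite /pre /mkseq /= /out.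
rewrite subr0 => /(le_trans (ler_norm _))/le_trans; apply.
have /andP[_ h] := tail_itv 0; rewrite mulrA ler_pM2r ?invr_gt0 ?ltr0n //.
by rewrite /=; lra.
Qed.

Variable P : probability cantor R.
Hypothesis PE : forall A, P A = mu (outF u r @^-1` A).

Lemma P_law x : Pw P x = law x.
Proof.
rewrite /Pw PE /law /pr; congr (fine (mu _)).
by apply/seteqP; split=> b /eqP.
Qed.

Let mF A (mA : measurable A) : measurable (outF u r @^-1` A : set cantor).
Proof. by rewrite -[X in measurable X]setTI; exact: (measurable_outF u r). Qed.

Let F_shift A : outF u r @^-1` (Defs.shift @^-1` A) = bshift @^-1` (outF u r @^-1` A).
Proof. by apply/seteqP; split=> b /=; rewrite outF_bshift. Qed.

Lemma P_stationary : stationary P.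
Proof.
move=> A mA; rewrite !PE F_shift.
by have [] := bshift_preserves muE (theta_shift q) (mF mA).
Qed.

Lemma P_ergodic : ergodic P.
Proof.
move=> A mA iA; rewrite PE; apply: (bshift_ergodic muE (theta_shift q)).
  exact: mF.
by rewrite -F_shift iA.
Qed.

(** [h x] is the probability of [x] followed by a one at a fair position. Summed over [x] this is
    the probability of a one at position [n], which stationarity makes independent of [n]. *)
Lemma P_entropy (eps : R) : 6 * Num.sqrt (2 / D%:R) <= eps ->
  exists H, entropy_is P H /\ 0 < H <= eps.
Proof.
move=> heps.
pose Y n b := fair u r n b && b (npair n 0).
have mY n : event (Y n) := event_outF u r n.
have mE x : event (fun b => pre (outF u r b) (size x) == x) := event_pre_outF u r _ x.
pose h x := pr mu (fun b => (pre (outF u r b) (size x) == x) && Y (size x) b).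
apply: (entropy_bounds P_stationary (h := h) (rho := law [:: true])).
- by move=> x; exact: pr_ge0.
- move=> x c; rewrite P_law /h.
  have true_le : pr mu (fun b => (pre (outF u r b) (size x) == x) && Y (size x) b) <= law (rcons x true).
    apply: pr_mono; [exact: event_and|exact: mE|].
    by move=> b /andP[/eqP hx hY]; rewrite size_rcons preS hx /outF -/(Y (size x) b) hY.
  case: c; first exact: true_le.
  (* flipping the coin of position [size x] preserves [mu] and the word [x] before it *)
  pose k0 := npair (size x) 0; pose flip (b : cantor) : cantor := fun k => (k == k0) (+) b k.
  have flipE b k : k != k0 -> flip b k = b k by rewrite /flip => /negbTE ->.
  have mark_flip b m j : mark (flip b) m j = mark b m j.
    by rewrite /mark flipE //; apply/eqP => /npair_inj[].
  have mode_flip J i b : mode u r J i (flip b) = mode u r J i b.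
    have marked_flip j' i' n' : marked (flip b) j' i' n' = marked b j' i' n'.
      by apply: eq_has => m; exact: mark_flip.
    by elim: J => //= J ->; rewrite !marked_flip.
  have fair_flip i b : fair u r i (flip b) = fair u r i b.
    by rewrite /fair; under eq_exists do under eq_forall do rewrite mode_flip.
  have pre_flip b : pre (outF u r (flip b)) (size x) = pre (outF u r b) (size x).
    apply/pre_eqP => i lt; rewrite /outF fair_flip flipE //.
    by apply/eqP => /npair_inj[e]; rewrite e ltnn in lt.
  pose Z b := [&& pre (outF u r b) (size x) == x, fair u r (size x) b & ~~ b k0].
  have mZ : event Z.
    apply: event_and => //; apply: event_and; first exact: event_fair.
    by apply: event_not; exact: (measurable_local (local_coord (I := predT) isT)).
  have [|n|_ e] := relabel_preserves muE (c := pred1 k0) (s := id) _ _ mZ.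
  - by [].
  - by rewrite /=; case: eqP => // ->; rewrite /theta nsnd_npair; lra.
  have -> : pr mu (fun b => (pre (outF u r b) (size x) == x) && Y (size x) b) = pr mu Z.
    rewrite {2}/pr -e; congr (fine (mu _)); apply/seteqP.
    by split=> b; rewrite /= -/(flip b) /Z pre_flip fair_flip /flip eqxx negb_add /= -/k0 //.
  apply: pr_mono => // b /and3P[/eqP hx _ nb].
  by rewrite size_rcons preS hx /outF -/k0 (negbTE nb) andbF.
- exact: law_true_gt0.
- move=> n; have -> : law [:: true] = pr mu (Y n).
    have [_ e] := pr_bshift_iter muE (theta_shift q) n (mY 0%N).
    transitivity (pr mu (Y 0%N)).
      by apply: eq_pr => b; rewrite /pre /mkseq /= eqseq_cons andbT eqb_id.
    rewrite -e; apply: eq_pr => b; have sh i : outF u r (iter i bshift b) 0 = outF u r b i.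
      by elim: i b => // i IH b; rewrite iterSr IH outF_bshift.
    exact: sh.
  have [mH hH] := pr_has mu (words n) (fun x => event_and (mE x) (mY (size x))).
  apply: le_trans (le_trans (pr_mono mu (mY n) mH _) hH) _.
    move=> b hY; apply/hasP; exists (pre (outF u r b) n); first by rewrite mem_words size_pre.
    by rewrite size_pre eqxx.
  exact: lexx.
rewrite P_law; apply: le_trans heps; rewrite ler_pM2l //.
by rewrite ler_sqrt ?law_true_le // divr_ge0.
Qed.

Let window n J k := (nfst k < n + blen J)%N && (nsnd k <= J)%N.

Lemma blen_mono j j' : (j <= j')%N -> (blen j <= blen j')%N.
Proof. by move=> le; rewrite leq_mul2l (u_mono scale_growth le) orbT. Qed.

Lemma local_mode_window n J i J' : (i < n)%N -> (J' <= J)%N ->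
  local (window n J) (mode u r J' i).
Proof.
move=> lt; have lm j l : (j < J)%N -> (l <= blen j)%N ->
    local (window n J) (fun b => marked b j i l).
  move=> jJ le; apply: local_has => m; rewrite mem_iota => hm; apply: local_coord.
  rewrite /window nfst_npair nsnd_npair jJ andbT.
  by have := blen_mono (ltnW jJ); lia.
elim: J' => [|j IH] le /=; first exact: local_const.
apply: local_if; [exact: lm| |exact/IH/ltnW].
by apply/local_not/lm => //; rewrite blenE leq_addr.
Qed.

Lemma dep_pre_out J (x : word) :
  dep (fun k => (k < depth B r J (enc_word x))%N) (fun b => pre (out u r J b) (size x) == x).
Proof.
have /local_dep : local (window (size x) J) (fun b => pre (out u r J b) (size x) == x).
  apply: (@local_pre _ _ _ (pred1 x)) => i lt; apply: local_and; first exact: local_mode_window.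
  apply: local_coord; rewrite /window nfst_npair nsnd_npair /=; lia.
apply: dep_sub => k /andP[h1 h2]; rewrite -[k]npair_eta /npair /depth code_sizeE.
have p1 : (0 < 2 ^ nfst k)%N by rewrite expn_gt0.
have p2 : (2 ^ nfst k <= 2 ^ (size x + blen J))%N by rewrite leq_exp2l // ltnW.
rewrite prednK ?muln_gt0 ?p1 //; apply: leq_mul => //; lia.
Qed.

Lemma law_numer_Ex g J (x : word) den : (0 < den)%N ->
  let w := enc_word x in let L := precision B r J w den in
  (law_numer B r D g J w den)%:R / (L ^ depth B r J w)%:R =
  Ex (fun k => (theta_approx B r D g L k)%:R / L%:R) (depth B r J w)
    (fun b => (pre (out u r J b) (size x) == x)%:R) :> R.
Proof.
move=> den0 w L; set m := depth B r J w.
have L0 : (0 < L)%N by rewrite !muln_gt0 den0 expn_gt0.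
have LR : L%:R != 0 :> R by rewrite pnatr_eq0 -lt0n.
rewrite Ex_bits /law_numer natr_sum mulr_suml; apply: eq_bigr => y _.
rewrite natrM -mulrA mulrC; congr (_ * _); last first.
  congr (nat_of_bool _)%:R; rewrite /out_matches code_sizeE.
  apply/allP/eqP => [h|h i]; last first.
    rewrite mem_iota => hi; rewrite word_bitE //.
    by have := congr1 (fun s => nth false s i) h; rewrite nth_mkseq // => <-.
  apply: (@eq_from_nth _ false); rewrite size_pre // => i lt.
  have /h/eqP : i \in iota 0 (size x) by rewrite mem_iota.
  by rewrite word_bitE // nth_mkseq.
have -> : (L ^ m)%:R = \prod_(k < m) L%:R :> R by rewrite prodr_const card_ord natrX.
rewrite natr_prod -/L -/m.
rewrite -prodf_div; apply: eq_bigr => k _; case: ifP => // _.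
by rewrite natrB ?theta_approx_le // mulrBl divff.
Qed.

(** Half of [1 / den] is spent on the approximate rates and half on discarding high levels. The
    level found depends on the name of [sigma], but the guarantee does not. *)
Lemma P_computable : computable_rel P sigma.
Proof.
have [c hc] := law_code_exists B r D; exists c => g hg x d d0.
set w := enc_word x; set dc := enc_rat d; pose den := `|denq d|%N.
have denE : nsnd dc = den by rewrite nsnd_npair.
have den0 : (0 < den)%N by rewrite absz_gt0 denq_neq0.
pose M := (2 * den * (size x).+1)%N.
have close j := @sigma_query_correct R B sigma sigma_ge0 g hg 1 j (ltn0Sn 0).
have exJ : exists J, level_test B g J w (nsnd dc).
  (* The target [M + 2] leaves [M + 1] after the query error of 1, which also rules out a zero
     denominator. *)
  have [J _ hJ] := sigma_u_unbounded scale_gt0 scale_growth sigma_mono sigma_unbounded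
    (M.+2)%:R 0.
  exists J; rewrite /level_test denE code_sizeE -/M.
  have := close J; rewrite invr1 ler_norml => /andP[h _].
  have {}h : M.+1%:R <= (numer (sigma_query B g 1 J))%:R / (nsnd (sigma_query B g 1 J))%:R :> R.
    by move: hJ; rewrite -[M.+2%:R]natr1 -/(scale J); lra.
  have b0 : (0 < nsnd (sigma_query B g 1 J))%N.
    rewrite lt0n; apply/eqP => e; move: h; rewrite e invr0 mulr0 leNgt ltr0n //.
  by rewrite b0 /= -(ler_nat R) natrM -ler_pdivlMr ?ltr0n.
have [J tJ ev] := hc g w dc exJ; rewrite denE in tJ ev.
eexists; first exact: ev.
rewrite P_law; set L := precision B r J w den; set m := depth B r J w.
set p := Ex (theta q) m (fun b => (pre (out u r J b) (size x) == x)%:R).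
have L0 : (0 < L)%N by rewrite !muln_gt0 den0 expn_gt0.
have m0 : (0 < m)%N by rewrite muln_gt0 expn_gt0.
have denR : (0 : R) < den%:R by rewrite ltr0n.
have -> : ratr (dec_rat (npair (law_numer B r D g J w den).*2 (L ^ m))) =
    (law_numer B r D g J w den)%:R / (L ^ m)%:R :> R.
  rewrite /dec_rat nfst_npair nsnd_npair /dec_int odd_double doubleK.
  by rewrite fmorph_div rmorph_int rmorph_nat -pmulrn.
rewrite law_numer_Ex //.
have e1 : `|Ex (fun k => (theta_approx B r D g L k)%:R / L%:R) m
    (fun b => (pre (out u r J b) (size x) == x)%:R) - p| <= (2 * den)%:R^-1 :> R.
  apply: le_trans (@Ex_lipschitz _ _ _ _ _ _ _ _) _.
  - move=> k; rewrite divr_ge0 //= ler_pdivrMr ?ltr0n // mul1r ler_nat.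
    exact: theta_approx_le.
  - exact: theta01 rate_itv.
  - by move=> b; case: (_ == _); rewrite lexx ler01.
  have oL : ~~ odd L by rewrite /L /precision -mulnA oddM.
  have qE j : q j = (T j - T j.+1) / (D * blen j)%:R by [].
  have th k := theta_approx_correct (D := D) B_gt0 D_gt0 sigma_ge0 sigma_mono qE hg k L0 oL.
  apply: (@le_trans _ _ (\sum_(k < m) 5 / L%:R)); first by apply: ler_sum => k _; exact: th.
  rewrite sumr_const card_ord -mulr_natl.
  have -> : L%:R = 10 * den%:R * m%:R :> R by rewrite !natrM.
  have mR : m%:R != 0 :> R by rewrite pnatr_eq0 -lt0n.
  rewrite natrM le_eqVlt; apply/orP; left; apply/eqP; field.
  by rewrite mR gt_eqF.
have e2 : `|law x - p| <= (2 * den)%:R^-1.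
  have := law_approx scale_gt0 rate_itv rate_blen muE J x.
  rewrite (pr_Ex muE (m := m)); last exact: dep_pre_out.
  move=> /le_trans; apply.
  have hs : M%:R <= sigma (u J).
    move: tJ; rewrite /level_test code_sizeE -/M => /andP[b0 hb].
    have := close J; rewrite invr1 ler_norml => /andP[_ h].
    have : M.+1%:R <= (numer (sigma_query B g 1 J))%:R / (nsnd (sigma_query B g 1 J))%:R :> R.
      by rewrite ler_pdivlMr ?ltr0n // -natrM ler_nat.
    by rewrite -natr1 -/(scale J) in h *; lra.
  have M0 : 0 <= M%:R :> R by [].
  have hT : T J <= (1 + M%:R)^-1 by rewrite lef_pV2 ?posrE; lra.
  have hD : T J / D%:R <= (1 + M%:R)^-1.
    apply: le_trans hT; rewrite ler_piMr //; last by rewrite invf_le1 ?ltr0n // ler1n.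
    by have /andP[/ltW] := tail_itv J.
  apply: le_trans (ler_wpM2l _ hD) _ => //.
  have d2 : (0 : R) < (2 * den)%:R by rewrite ltr0n muln_gt0.
  rewrite ler_pdivrMr; last lra.
  rewrite mulrC ler_pdivlMr // -natrM mulnC -/M; lra.
have hd : den%:R^-1 <= ratr d :> R.
  rewrite -[d]divq_num_den fmorph_div !rmorph_int.
  have eden : (denq d)%:~R = den%:R :> R by rewrite -[in LHS]absz_denq -pmulrn.
  rewrite eden ler_peMl ?invr_ge0 // ler1z.
  by rewrite -numq_gt0 in d0.
have hh : (2 * den)%:R^-1 + (2 * den)%:R^-1 = den%:R^-1 :> R.
  by rewrite natrM; field; rewrite gt_eqF.
apply: le_trans hd; rewrite -hh; rewrite distrC in e2.
apply: le_trans (le_trans (ler_normD _ _) (lerD e1 e2)).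
by rewrite addrA subrK.
Qed.

End construction.

(** * Oscillation of the complexity *)

Lemma limn_esup_ge {R : realType} (f : nat -> \bar R) (a : \bar R) :
  (forall N, exists2 n, (N <= n)%N & (a <= f n)%E) -> (a <= limn_esup f)%E.
Proof.
move=> h; apply: le_ereal_inf_tmp => _ [V [N _ NV] <-].
have [n Nn an] := h N; apply: le_trans an _; apply: ereal_sup_ubound.
by exists n => //; exact: NV.
Qed.

Lemma limn_einf_le {R : realType} (f : nat -> \bar R) (a : \bar R) :
  (forall N, exists2 n, (N <= n)%N & (f n <= a)%E) -> (limn_einf f <= a)%E.
Proof.
move=> h; rewrite /limn_einf leeNl; apply: limn_esup_ge => N.
by have [n Nn na] := h N; exists n => //; rewrite leeN2.
Qed.

Section oscillation.
Context {R : realType} (psi : word -> option word) (optK : optimal_decoder (R := R) psi).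
Variables (u v : nat -> nat) (rr : nat) (w : nat -> bool).
Hypotheses (u_gt0 : forall j, (0 < u j)%N) (u_ge : forall j, (j <= u j)%N)
  (u4v : forall j, u j = (4 * v j)%N)
  (ms : forall k, exists j t, [/\ (k <= j)%N, (u j < t <= 2 * u j)%N,
      ~ simple psi (3 * v j) (pre w (t + u j)) &
      forall i, (t + u j <= i < t + blen u (3 * rr) j)%N -> ~~ w i]).

(** The prefix ending with the fair part has length at most [3 * u j = 12 * v j] and no program
    shorter than [3 * v j]. *)
Lemma limsup_complexity :
  ((1 / 4 : R)%:E <= limn_esup (fun n => Kdec psi (pre w n) * (n%:R^-1)%:E))%E.
Proof.
apply: limn_esup_ge => N; have [j [t [Nj ht ns _]]] := ms N.
exists (t + u j)%N; first by have := u_ge j; lia.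
have n0 : (0 : R) < (t + u j)%:R by rewrite ltr0n; lia.
apply: (@le_trans _ _ ((3 * v j)%:R%:E * ((t + u j)%:R^-1)%:E)%E).
  rewrite -EFinM lee_fin ler_pdivlMr //.
  have : (t + u j)%:R <= (3 * v j)%:R * 4 :> R by rewrite -natrM ler_nat u4v in ht *; lia.
  lra.
by rewrite lee_wpmul2r ?lee_fin ?invr_ge0 ?ler0n //; exact: Kdec_ge.
Qed.

(** That prefix [x] has length at most [3 * u j], so the [3 * rr * u j] zeros after it suffice to
    continue it as [pad rr x], whose complexity is at most [size x + c]. *)
Lemma liminf_complexity (eps : R) : 0 < eps -> 2 / eps <= rr%:R ->
  (limn_einf (fun n => Kdec psi (pre w n) * (n%:R^-1)%:E) <= eps%:E)%E.
Proof.
move=> eps0 hrr; have [c hc] := Kdec_pad rr optK.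
(* Prefixes of length at least [2 c / eps] absorb the additive constant [c]. *)
have hb := archi_boundP (divr_ge0 (mulr_ge0 (ler0n R 2) (ler0n R c)) (ltW eps0)).
set M := Num.bound _ in hb.
apply: limn_einf_le => N; have [j [t [Nj ht _ z]]] := ms (maxn N M).
set x := pre w (t + u j); have sx : size x = (t + u j)%N by rewrite size_pre.
have uj := u_ge j; have l0 : (0 < size x)%N by rewrite sx; have := u_gt0 j; lia.
have big : (maxn N M <= size x)%N by rewrite sx; lia.
exists (size x + rr * size x)%N; first by move: big; rewrite geq_max; lia.
have -> : pre w (size x + rr * size x) = x ++ nseq (rr * size x) false.
  apply: (@eq_from_nth _ false); rewrite size_pre ?size_cat ?size_nseq // => i lt.
  rewrite nth_mkseq // nth_cat; case: ltnP => hi; first by rewrite nth_mkseq // -sx.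
  rewrite nth_nseq if_same; apply/negbTE/z; rewrite sx in hi lt.
  by have := blenE u (3 * rr) j; nia.
set n := (size x + rr * size x)%N.
have nR : (0 : R) < n%:R by rewrite ltr0n addn_gt0 l0.
apply: (@le_trans _ _ (((size x + c)%:R : R)%:E * (n%:R^-1)%:E)%E).
  by rewrite lee_wpmul2r ?lee_fin ?invr_ge0 ?ler0n //; exact: hc.
rewrite -EFinM lee_fin ler_pdivrMr // /n natrD natrD natrM.
have hs : M%:R <= (size x)%:R :> R by rewrite ler_nat; move: big; rewrite geq_max => /andP[].
rewrite ltr_pdivrMr // in hb; rewrite ler_pdivrMr // in hrr.
have s1 : (0 : R) <= (size x)%:R by [].
have k1 := ler_wpM2r s1 hrr; have k2 := ler_wpM2l (ltW eps0) hs.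
have k3 : 0 <= eps * (size x)%:R by rewrite mulr_ge0 // ltW.
lra.
Qed.

End oscillation.

Unset Implicit Arguments.

Theorem theorem1 (R : realType) (psi : word -> option word)
    (S : set (word * word)) :
  optimal_decoder (R:=R) psi -> optimal_monotone (R:=R) S ->
  forall sigma : nat -> R,
    (forall n, 0 <= sigma n) ->
    {homo sigma : m n / (m <= n)%N >-> m <= n} ->
    (forall M : R, exists n, M < sigma n) ->
  forall eps : R, 0 < eps < 1 / 4 ->
  exists P : probability cantor R,
    [/\ stationary P, ergodic P, computable_rel P sigma,
        (exists H : R, entropy_is P H /\ 0 < H <= eps) &
        exists alpha : nat -> bool,
          [/\ (\forall n \near \oo,
                 (deficiency P S (pre alpha n) <= (sigma n)%:E)%E),
              (((1 / 4 : R)%:E <=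
                 limn_esup (fun n => Kdec psi (pre alpha n) * ((n%:R)^-1)%:E))%E) &
              ((limn_einf (fun n => Kdec psi (pre alpha n) * ((n%:R)^-1)%:E)
                 <= eps%:E)%E)]].
Proof.
move=> optK [_ [monoS _]] sigma s0 smono sunb eps /andP[eps0 _].
have [rr rr1 hrr] : exists2 rr, (1 <= rr)%N & 2 / eps <= rr%:R.
  have h := archi_boundP (divr_ge0 (ler0n R 2) (ltW eps0)).
  exists (maxn 1 (Num.bound (2 / eps))); first exact: leq_maxl.
  by apply: le_trans (ltW h) _; rewrite ler_nat leq_maxr.
(* Squaring [6 * sqrt (2 / D) <= eps] gives [D >= 72 / eps ^ 2]; the bound 4 keeps every tail
   divided by [D] below [1/4]. *)
have [D D4 hD] : exists2 D, (4 <= D)%N & 6 * Num.sqrt (2 / D%:R) <= eps.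
  have h := archi_boundP (divr_ge0 (ler0n R 72) (ltW (exprn_gt0 2 eps0))).
  set D := Num.bound _ in h; exists (maxn 4 D); first exact: leq_maxl.
  have DR : (0 : R) < (maxn 4 D)%:R by rewrite ltr0n leq_max.
  rewrite -ler_pdivlMl // -[leRHS]ger0_norm; last by rewrite mulr_ge0 ?invr_ge0 // ltW.
  rewrite -sqrtr_sqr ler_sqrt ?sqr_ge0 // ler_pdivrMr //.
  have : 72 / eps ^+ 2 <= (maxn 4 D)%:R by apply: le_trans (ltW h) _; rewrite ler_nat leq_maxr.
  rewrite ler_pdivrMr ?exprn_gt0 // exprMn => h'.
  have -> : (6^-1 : R) ^+ 2 = 1 / 36 by rewrite exprVn div1r -natrX.
  lra.
(* The factor 3 matches the bound [3 * u j] on the prefix that the zeros have to outweigh. *)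
pose r := (3 * rr)%N; have r3 : (3 <= r)%N by rewrite /r; lia.
have r0 : (0 < r)%N by exact: leq_trans r3.
have gt0 := scale_gt0 r; have growth := scale_growth r.
have q01 := rate_itv r D4 s0 smono.
have [mu muE] := bernoulli_measure_exists (theta01 q01).
have [P PE] := pushforward_probability mu (measurable_outF (scale r) r).
exists P; split.
- exact: (P_stationary muE PE).
- exact: (P_ergodic muE PE).
- exact: (P_computable r3 D4 s0 smono sunb muE PE).
- exact: (P_entropy r3 D4 s0 smono sunb muE PE hD).
have c0 : 0 < (D * r.+1)%:R^-1 :> R by rewrite invr_gt0 ltr0n muln_gt0 (leq_trans _ D4).
have [w [n0 [hdef ms]]] := alpha_exists gt0 r0 growth q01 (rate_blen r D4 s0)
  (tail_small r D4 s0) (v := fun j => ((r + 3) ^ j)%N) (J0 := 2) (fun j => erefl) c0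
  (rate_scale r sigma D4) (fun j => erefl) (scale_sum r3) s0 smono sunb muE psi monoS.
exists w; split.
- exists n0 => // n /= hn; apply: deficiency_le => p hp.
  rewrite (P_law PE) leNgt; apply/negP => lt; apply: (hdef n hn).
  by exists p => //; rewrite size_pre.
- exact: (@limsup_complexity _ _ (scale r) (fun j => ((r + 3) ^ j)%N) rr _ (u_ge gt0 growth)).
exact: (liminf_complexity optK gt0 (u_ge gt0 growth) ms eps0 hrr).
Qed.
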